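(* Suppose there exist a constant $\kappa>0$ and a nondecreasing, continuously differentiable function $\zeta:[0,\infty)\to[1,\infty)$ with $\int_0^\infty \frac{dr}{r\zeta(r)+1}=\infty$ such that for all $x\in\mathbb R^d$ $$2\langle x,b(x)\rangle+|\sigma(x)|^2+\int_U|c(x,u)|^2\,\nu(du)\le \kappa\,[\,|x|^2\zeta(|x|^2)+1\,].$$ Then any solution $X$ of the stochastic differential equation $$dX(t)=b(X(t))\,dt+\sigma(X(t))\,dW(t)+\int_U c(X(t-),u)\,\widetilde N(dt,du)$$ is non-explosive.
   Context: Let $d\ge2$, $(U,\mathfrak U)$ a measurable space, $\nu$ a $\sigma$-finite measure on $U$. The functions $b:\mathbb R^d\to\mathbb R^d$, $\sigma:\mathbb R^d\to\mathbb R^{d\times d}$, $c:\mathbb R^d\times U\to\mathbb R^d$ are Borel measurable; $b$, $\sigma$ and $c(\cdot,u)$ (for each $u\in U$) are continuous, and $x\mapsto\int_U|c(x,u)|^2\nu(du)$ is continuous. For a matrix or vector $A$, $|A|=\sqrt{\mathrm{tr}(AA^T)}$. On a filtered probability space $(\Omega,\mathcal F,\{\mathcal F_t\},\mathbb P)$ satisfying the usual hypotheses, $W$ is a standard $d$-dimensional $\{\mathcal F_t\}$-Brownian motion, $N$ is the Poisson random measure on $[0,\infty)\times U$ with intensity $dt\,\nu(du)$ associated with an $\{\mathcal F_t\}$-Poisson point process $p$ on $U$ independent of $W$, and $\widetilde N$ is its compensated measure. A (weak) solution up to an explosion time is an $\mathbb R^d$-valued càdlàg $\{\mathcal F_t\}$-adapted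 process $X$ with $X(0)$ $\mathcal F_0$-measurable such that, with $\tau_n=\inf\{t\ge0:|X(t)|>n\}$, the integral form of the equation holds at time $t\wedge\tau_n$ for all $n\in\mathbb N$ and $t\ge0$ a.s. The explosion time is $\tau=\lim_{n\to\infty}\tau_n$; $X$ is non-explosive if $\mathbb P\{\tau<\infty\}=0$. *)

(* Defs.v *)
From HB Require Import structures.
From mathcomp Require Import all_boot all_order all_algebra.
From mathcomp Require Import all_classical all_reals all_analysis.

Set Implicit Arguments.
Unset Strict Implicit.
Unset Printing Implicit Defensive.
Import Order.TTheory GRing.Theory Num.Theory.
Import numFieldNormedType.Exports.
Local Open Scope classical_set_scope.
Local Open Scope ring_scope.

Section euclidean.
Context {R : realType}.

(* The library norm on matrices is the sup norm; it induces the same topology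
   and Borel sets, but sizes below are measured by this Euclidean
   (Hilbert-Schmidt) norm. *)
Definition enorm {m n : nat} (A : 'M[R]_(m, n)) : R :=
  Num.sqrt (\tr (A *m A^T)).

Definition dotv {d : nat} (x y : 'cV[R]_d) : R := \sum_(i < d) x i 0 * y i 0.

Definition borel_mx (m n : nat) := g_sigma_algebraType (@open 'M[R]_(m, n)).

End euclidean.
Arguments borel_mx : clear implicits.

Section calculus.
Context {R : realType}.

(* Continuous differentiability on the closed half-line; the derivative is
   one-sided at 0, and values of f at negative arguments play no role. *)
Definition C1_halfline (f : R -> R) : Prop :=
  exists2 df : R -> R,
    {within `[0, +oo[, continuous df} &
    forall r, 0 <= r ->
      (f s - f r) / (s - r) @[s --> within [set s | 0 <= s /\ s != r] (nbhs r)]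
        --> df r.

Definition cadlag_on {E : topologicalType} (I : set R) (f : R -> E) : Prop :=
  forall t, I t ->
    (f s @[s --> t^'+] --> f t) /\ (0 < t -> exists y : E, f s @[s --> t^'-] --> y).

Definition leftlim {E : ptopologicalType} (f : R -> E) (s : R) : E :=
  lim (f r @[r --> s^'-]).

End calculus.

Section stochastic_basis.
Context {R : realType} {dT : measure_display} {T : measurableType dT}.
Variable P : probability T R.

Definition usual_conditions (F : R -> set (set T)) : Prop :=
  [/\ forall t, 0 <= t -> sigma_algebra setT (F t) /\ F t `<=` measurable,
      forall s t, 0 <= s -> s <= t -> F s `<=` F t,
      forall t, 0 <= t -> \bigcap_(s in `]t, +oo[) F s `<=` F t &
      P.-negligible `<=` F 0].

Variable F : R -> set (set T).

Definition adapted {m n : nat} (X : R -> T -> 'M[R]_(m, n)) : Prop :=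
  forall t, 0 <= t ->
    forall B : set (borel_mx R m n), measurable B -> F t (X t @^-1` B).

Definition brownian_motion {d : nat} (W : R -> T -> 'cV[R]_d) : Prop :=
  [/\ adapted W,
      {ae P, forall w, W 0 w = 0},
      {ae P, forall w, {within `[0, +oo[, continuous (W ^~ w)}} &
      (* W t - W s is independent of F s and has law N(0, (t - s) I_d) *)
      forall (s t : R) (E : set T) (B : 'I_d -> set R),
        0 <= s -> s < t -> F s E -> (forall i, measurable (B i)) ->
        P (E `&` [set w | forall i, B i (W t w i 0 - W s w i 0)]) =
        (P E * \big[*%E/1]_(i < d) normal_prob 0 (Num.sqrt (t - s)) (B i))%E].

Section point_process.
Context {dU : measure_display} {U : measurableType dU}.
Variable nu : {sigma_finite_measure set U -> \bar R}.

(* A point process p on U is encoded as a random partial function of time: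
   p s w = Some u when p(w) jumps to u at time s, and p s w = None when s is
   not in the (countable) domain of p(w). *)
Definition point_process (p : R -> T -> option U) : Prop :=
  forall w, countable [set s | p s w <> None] /\
            [set s | p s w <> None] `<=` `]0, +oo[.

Definition jump_measure (p : R -> T -> option U) (w : T) (A : set (R * U)) :
    \bar R :=
  counting [set s | exists2 u, p s w = Some u & A (s, u)].

(* Unlike the library's poisson_pmf, this is the right mass (Dirac at 0) also
   for the rate 0. *)
Definition poisson_mass (l : R) (k : nat) : R :=
  l ^+ k / k`!%:R * expR (- l).

(* Sets of infinite intensity need not be mentioned: their counts are then
   a.s. infinite because nu is sigma-finite. *)
Definition poisson_point_process (p : R -> T -> option U) : Prop :=
  [/\ point_process p,
      forall (t : R) (A : set (R * U)) (k : nat),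
        0 <= t -> measurable A -> A `<=` `]0, t] `*` setT ->
        F t [set w | jump_measure p w A = k%:R%:E] &
      forall (s : R) (E : set T) (m : nat) (A : 'I_m -> set (R * U))
             (k : 'I_m -> nat),
        0 <= s -> F s E ->
        (forall i, [/\ measurable (A i), A i `<=` `]s, +oo[ `*` setT &
                       (lebesgue_measure \x nu) (A i) < +oo]%E) ->
        trivIset setT A ->
        P (E `&` [set w | forall i, jump_measure p w (A i) = (k i)%:R%:E]) =
        (P E * \big[*%E/1]_(i < m)
          (poisson_mass (fine ((lebesgue_measure \x nu) (A i))) (k i))%:E)%E].

Definition sigma_BM {d : nat} (W : R -> T -> 'cV[R]_d) : set (set T) :=
  <<s [set A | exists t (B : set (borel_mx R d 1)),
         [/\ 0 <= t, measurable B & A = W t @^-1` B]] >>.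

Definition sigma_PP (p : R -> T -> option U) : set (set T) :=
  <<s [set A | exists (C : set (R * U)) (k : nat),
         measurable C /\ A = [set w | jump_measure p w C = k%:R%:E]] >>.

Definition independent_BM_PP {d : nat} (W : R -> T -> 'cV[R]_d)
    (p : R -> T -> option U) : Prop :=
  forall A B, sigma_BM W A -> sigma_PP p B -> P (A `&` B) = (P A * P B)%E.

End point_process.

(* sum_k coef_k 1_(lo_k, hi_k], with coef_k bounded and F_(lo_k)-measurable *)
Record simple_process := SimpleProcess {
  sp_size : nat;
  sp_lo : 'I_sp_size -> R;
  sp_hi : 'I_sp_size -> R;
  sp_coef : 'I_sp_size -> T -> R;
  sp_lo_ge0 : forall k, 0 <= sp_lo k;
  sp_lo_le_hi : forall k, sp_lo k <= sp_hi k;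
  sp_coef_meas : forall k (B : set R), measurable B ->
    F (sp_lo k) (sp_coef k @^-1` B);
  sp_coef_bounded : forall k, exists M, forall w, `|sp_coef k w| <= M }.
Arguments sp_lo : clear implicits.
Arguments sp_hi : clear implicits.
Arguments sp_coef : clear implicits.

Definition sp_val (h : simple_process) (s : R) (w : T) : R :=
  \sum_k sp_coef h k w * \1_(`]sp_lo h k, sp_hi h k]) s.

Definition sp_integral (h : simple_process) (B : R -> T -> R) (t : R) (w : T) :
    R :=
  \sum_k sp_coef h k w *
    (B (Num.min (sp_hi h k) t) w - B (Num.min (sp_lo h k) t) w).

(* I is (a version of) the Ito integral of H over (0, t] with respect to the
   real Brownian motion B: the L2 limit of the integrals of simple processes
   approximating H in L2(P (x) ds). *)
Definition is_ito_integral (B : R -> T -> R) (H : R -> T -> R) (t : R)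
    (I : T -> R) : Prop :=
  [/\ measurable_fun setT (fun z : R * T => H z.1 z.2),
      measurable_fun setT I &
      exists h : nat -> simple_process,
        (\int[P]_w \int[lebesgue_measure]_(s in `]0%R, t])
            ((sp_val (h k) s w - H s w) ^+ 2)%:E @[k --> \oo] --> 0)%E /\
        (\int[P]_w ((sp_integral (h k) B t w - I w) ^+ 2)%:E
            @[k --> \oo] --> 0)%E].

Section compensated.
Context {dU : measure_display} {U : measurableType dU}.
Variable nu : {sigma_finite_measure set U -> \bar R}.

(* sum_k coef_k 1_(lo_k, hi_k] 1_(B_k) with nu(B_k) finite *)
Record simple_field := SimpleField {
  sf_base :> simple_process;
  sf_set : 'I_(sp_size sf_base) -> set U;
  sf_set_meas : forall k, measurable (sf_set k);
  sf_set_fin : forall k, (nu (sf_set k) < +oo)%E }.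
Arguments sf_set : clear implicits.

Definition sf_val (h : simple_field) (s : R) (u : U) (w : T) : R :=
  \sum_k sp_coef h k w * \1_(`]sp_lo h k, sp_hi h k]) s * \1_(sf_set h k) u.

Definition compensated_measure (N : T -> set (R * U) -> \bar R)
    (a b : R) (B : set U) (w : T) : R :=
  fine (N w (`]a, b] `*` B)) - (b - a) * fine (nu B).

Definition sf_integral (h : simple_field) (N : T -> set (R * U) -> \bar R)
    (t : R) (w : T) : R :=
  \sum_k sp_coef h k w *
    compensated_measure N (Num.min (sp_lo h k) t) (Num.min (sp_hi h k) t)
      (sf_set h k) w.

(* I is (a version of) the integral of H over (0, t] x U with respect to the
   compensated measure of N: again the L2 limit along simple integrands, now
   approximating H in L2(P (x) ds (x) nu). *)
Definition is_compensated_integral (N : T -> set (R * U) -> \bar R)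
    (H : R -> U -> T -> R) (t : R) (I : T -> R) : Prop :=
  [/\ measurable_fun setT (fun z : R * U * T => H z.1.1 z.1.2 z.2),
      measurable_fun setT I &
      exists h : nat -> simple_field,
        (\int[P]_w \int[lebesgue_measure]_(s in `]0%R, t]) \int[nu]_u
            ((sf_val (h k) s u w - H s u w) ^+ 2)%:E @[k --> \oo] --> 0)%E /\
        (\int[P]_w ((sf_integral (h k) N t w - I w) ^+ 2)%:E
            @[k --> \oo] --> 0)%E].

End compensated.
End stochastic_basis.

Section sde.
Context {R : realType} {dT : measure_display} {T : measurableType dT}.
Context {d : nat}.

Definition exit_time (X : R -> T -> 'cV[R]_d) (n : nat) (w : T) : \bar R :=
  ereal_inf [set t%:E | t in [set t | 0 <= t /\ n%:R < enorm (X t w)]].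

Definition explosion_time (X : R -> T -> 'cV[R]_d) (w : T) : \bar R :=
  limn (fun n => exit_time X n w).

Definition non_explosive (P : probability T R) (X : R -> T -> 'cV[R]_d) :=
  P [set w | (explosion_time X w < +oo)%E] = 0%E.

(* The time t /\ tau_n; it is finite since t is. *)
Definition stopped_time (X : R -> T -> 'cV[R]_d) (n : nat) (t : R) (w : T) : R :=
  fine (mine t%:E (exit_time X n w)).

(* The indicator of the stochastic interval (0, tau_n]: the stochastic
   integrals up to t /\ tau_n are those over (0, t] of the integrands multiplied
   by it. The stopped integrands are bounded in the relevant L2 sense, so no
   further localization is needed. *)
Definition stop_ind (X : R -> T -> 'cV[R]_d) (n : nat) (s : R) (w : T) : R :=
  ((0 < s) && (s%:E <= exit_time X n w)%E)%:R.

Context {dU : measure_display} {U : measurableType dU}.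
Variable nu : {sigma_finite_measure set U -> \bar R}.
Variables (b : 'cV[R]_d -> 'cV[R]_d) (sigma : 'cV[R]_d -> 'M[R]_d)
  (c : 'cV[R]_d -> U -> 'cV[R]_d).

(* Solution up to the explosion time tau = lim tau_n. Paths are required to be
   cadlag on each [0, tau_n], hence on [0, tau), and may be arbitrary from tau
   on. (An R^d-valued path that is cadlag on all of [0, +oo) is locally bounded,
   so it would have tau = +oo automatically. Right-continuity at tau_n itself
   gives tau_n < tau when tau_n is finite, so that values from tau on
   do not influence tau_n.) *)
Definition sde_solution (P : probability T R) (F : R -> set (set T))
    (W : R -> T -> 'cV[R]_d) (p : R -> T -> option U)
    (X : R -> T -> 'cV[R]_d) : Prop :=
  [/\ adapted F X,
      forall n w,
        cadlag_on [set t | 0 <= t /\ (t%:E <= exit_time X n w)%E] (X ^~ w) &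
      forall (n : nat) (t : R), 0 <= t ->
        exists (IW : 'I_d -> 'I_d -> T -> R) (IN : 'I_d -> T -> R),
        [/\ forall i j, is_ito_integral P F (fun s w => W s w j 0)
              (fun s w => sigma (X s w) i j * stop_ind X n s w) t (IW i j),
            forall i, is_compensated_integral P F nu (jump_measure p)
              (fun s u w => c (leftlim (X ^~ w) s) u i 0 * stop_ind X n s w)
              t (IN i) &
            {ae P, forall w, forall i : 'I_d,
              X (stopped_time X n t w) w i 0 =
                X 0 w i 0
                + \int[lebesgue_measure]_(s in `]0%R, stopped_time X n t w])
                    (b (X s w) i 0)
                + \sum_(j < d) IW i j w
                + IN i w}]].

End sde.

(* Main.v *)
Require Import Defs.
From HB Require Import structures.
From mathcomp Require Import all_boot all_order all_algebra.
From mathcomp Require Import all_classical all_reals all_analysis.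
From mathcomp Require Import measurable_realfun.
From mathcomp Require Import finmap ring lra.
Set Implicit Arguments.
Unset Strict Implicit.
Unset Printing Implicit Defensive.
Import Order.TTheory GRing.Theory Num.Theory.
Import numFieldNormedType.Exports.
Local Open Scope classical_set_scope.
Local Open Scope ring_scope.

(* Let [psi r] be the integral of [1 / h] over [0, r], with [h s = s zeta s + 1].
   As [h] is nondecreasing, [psi] is concave, and it is unbounded by hypothesis.
   Concavity replaces the Ito formula: over a subdivision [t_k] of [0, t], the
   increment of [psi (|X|^2)] along the path stopped at [tau_n] is at most that of
   [|X|^2] divided by [h (|X (t_k)|^2)]. Increments of [|X|^2] only involve first
   and second conditional moments of the stochastic integrals: the former vanish,
   the latter are given by the isometry and by the orthogonality of the components
   of [W] and of the compensated jumps. The growth condition bounds the sum by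
   [kappa t] up to an error which vanishes with the mesh, hence
   [psi (n^2) P (|X 0| <= m, tau_n < t) <= psi (m^2) + kappa t].
   Letting [n] tend to infinity, [P (|X 0| <= m, explosion before t) = 0]. *)

(** * Expectation *)

(** The stochastic integrals are given only at fixed times, as L2 limits along simple integrands.
    Everything therefore passes through moments of increments, tested against bounded
    [F s]-measurable factors. Concavity suits this: the tangent slope [1 / h (|X s|^2)] at the left
    end of a step is such a factor, with values in [0, 1]. Two errors must vanish. The growth
    condition is available at [X r], for [r] inside a step, while the slope is taken at [X s]; since
    the path is left-continuous at almost every time before the exit, dominated convergence removes
    the discrepancy. The square of drift plus martingale increment has a cross term, absorbed with a
    parameter [e]: the martingale square gets the factor [1 + e], and the drift square, of second
    order in the mesh, gets [1 + 1/e]. Hence the mesh tends to 0 before [e] does. At its exit a path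
    may jump far out of the ball of radius [n]. The coefficients are bounded before the exit, and
    the isometry already accounts for the jump. No moment of [X 0] is assumed, hence the restriction
    to [|X 0| <= m]. *)

Section expectation.
Context {R : realType} {dT : measure_display} {T : measurableType dT}.
Variable P : probability T R.
Implicit Types (f g Y : T -> R) (a : R).

Definition Lone f := P.-integrable setT (EFin \o f).

Definition Ltwo f := measurable_fun setT f /\ Lone (fun w => f w ^+ 2).

(** The value is a default one when [f] is not integrable, which is why the linearity lemmas below
    carry [Lone] hypotheses. *)
Definition ex f : R := \int[P]_w f w.

Lemma Lone_meas f : Lone f -> measurable_fun setT f.
Proof. by move=> /measurable_int/measurable_EFinP. Qed.

Lemma LoneD f g : Lone f -> Lone g -> Lone (fun w => f w + g w).
Proof. by move=> Lf Lg; exact: (integrableD measurableT Lf Lg). Qed.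

Lemma LoneZ a f : Lone f -> Lone (fun w => a * f w).
Proof. by move=> Lf; exact: (integrableZl measurableT a Lf). Qed.

Lemma LoneN f : Lone f -> Lone (fun w => - f w).
Proof. by move=> Lf; exact: (integrableN Lf). Qed.

Lemma LoneB f g : Lone f -> Lone g -> Lone (fun w => f w - g w).
Proof. by move=> Lf Lg; apply: LoneD => //; exact: LoneN. Qed.

Lemma Lone_le f g : measurable_fun setT f -> (forall w, `|f w| <= `|g w|) ->
  Lone g -> Lone f.
Proof.
move=> mf fg Lg; apply: (le_integrable measurableT _ _ Lg).
  exact/measurable_EFinP.
by move=> w _; rewrite /= lee_fin.
Qed.

Lemma Lone_cst a : Lone (cst a).
Proof. exact: finite_measure_integrable_cst. Qed.

Lemma Lone_bounded f a : measurable_fun setT f -> (forall w, `|f w| <= a) ->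
  Lone f.
Proof.
move=> mf fa; apply: (@Lone_le _ (cst a)) => //; last exact: Lone_cst.
by move=> w; rewrite (le_trans (fa w))//= ler_norm.
Qed.

Lemma Lone_sum (I : Type) (r : seq I) (F : I -> T -> R) :
  (forall i, Lone (F i)) -> Lone (fun w => \sum_(i <- r) F i w).
Proof.
move=> LF; elim: r => [|i r ih].
  by under eq_fun do rewrite big_nil; exact: Lone_cst.
by under eq_fun do rewrite big_cons; exact: LoneD.
Qed.

Lemma LoneM_bounded f g a : Lone f -> measurable_fun setT g ->
  (forall w, `|g w| <= a) -> Lone (fun w => g w * f w).
Proof.
move=> Lf mg ga; apply: (@Lone_le _ (fun w => a * f w)); last exact: LoneZ.
  by apply: measurable_funM => //; exact: Lone_meas.
move=> w; rewrite !normrM ler_wpM2r// (le_trans (ga w))// ler_norm//.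
Qed.

Lemma Lone_ae f g : measurable_fun setT g -> {ae P, forall w, f w = g w} ->
  Lone f -> Lone g.
Proof.
move=> mg fg /integrableP[mf fi]; apply/integrableP; split.
  exact/measurable_EFinP.
rewrite (ge0_ae_eq_integral measurableT _ _ _ _
  (_ : ae_eq P setT _ (abse \o (EFin \o f)))) //.
- by do 2 apply: measurableT_comp => //; exact/measurable_EFinP.
- by apply: measurableT_comp.
- by move=> w _ /=; rewrite lee_fin.
- by apply: filterS fg => w fg _ /=; rewrite fg.
Qed.

Lemma exD f g : Lone f -> Lone g -> ex (fun w => f w + g w) = ex f + ex g.
Proof. by move=> Lf Lg; exact: RintegralD. Qed.

Lemma exB f g : Lone f -> Lone g -> ex (fun w => f w - g w) = ex f - ex g.
Proof. by move=> Lf Lg; exact: RintegralB. Qed.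

Lemma exZ a f : Lone f -> ex (fun w => a * f w) = a * ex f.
Proof. by move=> Lf; exact: RintegralZl. Qed.

Lemma ex_cst a : ex (cst a) = a.
Proof. rewrite /ex Rintegral_cst// -[RHS]mulr1; congr (a * _).
exact: (congr1 fine (probability_setT P)). Qed.

Lemma ex_ge0 f : (forall w, 0 <= f w) -> 0 <= ex f.
Proof. by move=> f0; apply: Rintegral_ge0. Qed.

Lemma ex_le f g : Lone f -> Lone g -> (forall w, f w <= g w) -> ex f <= ex g.
Proof. by move=> Lf Lg fg; apply: le_Rintegral. Qed.

Lemma ex_ae f g : measurable_fun setT f -> measurable_fun setT g ->
  {ae P, forall w, f w = g w} -> ex f = ex g.
Proof.
move=> mf mg fg; congr fine; apply: ae_eq_integral => //.
- exact/measurable_EFinP.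
- exact/measurable_EFinP.
- by move: fg; apply: filterS => w fg _ /=; rewrite fg.
Qed.

Lemma ex_norm_le f : Lone f -> `|ex f| <= ex (fun w => `|f w|).
Proof. by move=> Lf; apply: le_normr_Rintegral. Qed.

Lemma ex_sum (I : Type) (r : seq I) (F : I -> T -> R) :
  (forall i, Lone (F i)) ->
  ex (fun w => \sum_(i <- r) F i w) = \sum_(i <- r) ex (F i).
Proof.
move=> LF; elim: r => [|i r ih].
  rewrite big_nil -[RHS](ex_cst 0); congr ex.
  by apply/funext => w; rewrite big_nil.
rewrite big_cons -ih -exD//; last exact: Lone_sum.
by congr ex; apply/funext => w; rewrite big_cons.
Qed.

Lemma EFin_ex f : Lone f -> ((ex f)%:E = \int[P]_w (f w)%:E)%E.
Proof. by move=> Lf; rewrite fineK//; exact: integrable_fin_num. Qed.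

Lemma Lone_ge0P f : measurable_fun setT f -> (forall w, 0 <= f w) ->
  (\int[P]_w (f w)%:E < +oo)%E -> Lone f.
Proof.
move=> mf f0 fi; apply/integrableP; split; first exact/measurable_EFinP.
by under eq_integral do rewrite /= ger0_norm//.
Qed.

Lemma Ltwo_meas f : Ltwo f -> measurable_fun setT f.
Proof. by case. Qed.

Lemma Ltwo_mul f g : Ltwo f -> Ltwo g -> Lone (fun w => f w * g w).
Proof.
move=> [mf Lf] [mg Lg]; apply: (@Lone_le _ (fun w => f w ^+ 2 + g w ^+ 2)).
- exact: measurable_funM.
- move=> w; rewrite [leRHS]ger0_norm ?addr_ge0 ?sqr_ge0//.
  have := sqr_ge0 (f w - g w); have := sqr_ge0 (f w + g w).
  by rewrite ler_norml; nra.
- exact: LoneD.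
Qed.

Lemma Ltwo_cst a : Ltwo (cst a).
Proof. by split => //; exact: (Lone_cst (a ^+ 2)). Qed.

Lemma Ltwo_Lone f : Ltwo f -> Lone f.
Proof.
move=> /Ltwo_mul-/(_ _ (Ltwo_cst 1)); apply: eq_ind; congr Lone.
by apply/funext => w; rewrite mulr1.
Qed.

Lemma LtwoD f g : Ltwo f -> Ltwo g -> Ltwo (fun w => f w + g w).
Proof.
move=> Lf Lg; split; first by apply: measurable_funD; apply: Ltwo_meas.
rewrite (_ : (fun w => _) = fun w => f w ^+ 2 + 2 * (f w * g w) + g w ^+ 2).
  apply: LoneD; last exact: Lg.2.
  by apply: LoneD; [exact: Lf.2|apply: LoneZ; exact: Ltwo_mul].
by apply/funext => w; ring.
Qed.

Lemma LtwoM_bounded f g a : Ltwo f -> measurable_fun setT g ->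
  (forall w, `|g w| <= a) -> Ltwo (fun w => g w * f w).
Proof.
move=> Lf mg ga; split; first by apply: measurable_funM => //; case: Lf.
under eq_fun do rewrite exprMn.
apply: (@LoneM_bounded _ _ (a ^+ 2)); first exact: Lf.2.
  exact: measurable_funX.
by move=> w; rewrite normrX ler_pXn2r// nnegrE (le_trans _ (ga w)).
Qed.

Lemma LtwoZ a f : Ltwo f -> Ltwo (fun w => a * f w).
Proof. by move=> Lf; apply: (@LtwoM_bounded _ (cst a) `|a|). Qed.

Lemma LtwoB f g : Ltwo f -> Ltwo g -> Ltwo (fun w => f w - g w).
Proof.
move=> Lf Lg; under eq_fun do rewrite -mulN1r.
by apply: LtwoD => //; exact: LtwoZ.
Qed.

Lemma Ltwo_sum (I : Type) (r : seq I) (F : I -> T -> R) :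
  (forall i, Ltwo (F i)) -> Ltwo (fun w => \sum_(i <- r) F i w).
Proof.
move=> LF; elim: r => [|i r ih].
  by under eq_fun do rewrite big_nil; exact: Ltwo_cst.
by under eq_fun do rewrite big_cons; exact: LtwoD.
Qed.

Lemma Ltwo_ae f g : measurable_fun setT g -> {ae P, forall w, f w = g w} ->
  Ltwo f -> Ltwo g.
Proof.
move=> mg fg [mf Lf]; split => //; apply: (Lone_ae _ _ Lf).
  exact: measurable_funX.
by move: fg; apply: filterS => w ->.
Qed.

Lemma Ltwo_bounded f a : measurable_fun setT f -> (forall w, `|f w| <= a) ->
  Ltwo f.
Proof.
move=> mf fa; split => //; apply: (@Lone_bounded _ (a ^+ 2)).
  exact: measurable_funX.
by move=> w; rewrite normrX ler_pXn2r// nnegrE (le_trans _ (fa w)).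
Qed.

Lemma ex_indic E : measurable E -> ex \1_E = fine (P E).
Proof. by move=> mE; rewrite /ex /Rintegral integral_indic// setIT. Qed.

Lemma ex_dominated (F : nat -> T -> R) f g :
  (forall k, measurable_fun setT (F k)) -> measurable_fun setT f -> Lone g ->
  {ae P, forall w, F ^~ w @ \oo --> f w} ->
  {ae P, forall w k, `|F k w| <= g w} ->
  ex (F k) @[k --> \oo] --> ex f.
Proof.
move=> mF mf Lg Ff Fg.
have [] := @dominated_convergence _ T R P setT measurableT
    (fun k w => (F k w)%:E) (fun w => (f w)%:E) (EFin \o g).
- by move=> k; exact/measurable_EFinP.
- exact/measurable_EFinP.
- by apply: filterS Ff => w Fw _; apply: cvg_EFin => //; exact: nearW.
- exact: Lg.
- by apply: filterS Fg => w Fw k _ /=; rewrite lee_fin.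
move=> Lf _; rewrite -(EFin_ex Lf) => /fine_cvg; exact.
Qed.

Import HBNNSimple.

(** Simple functions increasing to [phi] reduce the claim to indicators of events of [Y]; the limit
    is dominated by the integrable function [|phi (Y) f|]. *)
Let ex_orth_ge0 f Y (phi : R -> R) : measurable_fun setT Y -> Lone f ->
  (forall B, measurable B -> ex (fun w => \1_B (Y w) * f w) = 0) ->
  measurable_fun setT phi -> (forall x, 0 <= phi x) ->
  Lone (fun w => phi (Y w) * f w) -> ex (fun w => phi (Y w) * f w) = 0.
Proof.
move=> mY Lf fB mphi phi0 Lpf.
have mphi' : measurable_fun setT (EFin \o phi) by exact/measurable_EFinP.
pose g := nnsfun_approx measurableT mphi'.
have g0 k : ex (fun w => g k (Y w) * f w) = 0.
  have -> : (fun w => g k (Y w) * f w) = (fun w =>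
      \sum_(y <- fset_set (range (g k)))
        y * (\1_(g k @^-1` [set y]) (Y w) * f w)).
    apply/funext => w; rewrite {1}fimfunE fsbig_finite//= mulr_suml.
    by apply: eq_bigr => y _; rewrite mulrA.
  have L1 y : Lone (fun w => \1_(g k @^-1` [set y]) (Y w) * f w).
    apply: (@LoneM_bounded _ _ 1) => //.
      by apply: measurableT_comp => //; exact: measurable_indic.
    by move=> w; rewrite ger0_norm// indicE; case: (_ \in _).
  rewrite ex_sum; last by move=> y; exact: LoneZ.
  by apply: big1 => y _; rewrite exZ// fB ?mulr0.
have gphi k x : g k x <= phi x.
  by rewrite -lee_fin /g nnsfun_approxE; apply: le_approx => // y _; rewrite lee_fin.
have Lg k : measurable_fun setT (fun w => g k (Y w) * f w).
  by apply: measurable_funM; [exact: measurableT_comp|exact: Lone_meas].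
have := @ex_dominated (fun k w => g k (Y w) * f w) (fun w => phi (Y w) * f w)
    (fun w => `|phi (Y w) * f w|) Lg (Lone_meas Lpf) (integrable_norm Lpf).
rewrite (_ : (fun k => _) = cst 0); last by apply/funext => k; rewrite g0.
move=> H; apply/esym; apply: (cvg_unique _ (@cvg_cst _ _ nat _ _) (H _ _)) => //.
- apply: aeW => w; apply: cvgM; last exact: cvg_cst.
  have /fine_cvg := @cvg_nnsfun_approx _ _ _ _ measurableT _ mphi'
    (fun x _ => phi0 x) (Y w) I.
  exact.
- apply: aeW => w k; rewrite !normrM ler_wpM2r// !ger0_norm//.
Qed.

(** This takes a measurable factor out of a conditional expectation without defining one: that [f]
    has conditional mean 0 given [Y] is tested on the events of [Y]. The positive and negative parts
    of [Y] are handled separately, both products being dominated by [|Y f|]. *)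
Lemma ex_orth f Y : measurable_fun setT Y -> Lone f ->
  (forall B, measurable B -> ex (fun w => \1_B (Y w) * f w) = 0) ->
  Lone (fun w => Y w * f w) -> ex (fun w => Y w * f w) = 0.
Proof.
move=> mY Lf fB LYf.
have Lp (s : R) : `|s| = 1 -> Lone (fun w => Num.max (s * Y w) 0 * f w).
  move=> s1; apply: (Lone_le _ _ LYf).
    apply: measurable_funM; last exact: Lone_meas.
    by apply: measurable_maxr => //; exact: measurable_funM.
  move=> w; rewrite !normrM ler_wpM2r//.
  rewrite ger0_norm ?le_max ?lexx ?orbT// ge_max normr_ge0 andbT.
  by rewrite (le_trans (ler_norm _))// normrM s1 mul1r.
have E0 (s : R) : `|s| = 1 -> ex (fun w => Num.max (s * Y w) 0 * f w) = 0.
  move=> s1; apply: (@ex_orth_ge0 f Y (fun x => Num.max (s * x) 0)) => //.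
  - by apply: measurable_maxr => //; exact: measurable_funM.
  - by move=> x; rewrite le_max lexx orbT.
  - exact: Lp.
have -> : (fun w => Y w * f w) =
    (fun w => Num.max (1 * Y w) 0 * f w - Num.max (-1 * Y w) 0 * f w).
  apply/funext => w; rewrite -mulrBl; congr (_ * _).
  by rewrite !maxEle; do 2 case: ifPn; rewrite -?ltNge; lra.
rewrite exB; last 2 first.
- by apply: Lp; rewrite normr1.
- by apply: Lp; rewrite normrN1.
by rewrite !E0 ?normr1 ?normrN1// subrr.
Qed.

End expectation.

(** * Gaussian moments *)

Section transfer.
Context {R : realType}.
Local Open Scope ereal_scope.
Import HBNNSimple.

(* An identity between two weighted integrals of indicators extends to all
   nonnegative measurable functions: this covers densities and image laws. *)
Lemma ge0_integral_transfer {d1 d2} {T : measurableType d1}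
    {S : measurableType d2} (m1 : {measure set T -> \bar R})
    (m2 : {measure set S -> \bar R}) (D : T -> S) (g : T -> R) (h f : S -> R) :
  measurable_fun setT D -> measurable_fun setT g -> measurable_fun setT h ->
  (forall x, 0 <= g x)%R -> (forall x, 0 <= h x)%R ->
  (forall B, measurable B -> \int[m1]_w (g w * \1_B (D w))%:E =
     \int[m2]_x (h x * \1_B x)%:E) ->
  measurable_fun setT f -> (forall x, 0 <= f x)%R ->
  \int[m1]_w (g w * f (D w))%:E = \int[m2]_x (h x * f x)%:E.
Proof.
move=> mD mg mh g0 h0 gh mf f0.
have mf' : measurable_fun setT (EFin \o f) by exact/measurable_EFinP.
pose k := nnsfun_approx measurableT mf'.
have kf x : (k n x)%:E @[n --> \oo] --> (f x)%:E.
  exact: (@cvg_nnsfun_approx _ _ _ _ measurableT _ mf' (fun x _ => f0 x) x I).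
have kl d (V : measurableType d) (m : {measure set V -> \bar R}) (E : V -> S)
    (r : V -> R) : measurable_fun setT E -> measurable_fun setT r ->
    (forall x, 0 <= r x)%R ->
    \int[m]_w (r w * f (E w))%:E = limn (fun n => \int[m]_w (r w * k n (E w))%:E).
  move=> mE mr r0; rewrite -monotone_convergence//.
  - apply: eq_integral => w _; apply/esym/cvg_lim => //.
    under eq_fun do rewrite EFinM; rewrite EFinM.
    by apply: cvgeZl => //; exact: kf.
  - move=> n; apply/measurable_EFinP; apply: measurable_funM => //.
    exact: measurableT_comp.
  - by move=> n w _; rewrite lee_fin mulr_ge0.
  - move=> w _ n m' nm; rewrite lee_fin ler_wpM2l//.
    exact/lefP/nd_nnsfun_approx.
rewrite kl// (kl _ S m2 id h)//; congr (limn _); apply/funext => n.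
have kE d (V : measurableType d) (m : {measure set V -> \bar R}) (E : V -> S)
    (r : V -> R) : measurable_fun setT E -> measurable_fun setT r ->
    (forall x, 0 <= r x)%R ->
    \int[m]_w (r w * k n (E w))%:E =
    \sum_(y <- fset_set (range (k n)))
      (y%:E * \int[m]_w (r w * \1_(k n @^-1` [set y]) (E w))%:E).
  move=> mE mr r0.
  have mi y : measurable_fun setT (fun w => r w * \1_(k n @^-1` [set y]) (E w))%R.
    by apply: measurable_funM => //; exact: measurableT_comp.
  transitivity (\int[m]_w (\sum_(y <- fset_set (range (k n)))
      (y * (r w * \1_(k n @^-1` [set y]) (E w)))%:E)).
    apply: eq_integral => w _; rewrite {1}fimfunE fsbig_finite//= mulr_sumr.
    rewrite sumEFin; congr (_%:E); apply: eq_bigr => y _.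
    by rewrite mulrCA.
  have ky y : y \in fset_set (range (k n)) -> (0 <= y)%R.
    by rewrite in_fset_set// => /set_mem[w _ <-].
  (* [ge0_integral_sum] asks for nonnegative terms at every index, not only at the values of [k n];
     truncating [y] at 0 provides this and changes nothing on the range. *)
  transitivity (\int[m]_w (\sum_(y <- fset_set (range (k n)))
      (Num.max y 0 * (r w * \1_(k n @^-1` [set y]) (E w)))%:E)).
    apply: eq_integral => w _; apply: eq_big_seq => y /ky y0.
    by rewrite (max_idPl y0).
  rewrite ge0_integral_sum//.
  - apply: eq_big_seq => y /ky y0.
    rewrite (max_idPl y0); under eq_integral do rewrite EFinM.
    rewrite ge0_integralZl//.
    + exact/measurable_EFinP.
    + by move=> w _; rewrite lee_fin mulr_ge0.
  - by move=> y; apply/measurable_EFinP; exact: measurable_funM.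
  - by move=> y w _; rewrite lee_fin !mulr_ge0// le_max lexx orbT.
rewrite kE// (kE _ S m2 id h)//; apply: eq_bigr => y _.
by rewrite gh.
Qed.

End transfer.

Section gaussian_moments.
Context {R : realType}.
Notation lam := (@lebesgue_measure R).
Variables (s : R) (s0 : 0 < s).

(** Multiplication by the exponential of a multiple of [x ^+ 2] only changes the width of a centred
    Gaussian. Parametrising by the ratio [r] of the standard deviations makes the exponential moment
    equal to [r] itself. *)
Let expR_normal_pdf (r x : R) : 0 < r ->
  expR ((1 - r ^- 2) / (2 * s ^+ 2) * x ^+ 2) * normal_pdf 0 s x =
  r * normal_pdf 0 (r * s) x.
Proof.
move=> r0; rewrite !normal_pdfE ?mulf_neq0 ?gt_eqF//.
rewrite /normal_peak /normal_fun !subr0.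
rewrite mulrCA -expRD [RHS]mulrA; congr (_ * expR _).
  rewrite (_ : (r * s) ^+ 2 * pi *+ 2 = r ^+ 2 * (s ^+ 2 * pi *+ 2)).
    rewrite sqrtrM ?sqr_ge0// sqrtr_sqr gtr0_norm// invfM mulrA divff ?gt_eqF//.
    by rewrite mul1r.
  by rewrite exprMn -mulrA mulrnAr.
have : r ^+ 2 != 0 by rewrite expf_neq0 ?gt_eqF.
have : s ^+ 2 != 0 by rewrite expf_neq0 ?gt_eqF.
rewrite exprMn -[_ *+ 2]mulr_natl -[X in _ = _ / X]mulr_natl.
move: (r ^+ 2) (s ^+ 2) (x ^+ 2) => a b' c' b0 a0.
by field; rewrite a0 b0.
Qed.

Let mpdf m t : measurable_fun setT (normal_pdf m t : R -> R).
Proof. exact: measurable_normal_pdf. Qed.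

Let x4 (x : R) : 0 <= x ^+ 4. Proof. exact: exprn_even_ge0. Qed.

Let mpX n : measurable_fun setT (fun x : R => normal_pdf 0 s x * x ^+ n).
Proof. by apply: measurable_funM => //; exact: measurable_funX. Qed.

Let integral_expR_normal (r : R) : 0 < r ->
  (\int[lam]_x (expR ((1 - r ^- 2) / (2 * s ^+ 2) * x ^+ 2) *
     normal_pdf 0 s x)%:E = r%:E)%E.
Proof.
move=> r0; under eq_integral do rewrite expR_normal_pdf// EFinM.
rewrite ge0_integralZl//.
- by rewrite integral_normal_pdf mule1.
- by apply/measurable_EFinP; exact: mpdf.
- by move=> x _; rewrite lee_fin normal_pdf_ge0.
- by rewrite lee_fin ltW.
Qed.

Let mexp (a : R) : measurable_fun setT (fun x : R => expR (a * x ^+ 2) * normal_pdf 0 s x).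
Proof.
by apply: measurable_funM => //; apply: measurableT_comp => //;
  apply: measurable_funM => //; exact: measurable_funX.
Qed.

(** Only finiteness and the order [s ^+ 4] matter later, so the exponential moment with [r = 2] and
    [exp y >= y ^+ 2 / 2] are precise enough. *)
Lemma normal_fourth_moment :
  (\int[lam]_x (normal_pdf 0 s x * x ^+ 4)%:E <= (64 * s ^+ 4)%:E)%E.
Proof.
have h2 : (0 : R) < 2 by [].
apply: (@le_trans _ _ (\int[lam]_x ((32 * s ^+ 4)%:E *
    (expR ((1 - 2 ^- 2) / (2 * s ^+ 2) * x ^+ 2) * normal_pdf 0 s x)%:E))%E).
  apply: ge0_le_integral => //.
  - by move=> x _; rewrite lee_fin mulr_ge0 ?normal_pdf_ge0// x4.
  - by apply/measurable_EFinP; exact: mpX.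
  - by apply: measurable_funeM; apply/measurable_EFinP; exact: mexp.
  move=> x _; rewrite -EFinM lee_fin [leLHS]mulrC mulrA ler_wpM2r ?normal_pdf_ge0//.
  set y := _ * x ^+ 2.
  have y0 : 0 <= y.
    rewrite /y (_ : 1 - 2 ^- 2 = 3 / 4); last by field.
    apply: mulr_ge0; last exact: sqr_ge0.
    by rewrite divr_ge0// mulr_ge0// ltW// exprn_gt0.
  have := expR_ge1Dxn 1 y0; rewrite /= (_ : 2`!%:R = 2 :> R)// => ye.
  (* Here [y = 3 x^2 / (8 s^2)], so this middle term is [9/4 x^4]. The constant 64 is 32 times the
     exponential moment [r = 2]. *)
  rewrite (le_trans (y := 32 * s ^+ 4 * (y ^+ 2 / 2)))//.
    rewrite /y (_ : _ * _ = 9 / 4 * x ^+ 4); last by field; rewrite gt_eqF.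
    by rewrite ler_peMl ?x4//; lra.
  apply: ler_wpM2l; first by rewrite mulr_ge0 ?exprn_ge0// ltW.
  by apply: le_trans ye; rewrite lerDr.
rewrite ge0_integralZl//.
- rewrite integral_expR_normal// -EFinM lee_fin.
  have : 0 <= s ^+ 4 by rewrite exprn_ge0// ltW.
  lra.
- by apply/measurable_EFinP; exact: mexp.
- by move=> x _; rewrite lee_fin mulr_ge0 ?expR_ge0 ?normal_pdf_ge0.
- by rewrite lee_fin mulr_ge0 ?exprn_ge0 ?ltW.
Qed.

(* Since [exp y >= 1 + y], each value [r] of the exponential moment of [x ^+ 2]
   bounds the second moment, from above for [r > 1] and from below for
   [r < 1]; both bounds tend to [s ^+ 2] as [r] tends to 1. *)
Lemma normal_second_moment :
  (\int[lam]_x (normal_pdf 0 s x * x ^+ 2)%:E = (s ^+ 2)%:E)%E.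
Proof.
have m20 := mpX 2.
have x20 x : 0 <= normal_pdf 0 s x * x ^+ 2.
  by rewrite mulr_ge0 ?normal_pdf_ge0// sqr_ge0.
have fin : lam.-integrable setT (EFin \o (fun x : R => (normal_pdf 0 s x * x ^+ 2))).
  apply: (@le_integrable _ _ R lam setT measurableT
    (EFin \o (fun x : R => normal_pdf 0 s x * x ^+ 2))
    (EFin \o (fun x : R => normal_pdf 0 s x * (1 + x ^+ 4)))).
  - exact/measurable_EFinP.
  - move=> x _; rewrite /= lee_fin.
    have q : 0 <= normal_pdf 0 s x * (1 + x ^+ 4).
      by rewrite mulr_ge0 ?normal_pdf_ge0// addr_ge0// x4.
    rewrite (ger0_norm (x20 x)) (ger0_norm q).
    apply: ler_wpM2l; first exact: normal_pdf_ge0.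
    have := x4 x.
    by have := sqr_ge0 (x ^+ 2 - 1); nra.
  - apply/integrableP; split.
      apply/measurable_EFinP.
      have : measurable_fun setT (fun x : R => normal_pdf 0 s x * (1 + x ^+ 4)).
        by apply: measurable_funM => //; exact: measurable_funD.
      exact.
    under eq_integral => x _.
      rewrite /= ger0_norm; last first.
        by rewrite mulr_ge0 ?normal_pdf_ge0 ?addr_ge0 ?x4.
      rewrite mulrDr mulr1 EFinD.
      over.
    rewrite ge0_integralD//.
    + rewrite integral_normal_pdf lte_add_pinfty ?ltry//.
      exact: le_lt_trans normal_fourth_moment (ltry _).
    + by move=> x _; rewrite lee_fin normal_pdf_ge0.
    + by apply/measurable_EFinP; exact: mpdf.
    + by move=> x _; rewrite lee_fin mulr_ge0 ?normal_pdf_ge0// x4.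
    + by apply/measurable_EFinP; exact: mpX.
pose m2 := \int[lam]_x (normal_pdf 0 s x * x ^+ 2).
have m2E : (\int[lam]_x (normal_pdf 0 s x * x ^+ 2)%:E = m2%:E)%E.
  by rewrite fineK//; exact: integrable_fin_num.
rewrite m2E; congr (_%:E).
have key r : 0 < r -> 1 + (1 - r ^- 2) / (2 * s ^+ 2) * m2 <= r.
  move=> r0; rewrite -lee_fin -(integral_expR_normal r0) EFinD EFinM -m2E.
  rewrite -integralZl// -(integral_normal_pdf 0 s) -integralD//; last 2 first.
  - exact: integrable_normal_pdf.
  - exact: integrableZl.
  apply: le_integral => //.
  - by apply: integrableD => //; [exact: integrable_normal_pdf|exact: integrableZl].
  - apply/integrableP; split; first by apply/measurable_EFinP; exact: mexp.
    under eq_integral do rewrite /= ger0_norm ?mulr_ge0 ?expR_ge0 ?normal_pdf_ge0//.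
    by rewrite integral_expR_normal// ltry.
  move=> x _; rewrite /= -EFinM -EFinD lee_fin.
  rewrite [_ * x ^+ 2]mulrC mulrA -[X in X + _]mul1r -mulrDl.
  rewrite ler_wpM2r ?normal_pdf_ge0//.
  exact: expR_ge1Dx.
have s2 : 0 < s ^+ 2 by rewrite exprn_gt0.
(* After division by [r - 1], whose sign decides the direction, this compares [m2] with
   [2 r^2 s^2 / (r + 1)], which equals [s^2] at [r = 1]. *)
have key2 r : 0 < r -> (r - 1) * ((r + 1) * m2 - 2 * r ^+ 2 * s ^+ 2) <= 0.
  move=> r0; have := key r r0.
  rewrite -lerBrDl mulrAC ler_pdivrMr ?mulr_gt0// => h.
  have r2 : 0 < r ^+ 2 by rewrite exprn_gt0.
  have : r ^+ 2 * ((1 - r ^- 2) * m2) <= r ^+ 2 * ((r - 1) * (2 * s ^+ 2)).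
    by rewrite ler_pM2l.
  rewrite mulrA mulrBr mulr1 divff ?gt_eqF// => h2; nra.
apply/eqP; rewrite eq_le; apply/andP; split; apply/ler_addgt0Pr => e e0.
  pose q := e / (2 * s ^+ 2).
  have q0 : 0 < q by rewrite divr_gt0// mulr_gt0.
  have eE : e = 2 * s ^+ 2 * q by rewrite /q; field; rewrite gt_eqF.
  have := key2 (1 + q) (ltac:(lra)).
  rewrite (_ : 1 + q - 1 = q); last by lra.
  rewrite pmulr_rle0// => h.
  rewrite eE -(ler_pM2l (_ : 0 < 2 + q)); last by lra.
  have q2 : 0 <= s ^+ 2 * q by rewrite mulr_ge0// ltW.
  nra.
have m20' : 0 <= m2 by apply: Rintegral_ge0 => x _.
(* Disposing of large [e] ensures [q < 1], so that [r = 1 - q] is positive. *)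
have [es|es] := leP (s ^+ 2) e; first by rewrite (le_trans es)// lerDr.
pose q := e / (2 * s ^+ 2).
have q0 : 0 < q by rewrite divr_gt0// mulr_gt0.
have eE : e = 2 * s ^+ 2 * q by rewrite /q; field; rewrite gt_eqF.
have q1 : q < 1 by rewrite /q ltr_pdivrMr ?mulr_gt0//; lra.
have := key2 (1 - q) (ltac:(lra)).
rewrite (_ : 1 - q - 1 = - q); last by lra.
rewrite mulNr oppr_le0 pmulr_rge0// => h.
rewrite eE -(ler_pM2l (_ : 0 < 2 - q)); last by lra.
have q2 : 0 <= s ^+ 2 * q by rewrite mulr_ge0// ltW.
nra.
Qed.

(** Applied to the positive part of the identity in [gauss_first]: the two halves of a Gaussian
    increment cancel in mean. *)
Lemma normal_symmetric (f : R -> R) : measurable_fun setT f ->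
  (forall x, 0 <= f x) ->
  (\int[lam]_x (normal_pdf 0 s x * f (- x))%:E =
   \int[lam]_x (normal_pdf 0 s x * f x)%:E)%E.
Proof.
move=> mf f0.
have mF : measurable_fun setT (fun x : R => (normal_pdf 0 s x * f x)%:E).
  by apply/measurable_EFinP; exact: measurable_funM.
transitivity (\int[pushforward lam (-%R : _ -> measurableTypeR R)]_x
    (normal_pdf 0 s x * f x)%:E)%E; last first.
  by apply: eq_measure_integral => A mA _; exact: lebesgue_measureN.
have mN : measurable_fun setT (-%R : measurableTypeR R -> measurableTypeR R).
  exact: (@oppr_measurable R).
rewrite (@ge0_integral_pushforward _ _ (measurableTypeR R) (measurableTypeR R) R
  (-%R) mN lam setT (fun x : R => (normal_pdf 0 s x * f x)%:E) measurableT mF).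
  apply: eq_integral => x _ /=; rewrite !normal_pdfE ?gt_eqF//.
  by rewrite /normal_fun !subr0 sqrrN.
by move=> x _; rewrite lee_fin mulr_ge0 ?normal_pdf_ge0.
Qed.

End gaussian_moments.

(** * Martingale increments and elementary sums *)

Section filtered.
Context {R : realType} {dT : measure_display} {T : measurableType dT}.
Variable P : probability T R.
Implicit Types (G : set (set T)) (Y Z f : T -> R).

(** Phrased on the space that carries the generated sigma-algebra, so that the algebra of measurable
    functions applies to it as it stands. *)
Definition meas_wrt G Y :=
  measurable_fun (setT : set (g_sigma_algebraType G)) (Y : g_sigma_algebraType G -> R).

Lemma meas_wrtP G Y : sigma_algebra setT G ->
  meas_wrt G Y <-> (forall B : set R, measurable B -> G (Y @^-1` B)).
Proof.
move=> sG; split=> [mY B mB|YG _ B mB]; last first.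
  by rewrite setTI; apply: sub_sigma_algebra; exact: YG.
have := mY measurableT B mB; rewrite setTI /measurable/= sigma_algebra_id//.
Qed.

Lemma meas_wrt_meas G Y : G `<=` measurable -> meas_wrt G Y ->
  measurable_fun setT Y.
Proof.
move=> sG mY _ B mB; have := mY measurableT B mB.
apply: smallest_sub => //; exact: sigma_algebra_measurable.
Qed.

Lemma meas_wrt_sub G G' Y : G `<=` G' -> meas_wrt G Y -> meas_wrt G' Y.
Proof.
move=> GG' mY _ B mB; have := mY measurableT B mB.
apply: smallest_sub; first exact: smallest_sigma_algebra.
by move=> A GA; apply: sub_sigma_algebra; exact: GG'.
Qed.

Lemma meas_wrt_indic G E : G E -> meas_wrt G \1_E.
Proof.
move=> GE; apply: (@measurable_indic _ (g_sigma_algebraType G)).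
exact: sub_sigma_algebra.
Qed.

Lemma meas_wrtM G Y Z : meas_wrt G Y -> meas_wrt G Z ->
  meas_wrt G (fun w => Y w * Z w).
Proof. by move=> mY mZ; exact: (measurable_funM mY mZ). Qed.

Lemma ex_orth_wrt G f Y : G `<=` measurable -> sigma_algebra setT G ->
  Lone P f -> (forall E, G E -> ex P (fun w => \1_E w * f w) = 0) ->
  meas_wrt G Y -> Lone P (fun w => Y w * f w) ->
  ex P (fun w => Y w * f w) = 0.
Proof.
move=> Gm sG Lf fG mY LYf; apply: ex_orth => //; first exact: (meas_wrt_meas Gm).
by move=> B mB; exact: (fG (Y @^-1` B) ((meas_wrtP Y sG).1 mY B mB)).
Qed.

Variable F : R -> set (set T).
Hypothesis Fsigma : forall t, 0 <= t -> sigma_algebra setT (F t).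
Hypothesis Fmeas : forall t, 0 <= t -> F t `<=` measurable.
Hypothesis Fmono : forall s t, 0 <= s -> s <= t -> F s `<=` F t.

(* A square-integrable martingale, recorded by its increments over the
   intervals [(a, b]]. *)
Record integrator (L : R -> R -> T -> R) : Prop := Integrator {
  integrator_meas : forall a b, 0 <= a -> a <= b -> meas_wrt (F b) (L a b);
  integrator_L2 : forall a b, 0 <= a -> a <= b -> Ltwo P (L a b);
  integrator_mart : forall a b E, 0 <= a -> a <= b -> F a E ->
    ex P (fun w => \1_E w * L a b w) = 0;
  integrator_add : forall a b c, 0 <= a -> a <= b -> b <= c ->
    {ae P, forall w, L a c w = L a b w + L b c w} }.

(** The predictable bracket of [L] and [L'] is [q t]. Conditional second moments tested on the
    events of [F a] express this without a bracket process. *)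
Definition covar (L L' : R -> R -> T -> R) (q : R) :=
  forall a b E, 0 <= a -> a <= b -> F a E ->
    ex P (fun w => \1_E w * (L a b w * L' a b w)) =
    q * (b - a) * ex P (\1_E : T -> R).

Definition bmeas (G : set (set T)) (Y : T -> R) :=
  meas_wrt G Y /\ exists M, forall w, `|Y w| <= M.

Lemma bmeasM G Y Z : bmeas G Y -> bmeas G Z -> bmeas G (fun w => Y w * Z w).
Proof.
move=> [mY [M YM]] [mZ [N ZN]]; split; first exact: meas_wrtM.
by exists (M * N) => w; rewrite normrM ler_pM.
Qed.

Lemma bmeas_sub s t Y : 0 <= s -> s <= t -> bmeas (F s) Y -> bmeas (F t) Y.
Proof. by move=> s0 st [mY bY]; split => //; exact: meas_wrt_sub (Fmono s0 st) mY. Qed.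

Lemma bmeas_Ltwo s Y f : 0 <= s -> bmeas (F s) Y -> Ltwo P f ->
  Ltwo P (fun w => Y w * f w).
Proof.
move=> s0 [mY [M YM]] Lf; apply: (@LtwoM_bounded _ _ _ _ _ _ M) => //.
exact: meas_wrt_meas (Fmeas s0) mY.
Qed.

Lemma bmeas_Lone s Y f : 0 <= s -> bmeas (F s) Y -> Lone P f ->
  Lone P (fun w => Y w * f w).
Proof.
move=> s0 [mY [M YM]] Lf; apply: (@LoneM_bounded _ _ _ _ _ _ M) => //.
exact: meas_wrt_meas (Fmeas s0) mY.
Qed.

Lemma bmeas_L1 s Y : 0 <= s -> bmeas (F s) Y -> Lone P Y.
Proof.
move=> s0 [mY [M YM]]; apply: (@Lone_bounded _ _ _ _ _ M) => //.
exact: meas_wrt_meas (Fmeas s0) mY.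
Qed.

Lemma integrator_orth L a b Y : integrator L -> 0 <= a -> a <= b ->
  meas_wrt (F a) Y -> Ltwo P Y -> ex P (fun w => Y w * L a b w) = 0.
Proof.
move=> iL a0 ab mY LY; have LL := integrator_L2 iL a0 ab.
apply: (@ex_orth_wrt (F a)) => //; [exact: Fmeas|exact: Fsigma| | |].
- exact: Ltwo_Lone.
- by move=> E; exact: integrator_mart.
- exact: Ltwo_mul.
Qed.

Lemma covar_sym L L' q : covar L L' q -> covar L' L q.
Proof.
move=> c a b E a0 ab FE; rewrite -c//; congr ex; apply/funext => w.
by rewrite [X in _ * X]mulrC.
Qed.

(** The product of the increments, once centred by [q * (b - a)], is orthogonal to the events of
    [F a], hence to any bounded [F a]-measurable factor. *)
Lemma covar_mean L L' q a b Y : integrator L -> integrator L' ->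
  covar L L' q -> 0 <= a -> a <= b -> bmeas (F a) Y ->
  ex P (fun w => Y w * (L a b w * L' a b w)) = q * (b - a) * ex P Y.
Proof.
move=> iL iL' cL a0 ab bY.
have LL := Ltwo_mul (integrator_L2 iL a0 ab) (integrator_L2 iL' a0 ab).
have LD : Lone P (fun w => L a b w * L' a b w - q * (b - a)).
  by apply: LoneB => //; exact: Lone_cst.
have YE : (fun w => Y w * (L a b w * L' a b w)) = (fun w =>
    Y w * (L a b w * L' a b w - q * (b - a)) + q * (b - a) * Y w).
  by apply/funext => w; ring.
rewrite YE exD; last 2 first.
- exact: bmeas_Lone bY LD.
- by apply: LoneZ; exact: bmeas_L1 bY.
rewrite exZ; last exact: bmeas_L1 bY.
rewrite (@ex_orth_wrt (F a)) ?add0r//; [exact: Fmeas|exact: Fsigma| | |].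
- move=> E FE; have mE : measurable E by exact: Fmeas FE.
  have Li : Lone P (\1_E : T -> R).
    by apply: (@Lone_bounded _ _ _ _ _ 1) => // w; rewrite indicE; case: (_ \in _); rewrite ?normr1 ?normr0.
  have iE : (fun w => \1_E w * (L a b w * L' a b w - q * (b - a))) = (fun w =>
    \1_E w * (L a b w * L' a b w) - q * (b - a) * \1_E w).
    by apply/funext => w; ring.
  rewrite iE exB; last 2 first.
  + apply: (@LoneM_bounded _ _ _ _ _ _ 1) => // w; rewrite indicE; case: (_ \in _); rewrite ?normr1 ?normr0//.
  + exact: LoneZ.
  by rewrite exZ// cL// subrr.
- by case: bY.
- exact: bmeas_Lone bY LD.
Qed.

Lemma bmeas_meas a Y : 0 <= a -> bmeas (F a) Y -> measurable_fun setT Y.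
Proof. by move=> a0 [mY _]; exact: meas_wrt_meas (Fmeas a0) mY. Qed.

(** Splitting [L'] at [v] leaves a piece over [(v, v']], which is orthogonal to the [F v]-measurable
    factor [Y * L u v]. *)
Let pair_same_left L L' q u v v' Y : integrator L -> integrator L' ->
  covar L L' q -> 0 <= u -> u <= v -> v <= v' -> bmeas (F u) Y ->
  ex P (fun w => Y w * (L u v w * L' u v' w)) = q * (v - u) * ex P Y.
Proof.
move=> iL iL' cL u0 uv vv' bY.
have v0 := le_trans u0 uv; have uv' := le_trans uv vv'.
have L1 := integrator_L2 iL u0 uv.
have L2 := integrator_L2 iL' u0 uv.
have L3 := integrator_L2 iL' v0 vv'.
have L4 := integrator_L2 iL' u0 uv'.
have mY := bmeas_meas u0 bY.
have [m1 m2 m3 m4] := And4 L1.1 L2.1 L3.1 L4.1.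
rewrite (@ex_ae _ _ _ _ _ (fun w => Y w * (L u v w * L' u v w) +
    (Y w * L u v w) * L' v v' w)); last 3 first.
- by do 2 apply: measurable_funM => //.
- by apply: measurable_funD => //; apply: measurable_funM => //; exact: measurable_funM.
- by apply: filterS (integrator_add iL' u0 uv vv') => w ->; ring.
rewrite exD; last 2 first.
- by apply: (bmeas_Lone u0) => //; exact: Ltwo_mul.
- by apply: Ltwo_mul => //; exact: (bmeas_Ltwo u0).
rewrite (covar_mean iL iL' cL)// (integrator_orth iL')// ?addr0//.
- apply: meas_wrtM; last exact: integrator_meas.
  exact: meas_wrt_sub (Fmono u0 uv) bY.1.
- exact: (bmeas_Ltwo u0).
Qed.

(** The length of the intersection of [(u, v]] and [(u', v']]; see [overlap_measure]. *)
Definition overlap (u v u' v' : R) := Num.max 0 (Num.min v v' - Num.max u u').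

Lemma overlapC u v u' v' : overlap u v u' v' = overlap u' v' u v.
Proof. by rewrite /overlap minC [Num.max u _]maxC. Qed.

(** If the intervals are disjoint, all but the later increment is [F u']-measurable and the mean
    vanishes. Otherwise [L] is split at [u']: its first piece is again a factor from the past, and
    the second starts together with [L']. The interval that ends first decides which of the two
    plays the shorter role in [pair_same_left]. *)
Let pair_left L L' q u v u' v' Y Y' : integrator L -> integrator L' ->
  covar L L' q -> 0 <= u -> u <= v -> u <= u' -> u' <= v' ->
  bmeas (F u) Y -> bmeas (F u') Y' ->
  ex P (fun w => (Y w * L u v w) * (Y' w * L' u' v' w)) =
  q * overlap u v u' v' * ex P (fun w => Y w * Y' w).
Proof.
move=> iL iL' cL u0 uv uu' uv' bY bY'.
have u0' := le_trans u0 uu'; have v0 := le_trans u0 uv.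
have L1 := integrator_L2 iL u0 uv.
have L4 := integrator_L2 iL' u0' uv'.
have bYu := bmeas_sub u0 uu' bY.
have bYY := bmeasM bYu bY'.
have [vu'|u'v] := leP v u'.
  rewrite (_ : overlap _ _ _ _ = 0); last first.
    rewrite /overlap; apply/max_idPl; rewrite subr_le0 ge_min le_max.
    by rewrite le_max vu' orbT.
  rewrite mulr0 mul0r -[RHS](integrator_orth iL' u0' uv'
    (Y := fun w => Y w * L u v w * Y' w)).
  - by congr ex; apply/funext => w; ring.
  - apply: meas_wrtM; last exact: bY'.1.
    apply: meas_wrtM; first exact: bYu.1.
    exact: meas_wrt_sub (Fmono v0 vu') (integrator_meas iL u0 uv).
  - under eq_fun do rewrite mulrC.
    by apply: (bmeas_Ltwo u0') => //; exact: (bmeas_Ltwo u0).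
have {}u'v := ltW u'v.
have L2 := integrator_L2 iL u0 uu'.
have L3 := integrator_L2 iL u0' u'v.
have mY := bmeas_meas u0 bY; have mY' := bmeas_meas u0' bY'.
have [m1 m2 m3 m4] := And4 L1.1 L2.1 L3.1 L4.1.
rewrite (@ex_ae _ _ _ _ _ (fun w => (Y w * L u u' w * Y' w) * L' u' v' w +
    (Y w * Y' w) * (L u' v w * L' u' v' w))); last 3 first.
- by apply: measurable_funM; exact: measurable_funM.
- by apply: measurable_funD => //; do 3? apply: measurable_funM => //.
- by apply: filterS (integrator_add iL u0 uu' u'v) => w ->; ring.
have LY : Ltwo P (fun w => Y w * L u u' w * Y' w).
  under eq_fun do rewrite mulrC.
  by apply: (bmeas_Ltwo u0') => //; exact: (bmeas_Ltwo u0).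
rewrite exD; last 2 first.
- exact: Ltwo_mul.
- by apply: (bmeas_Lone u0') => //; exact: Ltwo_mul.
rewrite (integrator_orth iL')//; last first.
  apply: meas_wrtM; last exact: bY'.1.
  apply: meas_wrtM; first exact: bYu.1.
  exact: integrator_meas.
rewrite add0r; have [vv'|/ltW v'v] := leP v v'.
  rewrite (pair_same_left iL iL' cL)//; congr (_ * _ * _).
  rewrite /overlap (max_idPr uu') (min_idPl vv'); apply/esym/max_idPr.
  by rewrite subr_ge0.
under [X in ex P X]eq_fun do rewrite [X in _ * X]mulrC.
rewrite (pair_same_left iL' iL (covar_sym cL))//; congr (_ * _ * _).
rewrite /overlap (max_idPr uu') (min_idPr v'v); apply/esym/max_idPr.
by rewrite subr_ge0.
Qed.

Lemma integrator_pair L L' q u v u' v' Y Y' : integrator L -> integrator L' ->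
  covar L L' q -> 0 <= u -> u <= v -> 0 <= u' -> u' <= v' ->
  bmeas (F u) Y -> bmeas (F u') Y' ->
  ex P (fun w => (Y w * L u v w) * (Y' w * L' u' v' w)) =
  q * overlap u v u' v' * ex P (fun w => Y w * Y' w).
Proof.
move=> iL iL' cL u0 uv u0' uv' bY bY'; have [uu'|/ltW u'u] := leP u u'.
  exact: pair_left.
rewrite overlapC; under [X in ex P X = _]eq_fun do rewrite mulrC.
under [X in _ = _ * ex P X]eq_fun do rewrite mulrC.
exact: pair_left (covar_sym cL) _ _ _ _ _ _.
Qed.

Section elementary.
Variables (K K' : finType) (s : R) (s0 : 0 <= s) (Z : T -> R).
Hypothesis bZ : bmeas (F s) Z.

Definition elem_sum (I : finType) (coef : I -> T -> R) (L : I -> R -> R -> T -> R)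
    (lo hi : I -> R) (w : T) : R := \sum_k coef k w * L k (lo k) (hi k) w.

Definition elem_ok (I : finType) (coef : I -> T -> R)
    (L : I -> R -> R -> T -> R) (lo hi : I -> R) :=
  forall k, [/\ integrator (L k), s <= lo k, lo k <= hi k & bmeas (F (lo k)) (coef k)].

Variables (coef : K -> T -> R) (L : K -> R -> R -> T -> R) (lo hi : K -> R).
Hypothesis ok : elem_ok coef L lo hi.
Variables (coef' : K' -> T -> R) (L' : K' -> R -> R -> T -> R) (lo' hi' : K' -> R).
Hypothesis ok' : elem_ok coef' L' lo' hi'.

Let elem_L2 (I : finType) c M l h (k : I) : elem_ok c M l h ->
  Ltwo P (fun w => c k w * M k (l k) (h k) w).
Proof.
move=> /(_ k)[iM sl lh bc]; have l0 := le_trans s0 sl.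
by apply: (bmeas_Ltwo l0) => //; exact: integrator_L2.
Qed.

Lemma elem_sum_L2 : Ltwo P (elem_sum coef L lo hi).
Proof. by apply: Ltwo_sum => k; exact: elem_L2 ok. Qed.

Lemma elem_sum_mean : ex P (fun w => Z w * elem_sum coef L lo hi w) = 0.
Proof.
under [X in ex P X]eq_fun do rewrite mulr_sumr.
rewrite ex_sum.
  apply: big1 => k _; have [iL sl lh bc] := ok k; have l0 := le_trans s0 sl.
  under [X in ex P X]eq_fun do rewrite mulrA.
  have bY := bmeasM (bmeas_sub s0 sl bZ) bc.
  rewrite (integrator_orth iL)//; first exact: bY.1.
  have [M YM] := bY.2.
  by apply: (@Ltwo_bounded _ _ _ _ _ M) => //; exact: (bmeas_meas l0).
move=> k; apply: (bmeas_Lone s0) => //; apply: Ltwo_Lone; exact: elem_L2 ok.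
Qed.

Lemma elem_sum_cov (q : K -> K' -> R) :
  (forall k k', covar (L k) (L' k') (q k k')) ->
  ex P (fun w => Z w * (elem_sum coef L lo hi w * elem_sum coef' L' lo' hi' w)) =
  \sum_k \sum_k' q k k' * overlap (lo k) (hi k) (lo' k') (hi' k') *
    ex P (fun w => Z w * (coef k w * coef' k' w)).
Proof.
move=> cq.
have -> : (fun w => Z w * (elem_sum coef L lo hi w * elem_sum coef' L' lo' hi' w)) =
   (fun w => \sum_k \sum_k' ((Z w * coef k w) * L k (lo k) (hi k) w) *
     (coef' k' w * L' k' (lo' k') (hi' k') w)).
  apply/funext => w; rewrite /elem_sum big_distrlr /= mulr_sumr.
  apply: eq_bigr => k _; rewrite mulr_sumr; apply: eq_bigr => k' _; ring.
have Lkk k k' : Lone P (fun w => ((Z w * coef k w) * L k (lo k) (hi k) w) *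
     (coef' k' w * L' k' (lo' k') (hi' k') w)).
  have [iL sl lh bc] := ok k; have l0 := le_trans s0 sl.
  apply: Ltwo_mul; last exact: elem_L2 ok'.
  apply: (bmeas_Ltwo l0); last exact: integrator_L2.
  exact: bmeasM (bmeas_sub s0 sl bZ) bc.
rewrite ex_sum; last by move=> k; apply: Lone_sum.
apply: eq_bigr => k _; rewrite ex_sum//; apply: eq_bigr => k' _.
have [iL sl lh bc] := ok k; have l0 := le_trans s0 sl.
have [iL' sl' lh' bc'] := ok' k'; have l0' := le_trans s0 sl'.
rewrite (integrator_pair iL iL' (cq k k'))//.
  by congr (_ * _ * ex P _); apply/funext => w; rewrite mulrA.
exact: bmeasM (bmeas_sub s0 sl bZ) bc.
Qed.

End elementary.

End filtered.

(** * Brownian increments *)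

Section borel_matrix.
Context {R : realType}.

Lemma continuous_borel_mx m n (f : 'M[R]_(m, n) -> R) : continuous f ->
  measurable_fun setT (f : borel_mx R m n -> R).
Proof.
move=> /continuousP cf; apply: (measurability _ (RGenOpens.measurableE R)).
move=> _ [_ [a [b ->] <-]]; rewrite setTI.
by apply: sub_sigma_algebra; apply: cf; exact: interval_open.
Qed.

End borel_matrix.

Section brownian.
Context {R : realType} {dT : measure_display} {T : measurableType dT}.
Variable P : probability T R.
Notation lam := (@lebesgue_measure R).

Section gaussian_law.
Variables (s : R) (s0 : 0 < s) (E : set T) (mE : measurable E) (D : T -> R).
Hypothesis mD : measurable_fun setT D.
Variables (c : R) (c0 : 0 <= c).
Hypothesis law : forall B, measurable B ->
  P (E `&` D @^-1` B) = (c%:E * normal_prob 0 s B)%E.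

(** The constant [c] stands for [P E]. It is left free because [bm_covar] takes for [E] an
    intersection with an event of another coordinate, whose probability is a product. *)
Let gauss_transfer (f : R -> R) : measurable_fun setT f -> (forall x, 0 <= f x) ->
  (\int[P]_w (\1_E w * f (D w))%:E =
   c%:E * \int[lam]_x (normal_pdf 0 s x * f x)%:E)%E.
Proof.
move=> mf f0.
have mpdf : measurable_fun setT (normal_pdf 0 s : R -> R).
  exact: measurable_normal_pdf.
have m1 : measurable_fun setT (fun x : R => c * normal_pdf 0 s x).
  exact: measurable_funM.
rewrite (@ge0_integral_transfer _ _ _ T (measurableTypeR R) P lam D \1_E
  (fun x => c * normal_pdf 0 s x) f mD)//.
- rewrite -ge0_integralZl//.
  + by apply: eq_integral => x _; rewrite -EFinM mulrA.
  + have : measurable_fun setT (fun x : R => normal_pdf 0 s x * f x).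
      exact: measurable_funM.
    by move=> h; apply/measurable_EFinP; exact: h.
  + by move=> x _; rewrite lee_fin mulr_ge0 ?normal_pdf_ge0.
- by move=> x; rewrite mulr_ge0 ?normal_pdf_ge0.
move=> B mB.
have mDB : measurable (D @^-1` B) by rewrite -[_ @^-1` _]setTI; exact: mD.
transitivity (\int[P]_w (\1_(E `&` D @^-1` B) w)%:E)%E.
  by apply: eq_integral => w _; rewrite indicI.
rewrite integral_indic//; last exact: measurableI.
transitivity (P (E `&` D @^-1` B)); first by rewrite setIT.
rewrite law// /normal_prob [X in (_ * X)%E]integral_mkcond/= -ge0_integralZl//.
- apply: eq_integral => x _; rewrite patchE indicE; case: (x \in B).
    by rewrite mulr1 EFinM.
  by rewrite mulr0 mule0.
- apply/(measurable_restrictT _ _).1 => //.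
  by apply/measurable_funTS/measurable_EFinP; exact: mpdf.
- by move=> x _; rewrite patchE; case: ifP => // _; rewrite lee_fin normal_pdf_ge0.
Qed.

Lemma gauss_second :
  (\int[P]_w (\1_E w * D w ^+ 2)%:E = (c * s ^+ 2)%:E)%E.
Proof.
rewrite (gauss_transfer (f := fun x => x ^+ 2)) ?normal_second_moment//.
by move=> x; exact: sqr_ge0.
Qed.

Lemma gauss_fourth :
  (\int[P]_w (\1_E w * D w ^+ 4)%:E <= (c * (64 * s ^+ 4))%:E)%E.
Proof.
rewrite (gauss_transfer (f := fun x => x ^+ 4))//; last first.
  by move=> x; exact: exprn_even_ge0.
by rewrite EFinM lee_wpmul2l// normal_fourth_moment.
Qed.

Lemma gauss_Ltwo : Ltwo P (fun w => \1_E w * D w).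
Proof.
split; first exact: measurable_funM.
apply: Lone_ge0P.
- by apply: measurable_funX; exact: measurable_funM.
- by move=> w; exact: sqr_ge0.
- rewrite (_ : (\int[P]_w _)%E = (\int[P]_w (\1_E w * D w ^+ 2)%:E)%E).
    by rewrite gauss_second ltry.
  apply: eq_integral => w _; rewrite exprMn indicE.
  by case: (_ \in _); rewrite ?expr1n// expr0n/=.
Qed.

Lemma gauss_first : ex P (fun w => \1_E w * D w) = 0.
Proof.
have mp : measurable_fun setT (fun x : R => Num.max x 0).
  exact: measurable_maxr.
have mn : measurable_fun setT (fun x : R => Num.max (- x) 0).
  by apply: measurable_maxr => //; exact: oppr_measurable.
have p0 (x : R) : 0 <= Num.max x 0 by rewrite le_max lexx orbT.
have L1 := Ltwo_Lone gauss_Ltwo.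
have L (x : R -> R) : measurable_fun setT x -> (forall r, `|x r| <= `|r|) ->
    Lone P (fun w => \1_E w * x (D w)).
  move=> mx xr; apply: Lone_le L1.
    by apply: measurable_funM => //; exact: measurableT_comp.
  by move=> w; rewrite !normrM ler_wpM2l.
have -> : (fun w => \1_E w * D w) = (fun w => \1_E w * Num.max (D w) 0 -
    \1_E w * Num.max (- D w) 0).
  apply/funext => w; rewrite -mulrBr; congr (_ * _).
  by rewrite !maxEle; do 2 case: ifPn; rewrite -?ltNge; lra.
have Lp : Lone P (fun w => \1_E w * Num.max (D w) 0).
  apply: (L (fun x => Num.max x 0)) => // r.
  by rewrite ger0_norm// ge_max ler_norm normr_ge0.
have Ln : Lone P (fun w => \1_E w * Num.max (- D w) 0).
  apply: (L (fun x => Num.max (- x) 0)) => // r.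
  by rewrite ger0_norm// ge_max -normrN ler_norm normr_ge0.
rewrite exB//; apply/eqP; rewrite subr_eq0; apply/eqP/EFin_inj.
rewrite !EFin_ex// (gauss_transfer (f := fun x => Num.max x 0))//.
rewrite (gauss_transfer (f := fun x => Num.max (- x) 0))//.
by rewrite (normal_symmetric s0 mp).
Qed.

End gaussian_law.

Variable F : R -> set (set T).
Hypothesis Fsigma : forall t, 0 <= t -> sigma_algebra setT (F t).
Hypothesis Fmeas : forall t, 0 <= t -> F t `<=` measurable.
Hypothesis Fmono : forall s t, 0 <= s -> s <= t -> F s `<=` F t.

Lemma adapted_continuous m n (X : R -> T -> 'M[R]_(m, n)) (f : 'M[R]_(m, n) -> R) t :
  adapted F X -> continuous f -> 0 <= t -> meas_wrt (F t) (fun w => f (X t w)).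
Proof.
move=> aX cf t0; apply/(meas_wrtP _ (Fsigma t0)) => B mB.
have := continuous_borel_mx cf measurableT mB; rewrite setTI => mfB.
exact: aX mfB.
Qed.

Lemma adapted_coord m n (X : R -> T -> 'M[R]_(m, n)) i j t :
  adapted F X -> 0 <= t -> meas_wrt (F t) (fun w => X t w i j).
Proof.
move=> aX t0; apply: (adapted_continuous (f := fun M => M i j)) => //.
exact: coord_continuous.
Qed.

Section increments.
Context {d : nat}.
Variables (W : R -> T -> 'cV[R]_d) (W_BM : brownian_motion P F W).

Definition bm_incr (i : 'I_d) (a b : R) (w : T) : R := W b w i 0 - W a w i 0.

Let aW : adapted F W. Proof. by case: W_BM. Qed.

Lemma bm_incr_meas i a b : 0 <= a -> a <= b -> meas_wrt (F b) (bm_incr i a b).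
Proof.
move=> a0 ab; have b0 := le_trans a0 ab.
apply: measurable_funB.
  exact: (adapted_coord _ _ aW).
by apply: (meas_wrt_sub (Fmono a0 ab)); exact: (adapted_coord _ _ aW).
Qed.

Let mincr i a b : 0 <= a -> a <= b -> measurable_fun setT (bm_incr i a b).
Proof.
move=> a0 ab; apply: meas_wrt_meas (bm_incr_meas i a0 ab).
exact/Fmeas/(le_trans a0).
Qed.

(** The event on coordinate [j] is put beside the past event [E]: given both, the increment of
    coordinate [i] keeps its Gaussian law, as [gauss_first] requires. *)
Let joint i j a b E B B' : 0 <= a -> a < b -> i != j -> F a E ->
  measurable B -> measurable B' ->
  P ((E `&` bm_incr j a b @^-1` B') `&` bm_incr i a b @^-1` B) =
  ((fine (P E * normal_prob 0 (Num.sqrt (b - a)) B'))%:E *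
    normal_prob 0 (Num.sqrt (b - a)) B)%E.
Proof.
move=> a0 ab ij FE mB mB'; have [_ _ _ law] := W_BM.
rewrite fineK; last first.
  rewrite fin_numM// fin_num_measure//; exact: Fmeas FE.
rewrite -muleA.
pose C k := if k == i then B else if k == j then B' else setT.
have Ci : C i = B by rewrite /C eqxx.
have Cj : C j = B' by rewrite /C eq_sym (negbTE ij) eqxx.
have := law a b E C a0 ab FE.
rewrite (bigD1 i)//= (bigD1 j)/=; last by rewrite eq_sym.
rewrite big1 => [|k /andP[ki kj]]; last first.
  by rewrite /C (negbTE ki) (negbTE kj) probability_setT.
rewrite mule1 Ci Cj [X in (_ * X)%E]muleC => H; rewrite -H; last first.
  by move=> k; rewrite /C; case: ifP => // _; case: ifP.
congr (P _); apply/seteqP; split => [w [[Ew Bj] Bi]|w [Ew Hw]].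
  split => // k; rewrite /C; case: eqP => [->//|_]; case: eqP => [->//|//].
split; first split => //.
  by have := Hw j; rewrite Cj.
by have := Hw i; rewrite Ci.
Qed.

Let law1 i a b E B : 0 <= a -> a < b -> F a E -> measurable B ->
  P (E `&` bm_incr i a b @^-1` B) =
  ((fine (P E))%:E * normal_prob 0 (Num.sqrt (b - a)) B)%E.
Proof.
move=> a0 ab FE mB; have [_ _ _ law] := W_BM.
rewrite fineK; last by rewrite fin_num_measure//; exact: Fmeas FE.
pose C k := if k == i then B else setT.
have Ci : C i = B by rewrite /C eqxx.
have := law a b E C a0 ab FE.
rewrite (bigD1 i)//= big1 => [|k ki]; last first.
  by rewrite /C (negbTE ki) probability_setT.
rewrite mule1 Ci => H; rewrite -H; last by move=> k; rewrite /C; case: ifP.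
congr (P _); apply/seteqP; split => [w [Ew Bi]|w [Ew Hw]].
  by split => // k; rewrite /C; case: eqP => [->|].
by split => //; have := Hw i; rewrite Ci.
Qed.

Let incr0 i a w : bm_incr i a a w = 0. Proof. exact: subrr. Qed.

Let sq (a b : R) : a < b -> Num.sqrt (b - a) ^+ 2 = b - a.
Proof. by move=> ab; rewrite sqr_sqrtr// subr_ge0 ltW. Qed.

Let FT a : 0 <= a -> F a setT.
Proof. by move=> /Fsigma[s0 sC _]; rewrite -(setD0 setT); exact: sC. Qed.

(** The order [(b - a) ^+ 2] is what makes the large values of a Brownian increment negligible in
    the bound [small] on mixed products. *)
Lemma bm_incr_fourth i a b : 0 <= a -> a < b ->
  (\int[P]_w (bm_incr i a b w ^+ 4)%:E <= (64 * (b - a) ^+ 2)%:E)%E.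
Proof.
move=> a0 ab; have b0 : 0 < Num.sqrt (b - a) by rewrite sqrtr_gt0 subr_gt0.
have := gauss_fourth b0 measurableT (mincr i a0 (ltW ab)) ler01.
rewrite mul1r (exprM _ 2 2) sq// => h; apply: le_trans (h _).
  rewrite le_eqVlt; apply/orP; left; apply/eqP.
  by apply: eq_integral => w _; rewrite indicT mul1r.
move=> B mB; rewrite law1//; last exact: FT.
by congr (_%:E * _)%E; rewrite probability_setT.
Qed.

Lemma bm_integrator i : integrator P F (bm_incr i).
Proof.
split.
- exact: bm_incr_meas.
(* The law of the increments is given for [a < b] only; over the degenerate interval the increment
   is 0. *)
- move=> a b a0; rewrite le_eqVlt => /predU1P[<-|ab].
    rewrite (_ : bm_incr i a a = cst 0); first exact: Ltwo_cst.
    by apply/funext => w; rewrite incr0.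
  have b0 : 0 < Num.sqrt (b - a) by rewrite sqrtr_gt0 subr_gt0.
  have := gauss_Ltwo b0 measurableT (mincr i a0 (ltW ab)) ler01.
  under eq_fun do rewrite indicT mul1r; apply.
  move=> B mB; rewrite law1//; last exact: FT.
  by congr (_%:E * _)%E; rewrite probability_setT.
- move=> a b E a0; rewrite le_eqVlt => /predU1P[<-|ab] FE.
    under [X in ex P X]eq_fun do rewrite incr0 mulr0.
    exact: ex_cst.
  have b0 : 0 < Num.sqrt (b - a) by rewrite sqrtr_gt0 subr_gt0.
  apply: (gauss_first b0 _ (mincr i a0 (ltW ab)) (c := fine (P E))).
  + exact: Fmeas FE.
  + exact: fine_ge0.
  + by move=> B mB; rewrite law1.
- by move=> a b c _ _ _; apply: aeW => w; rewrite /bm_incr; ring.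
Qed.

Lemma bm_covar i j : covar P F (bm_incr i) (bm_incr j) (i == j)%:R.
Proof.
move=> a b E a0; rewrite le_eqVlt => /predU1P[<-|ab] FE.
  under [X in ex P X = _]eq_fun do rewrite !incr0 !mulr0.
  by rewrite subrr mulr0 mul0r; exact: ex_cst.
have b0 : 0 < Num.sqrt (b - a) by rewrite sqrtr_gt0 subr_gt0.
have mE : measurable E by exact: Fmeas FE.
have mi k := mincr k a0 (ltW ab).
have L2 k := integrator_L2 (bm_integrator k) a0 (ltW ab).
have [<-|ij] := eqVneq i j.
  rewrite mul1r; apply: EFin_inj; rewrite EFin_ex; last first.
    apply: (@LoneM_bounded _ _ _ _ _ _ 1); [exact: Ltwo_mul|by []|].
    by move=> w; rewrite indicE; case: (_ \in _); rewrite ?normr1 ?normr0.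
  under eq_integral do rewrite -expr2.
  rewrite (gauss_second b0 mE (mi i) (fine_ge0 _) (c := fine (P E)))//.
    by rewrite sq// ex_indic// mulrC.
  by move=> B mB; rewrite law1.
rewrite mul0r mul0r.
have -> : (fun w => \1_E w * (bm_incr i a b w * bm_incr j a b w)) =
    (fun w => bm_incr j a b w * (\1_E w * bm_incr i a b w)).
  by apply/funext => w; ring.
have LE : Ltwo P (fun w => \1_E w * bm_incr i a b w).
  apply: (@LtwoM_bounded _ _ _ _ _ _ 1) => //.
  by move=> w; rewrite indicE; case: (_ \in _); rewrite ?normr1 ?normr0.
(* The increment of coordinate [j] is the outer factor: on each of its events, that of coordinate
   [i] has mean zero by [joint]. *)
apply: ex_orth => //.
- exact: Ltwo_Lone.
- move=> B mB.
  have mjB : measurable (bm_incr j a b @^-1` B).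
    by rewrite -[_ @^-1` _]setTI; exact: mi.
  have := gauss_first b0 (measurableI _ _ mE mjB) (mi i).
  move=> /(_ (fine (P E * normal_prob 0 (Num.sqrt (b - a)) B))) H.
  rewrite -[RHS]H.
  + congr ex; apply/funext => w; rewrite indicI /= mulrA [X in X * _]mulrC.
    by [].
  + by rewrite fine_ge0// mule_ge0.
  + by move=> B' mB'; rewrite joint.
- exact: Ltwo_mul.
Qed.

End increments.
End brownian.

(** * Poisson increments *)

Section poisson_moments.
Context {R : realType}.
Variables (l : R) (l0 : 0 <= l).

Lemma poisson_mass_ge0 k : 0 <= poisson_mass l k.
Proof. by rewrite /poisson_mass mulr_ge0 ?expR_ge0// divr_ge0// exprn_ge0. Qed.

Lemma poisson_mass_sum : (\sum_(k <oo) (poisson_mass l k)%:E = 1)%E.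
Proof.
rewrite [RHS](_ : _ = (expR (- l))%:E * (expR l)%:E)%E; last first.
  by rewrite -EFinM expRN mulVf ?gt_eqF ?expR_gt0.
under eq_eseriesr.
  move=> n _; rewrite /poisson_mass EFinM muleC; over.
rewrite /= nneseriesZl/=; last first.
  by move=> n _; rewrite lee_fin divr_ge0// exprn_ge0.
congr *%E; rewrite -EFin_lim; last exact: is_cvg_series_exp_coeff.
by apply/congr_lim/funext => n/=; rewrite /series/= -sumEFin.
Qed.

(** Factorial moments are the ones that the Poisson weights yield directly: a shift of the index
    cancels one factor of [k!] and releases one factor [l]. *)
Lemma poisson_mass_ffact j :
  (\sum_(k <oo) ((k ^_ j)%:R * poisson_mass l k)%:E = (l ^+ j)%:E)%E.
Proof.
elim: j => [|j ih].
  by under eq_eseriesr do rewrite mul1r; exact: poisson_mass_sum.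
have f0 i k : (0 <= ((k ^_ i)%:R * poisson_mass l k)%:E :> \bar R)%E.
  by rewrite lee_fin mulr_ge0// poisson_mass_ge0.
rewrite nneseries_recl// ffact0n mul0r add0e.
rewrite -(@nneseries_addn _ (fun k => ((k ^_ j.+1)%:R * poisson_mass l k)%:E) 1%N)//.
rewrite exprS EFinM -ih -nneseriesZl//; apply: eq_eseriesr => k _.
rewrite addn1 -EFinM ffactSS /poisson_mass natrM factS natrM exprS; congr (_%:E).
by field; rewrite gt_eqF ?ltr0n ?fact_gt0//= -natr1 -(natrD _ k 1) addn1 pnatr_eq0.
Qed.

Context {dT : measure_display} {T : measurableType dT}.
Variable P : probability T R.

Lemma measurable_natr {d} {V : measurableType d} (D : V -> nat) :
  (forall k, measurable (D @^-1` [set k])) ->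
  measurable_fun setT (fun w => (D w)%:R : R).
Proof.
move=> mD _ B mB; rewrite setTI.
rewrite (_ : _ @^-1` _ = \bigcup_(k in [set k : nat | B k%:R]) (D @^-1` [set k])).
  by apply: bigcup_measurable => k _; exact: mD.
apply/seteqP; split => [w Bw|w [k /= Bk Dk]]; first by exists (D w).
by rewrite /= Dk.
Qed.

Variables (D : T -> nat) (mD : forall k, measurable (D @^-1` [set k])).

Let mDr : measurable_fun setT (fun w => (D w)%:R : R).
Proof. exact: measurable_natr. Qed.

(** A discrete counterpart of [ex_orth]. The laws of the counts are known on level sets, so the
    sample space is partitioned along these; the integrability hypothesis makes the resulting series
    legitimate. *)
Lemma ex_orth_nat (f : T -> R) (y : nat -> R) : 
  (forall j, ex P (fun w => \1_(D @^-1` [set j]) w * f w) = 0) ->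
  Lone P f -> Lone P (fun w => y (D w) * f w) ->
  ex P (fun w => y (D w) * f w) = 0.
Proof.
move=> fD Lf Ly.
have UD : \bigcup_k (D @^-1` [set k]) = setT.
  by apply/seteqP; split => // w _; exists (D w).
rewrite /ex /Rintegral -{1}UD integral_bigcup ?UD//.
- rewrite (eq_eseriesr (g := fun=> 0%E)) ?eseries0// => k _.
  rewrite integral_mkcond/=.
  transitivity (\int[P]_w ((y k)%:E * (\1_(D @^-1` [set k]) w * f w)%:E))%E.
    apply: eq_integral => w _; rewrite patchE indicE.
    case: ifPn => [/set_mem <-|_]; first by rewrite mul1r.
    by rewrite mul0r mule0.
  have LI : Lone P (fun w => \1_(D @^-1` [set k]) w * f w).
    apply: (@LoneM_bounded _ _ _ _ _ _ 1) => //.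
    by move=> w; rewrite indicE; case: (_ \in _); rewrite ?normr1 ?normr0.
  by rewrite integralZl// -(EFin_ex LI) fD mule0.
- by move=> i j _ _ [w [/= <- <-]].
Qed.

Section law.
Variables (E : set T) (mE : measurable E) (c : R) (c0 : 0 <= c).
Hypothesis law : forall k, P (E `&` D @^-1` [set k]) = (c * poisson_mass l k)%:E.

Let law_integral (f : nat -> R) : (forall k, 0 <= f k) ->
  (\int[P]_w (\1_E w * f (D w))%:E =
   c%:E * \sum_(k <oo) (f k * poisson_mass l k)%:E)%E.
Proof.
move=> f0.
have UD : \bigcup_k (D @^-1` [set k]) = setT.
  by apply/seteqP; split => // w _; exists (D w).
have mf : measurable_fun setT (fun w => \1_E w * f (D w)).
  apply: measurable_funM => //; move=> _ B mB; rewrite setTI.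
  rewrite (_ : _ @^-1` _ = \bigcup_(k in [set k : nat | B (f k)]) (D @^-1` [set k])).
    by apply: bigcup_measurable => k _; exact: mD.
  apply/seteqP; split => [w Bw|w [k /= Bk Dk]]; first by exists (D w).
  by rewrite /= Dk.
rewrite -{1}UD ge0_integral_bigcup//; last 3 first.
- by rewrite UD; exact/measurable_EFinP.
- by move=> w _; rewrite lee_fin mulr_ge0.
- by move=> i j _ _ [w [/= <- <-]].
rewrite -nneseriesZl; last by move=> k _; rewrite lee_fin mulr_ge0 ?poisson_mass_ge0.
apply: eq_eseriesr => k _; rewrite integral_mkcond/=.
transitivity (\int[P]_w ((f k)%:E * (\1_(E `&` D @^-1` [set k]) w)%:E))%E.
  apply: eq_integral => w _; rewrite patchE indicI/=.
  rewrite [\1_(D @^-1` _) w]indicE; case: ifPn => [/set_mem <-|_].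
    by rewrite mulr1 -EFinM mulrC.
  by rewrite mulr0 mule0.
have mEk : measurable (E `&` D @^-1` [set k]) by exact: measurableI.
rewrite ge0_integralZl//.
- transitivity ((f k)%:E * (c * poisson_mass l k)%:E)%E.
    by congr (_ * _)%E; rewrite integral_indic// setIT; exact: law.
  by rewrite -!EFinM; congr (_%:E); ring.
- by apply/measurable_EFinP; exact: measurable_indic.
- by rewrite lee_fin.
Qed.

Let mass : (\int[P]_w (\1_E w)%:E = c%:E)%E.
Proof.
have := law_integral (f := fun=> 1) (fun=> ler01).
under eq_integral do rewrite mulr1; move=> ->.
by under eq_eseriesr do rewrite mul1r; rewrite poisson_mass_sum mule1.
Qed.

Let first : (\int[P]_w (\1_E w * (D w)%:R)%:E = (c * l)%:E)%E.
Proof.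
rewrite (law_integral (f := fun k => k%:R))// EFinM; congr (_ * _)%E.
by have := poisson_mass_ffact 1; under eq_eseriesr do rewrite ffactn1.
Qed.

Let second : (\int[P]_w (\1_E w * (D w)%:R ^+ 2)%:E = (c * (l + l ^+ 2))%:E)%E.
Proof.
rewrite (law_integral (f := fun k => k%:R ^+ 2)); last by move=> k; exact: sqr_ge0.
rewrite EFinM; congr (_ * _)%E.
(* The square is a sum of two factorial moments, [k^2 = k (k - 1) + k]. *)
rewrite [in RHS]EFinD -(poisson_mass_ffact 2) -{1}(expr1 l) -(poisson_mass_ffact 1).
rewrite -nneseriesD; last 2 first.
- by move=> k _; rewrite lee_fin mulr_ge0 ?poisson_mass_ge0.
- by move=> k _; rewrite lee_fin mulr_ge0 ?poisson_mass_ge0.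
apply: eq_eseriesr => k _; rewrite -EFinD -mulrDl; congr (_ * _)%:E.
rewrite -natrX -natrD; congr (_%:R); case: k => [//|k].
by rewrite ffactn1 ffactSS ffactn1 -mulnS mulnn.
Qed.

Lemma poisson_Ltwo : Ltwo P (fun w => \1_E w * (D w)%:R).
Proof.
split; first exact: measurable_funM.
apply: Lone_ge0P.
- by apply: measurable_funX; exact: measurable_funM.
- by move=> w; exact: sqr_ge0.
- rewrite (_ : (\int[P]_w _)%E = (\int[P]_w (\1_E w * (D w)%:R ^+ 2)%:E)%E).
    by rewrite second ltry.
  apply: eq_integral => w _; rewrite exprMn indicE.
  by case: (_ \in _); rewrite ?expr1n// expr0n/=.
Qed.

Let L1 : Lone P (\1_E : T -> R).
Proof.
by apply: Lone_ge0P => //; rewrite mass ltry.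
Qed.

Let L2 : Lone P (fun w => \1_E w * (D w)%:R).
Proof. exact/Ltwo_Lone/poisson_Ltwo. Qed.

Let L3 : Lone P (fun w => \1_E w * (D w)%:R ^+ 2).
Proof.
apply: Lone_ge0P.
- by apply: measurable_funM => //; exact: measurable_funX.
- by move=> w; rewrite mulr_ge0// sqr_ge0.
- by rewrite second ltry.
Qed.

Lemma poisson_centered_mean : ex P (fun w => \1_E w * ((D w)%:R - l)) = 0.
Proof.
have -> : (fun w => \1_E w * ((D w)%:R - l)) =
    (fun w => \1_E w * (D w)%:R - l * \1_E w) by apply/funext => w; ring.
rewrite exB//; last exact: LoneZ.
rewrite exZ// /ex /Rintegral first mass/=; ring.
Qed.

Lemma poisson_mean : ex P (fun w => \1_E w * (D w)%:R) = c * l.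
Proof. by rewrite /ex /Rintegral first. Qed.

Lemma poisson_square : ex P (fun w => \1_E w * (D w)%:R ^+ 2) = c * (l + l ^+ 2).
Proof. by rewrite /ex /Rintegral second. Qed.

Lemma poisson_variance : ex P (fun w => \1_E w * ((D w)%:R - l) ^+ 2) = c * l.
Proof.
have -> : (fun w => \1_E w * ((D w)%:R - l) ^+ 2) =
    (fun w => \1_E w * (D w)%:R ^+ 2 +
      (- 2 * l * (\1_E w * (D w)%:R) + l ^+ 2 * \1_E w)).
  by apply/funext => w; ring.
rewrite exD//; last by apply: LoneD; exact: LoneZ.
rewrite exD; [|exact: LoneZ|exact: LoneZ].
rewrite !exZ// poisson_square poisson_mean /ex /Rintegral mass/=; ring.
Qed.

End law.
End poisson_moments.

Section poisson_integrator.
Context {R : realType} {dT : measure_display} {T : measurableType dT}.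
Variable P : probability T R.
Notation lam := (@lebesgue_measure R).
Context {dU : measure_display} {U : measurableType dU}.
Variable nu : {sigma_finite_measure set U -> \bar R}.

Lemma measure_ae_eq (A B : set T) : measurable A -> measurable B ->
  {ae P, forall w, A w <-> B w} -> P A = P B.
Proof.
move=> mA mB AB; rewrite -[A]setIT -[B]setIT -!integral_indic//.
apply: ge0_ae_eq_integral => //.
- by apply/measurable_EFinP; exact: measurable_indic.
- by apply/measurable_EFinP; exact: measurable_indic.
apply: filterS AB => w AB _; rewrite !indicE; congr (_%:R%:E).
congr nat_of_bool; apply/idP/idP => /set_mem H; apply/mem_set; exact/AB.
Qed.

Section jump_count.
Variable p : R -> T -> option U.

Let times (A : set (R * U)) w := [set s | exists2 u, p s w = Some u & A (s, u)].

(** The default 0 for infinitely many jumps agrees with [fine +oo = 0], so that [fine_jump] holds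
    without condition. A positive count is therefore faithful, a null one is not. *)
Definition jcount (A : set (R * U)) w : nat :=
  if `[< finite_set (times A w) >] then #|` fset_set (times A w)| else 0.

Lemma fine_jump A w : fine (jump_measure p w A) = (jcount A w)%:R.
Proof. by rewrite /jump_measure /counting /jcount -/(times A w); case: asboolP. Qed.

Lemma jump_jcount A w k : jump_measure p w A = k%:R%:E -> jcount A w = k.
Proof.
move=> /(congr1 fine); rewrite fine_jump/= => /eqP; rewrite eqr_nat.
by move/eqP.
Qed.

Lemma jcount_pos A w k : jcount A w = k.+1 -> jump_measure p w A = k.+1%:R%:E.
Proof.
by rewrite /jcount /jump_measure /counting -/(times A w); case: asboolP => // _ ->.
Qed.

(** At most one mark occurs at a given time, so disjoint sets have disjoint sets of jump times. The
    two other hypotheses exclude the default value of [jcount]. *)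
Lemma jcountU A B w : A `&` B = set0 ->
  jump_measure p w A = (jcount A w)%:R%:E -> jump_measure p w B = (jcount B w)%:R%:E ->
  jcount (A `|` B) w = (jcount A w + jcount B w)%N.
Proof.
move=> AB.
rewrite /jcount /jump_measure /counting -/(times A w) -/(times B w).
case: asboolP => // fA _; case: asboolP => // fB _.
have -> : times (A `|` B) w = times A w `|` times B w.
  apply/seteqP; split => [s [u pu [Au|Bu]]|s [[u pu Au]|[u pu Bu]]].
  - by left; exists u.
  - by right; exists u.
  - by exists u => //; left.
  - by exists u => //; right.
rewrite asboolT; last by rewrite finite_setU.
rewrite fset_setU// cardfsU -fset_setI// (_ : times A w `&` times B w = set0).
  by rewrite fset_set0 cardfs0 subn0.
apply/seteqP; split => // s [[u pu Au] [v pv Bv]].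
move: pv; rewrite pu => -[uv]; suff : (A `&` B) (s, u) by rewrite AB.
by split => //; rewrite uv.
Qed.

End jump_count.

Variable F : R -> set (set T).
Hypothesis Fsigma : forall t, 0 <= t -> sigma_algebra setT (F t).
Hypothesis Fmeas : forall t, 0 <= t -> F t `<=` measurable.
Hypothesis Fmono : forall s t, 0 <= s -> s <= t -> F s `<=` F t.
Variables (p : R -> T -> option U) (p_PPP : poisson_point_process P F nu p).
Notation N := (jump_measure p).

Definition slab (a b : R) (B : set U) : set (R * U) := `]a, b] `*` B.

Definition intensity (A : set (R * U)) : R := fine ((lam \x nu) A).

Lemma slab_measurable a b B : measurable B -> measurable (slab a b B).
Proof. by move=> mB; apply: measurableX. Qed.

Lemma slab_measure a b B : a <= b -> measurable B ->
  ((lam \x nu) (slab a b B) = (b - a)%:E * nu B)%E.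
Proof.
move=> ab mB; rewrite /slab product_measure1E//.
have h : (lam `]a, b]%classic = (b - a)%:E)%E.
  rewrite lebesgue_measure_itv/= lte_fin; case: ltgtP ab => // <- _.
  by rewrite subrr.
by congr (_ * _)%E; exact: h.
Qed.

Lemma slab_intensity a b B : a <= b -> measurable B -> (nu B < +oo)%E ->
  intensity (slab a b B) = (b - a) * fine (nu B).
Proof.
move=> ab mB nB; rewrite /intensity slab_measure// fineM//.
by rewrite ge0_fin_numE.
Qed.

Let slab_fin a b B : a <= b -> measurable B -> (nu B < +oo)%E ->
  ((lam \x nu) (slab a b B) < +oo)%E.
Proof.
move=> ab mB nB; rewrite slab_measure// lte_mul_pinfty// lee_fin subr_ge0//.
Qed.

Let slab_sub0 a b B : 0 <= a -> slab a b B `<=` `]0, b] `*` setT.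
Proof.
move=> a0 [s u] [/= + _]; rewrite !in_itv/= => /andP[sa ->]; split => //.
by rewrite andbT (le_lt_trans a0).
Qed.

Let slab_suba a b B : slab a b B `<=` `]a, +oo[ `*` setT.
Proof.
by move=> [s u] [/= + _]; rewrite !in_itv/= => /andP[-> _].
Qed.

Lemma jcount_meas t (A : set (R * U)) k : 0 <= t -> measurable A ->
  A `<=` `]0, t] `*` setT -> F t (jcount p A @^-1` [set k]).
Proof.
move=> t0 mA At; have [_ mN _] := p_PPP; have [F0 FC FU] := Fsigma t0.
have FN j : F t [set w | jump_measure p w A = j%:R%:E] by exact: mN.
case: k => [|k]; last first.
  rewrite (_ : _ @^-1` _ = [set w | jump_measure p w A = k.+1%:R%:E])//.
  apply/seteqP; split => w /=; [exact: jcount_pos|exact: jump_jcount].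
(* The level 0 also contains the paths with infinitely many jumps; it is reached as the complement
   of the positive levels. *)
rewrite (_ : _ @^-1` _ =
    setT `\` \bigcup_k [set w | jump_measure p w A = k.+1%:R%:E]).
  by apply: FC; apply: FU => j; exact: FN.
apply/seteqP; split => w /=.
  by move=> j0; split => // -[k _ /= /jump_jcount]; rewrite j0.
move=> [_ H]; case E : (jcount p A w) => [//|k]; exfalso; apply: H.
by exists k => //=; exact: jcount_pos.
Qed.

Let jump_law s E A k : 0 <= s -> F s E -> measurable A ->
  A `<=` `]s, +oo[ `*` setT -> ((lam \x nu) A < +oo)%E ->
  P (E `&` [set w | N w A = k%:R%:E]) = (P E * (poisson_mass (intensity A) k)%:E)%E.
Proof.
move=> s0 FE mA As fA; have [_ _ law] := p_PPP.
have := law s E 1%N (fun=> A) (fun=> k) s0 FE.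
rewrite big_ord1 => <-//.
- congr (P _); apply/seteqP; split => w [Ew H]; split => //.
  by have := H ord0.
- by move=> i j _ _ _; rewrite !ord1.
Qed.

(** The Poisson masses sum to 1, so the finite values of the count already exhaust the
    probability. *)
Lemma jump_finite s (A : set (R * U)) : 0 <= s -> measurable A ->
  A `<=` `]s, +oo[ `*` setT -> ((lam \x nu) A < +oo)%E ->
  (forall k, measurable [set w | N w A = k%:R%:E]) ->
  {ae P, forall w, N w A = (jcount p A w)%:R%:E}.
Proof.
move=> s0 mA As fA mN.
have P1 : P (\bigcup_k [set w | N w A = k%:R%:E]) = 1%E.
  rewrite measure_semi_bigcup//; last 2 first.
  - move=> i j _ _ [w [/= Ni Nj]]; move: Nj; rewrite Ni => -[/eqP].
    by rewrite eqr_nat => /eqP.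
  - exact: bigcupT_measurable.
  rewrite -(@poisson_mass_sum R (intensity A)) ?fine_ge0//.
  apply: eq_eseriesr => k _.
  have FsT : F s setT.
    by have [F0 FC _] := Fsigma s0; rewrite -(setD0 setT); exact: FC.
  have := jump_law k s0 FsT mA As fA; rewrite setTI.
  by rewrite (_ : P setT = 1%E) ?mul1e//; exact: probability_setT.
exists (~` \bigcup_k [set w | N w A = k%:R%:E]); split.
- by apply: measurableC; exact: bigcupT_measurable.
- rewrite probability_setC; last exact: bigcupT_measurable.
  by rewrite P1 subee.
move=> w /= H [k _ /= Nk]; apply: H.
by rewrite (jump_jcount Nk).
Qed.

Let slab_finite a b B : 0 <= a -> a <= b -> measurable B -> (nu B < +oo)%E ->
  {ae P, forall w, N w (slab a b B) = (jcount p (slab a b B) w)%:R%:E}.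
Proof.
move=> a0 ab mB nB; apply: (jump_finite a0).
- exact: slab_measurable.
- exact: slab_suba.
- exact: slab_fin.
move=> k; have b0 := le_trans a0 ab; apply: (Fmeas b0); have [_ mN _] := p_PPP.
by apply: mN => //; [exact: slab_measurable|exact: slab_sub0].
Qed.

Let jslab_meas a b B k : 0 <= a -> a <= b -> measurable B ->
  F b (jcount p (slab a b B) @^-1` [set k]).
Proof.
move=> a0 ab mB; apply: jcount_meas; first exact: le_trans ab.
- exact: slab_measurable.
- exact: slab_sub0.
Qed.

Let jslab_meas' a b B k : 0 <= a -> a <= b -> measurable B ->
  measurable (jcount p (slab a b B) @^-1` [set k]).
Proof.
by move=> a0 ab mB; apply: (Fmeas (le_trans a0 ab)); exact: jslab_meas.
Qed.

Lemma jslab_law a b B E k : 0 <= a -> a <= b -> measurable B -> (nu B < +oo)%E ->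
  F a E -> P (E `&` jcount p (slab a b B) @^-1` [set k]) =
  (fine (P E) * poisson_mass ((b - a) * fine (nu B)) k)%:E.
Proof.
move=> a0 ab mB nB FE; have b0 := le_trans a0 ab.
have mE : measurable E by exact: Fmeas FE.
have mN : measurable [set w | N w (slab a b B) = k%:R%:E].
  apply: (Fmeas b0); have [_ mN _] := p_PPP.
  by apply: mN => //; [exact: slab_measurable|exact: slab_sub0].
rewrite EFinM fineK ?fin_num_measure// -slab_intensity//.
rewrite -(jump_law _ a0)//; last 2 first.
- exact: slab_measurable.
- exact: slab_fin.
apply: measure_ae_eq.
- by apply: measurableI => //; exact: jslab_meas'.
- exact: measurableI.
apply: filterS (slab_finite a0 ab mB nB) => w Nw; split => -[Ew /= H]; split => //=.
  by rewrite Nw H.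
exact: jump_jcount.
Qed.

(** As in [joint], the event on [B'] is put beside the past, and the count of [B] keeps its law
    given both; this feeds [poisson_centered_mean] in the disjoint case of the covariance. *)
Lemma jslab_law2 a b B B' E j k : 0 <= a -> a <= b ->
  measurable B -> (nu B < +oo)%E -> measurable B' -> (nu B' < +oo)%E ->
  B `&` B' = set0 -> F a E ->
  P ((E `&` jcount p (slab a b B') @^-1` [set j]) `&`
     jcount p (slab a b B) @^-1` [set k]) =
  (fine (P E) * poisson_mass ((b - a) * fine (nu B')) j *
    poisson_mass ((b - a) * fine (nu B)) k)%:E.
Proof.
move=> a0 ab mB nB mB' nB' BB FE; have b0 := le_trans a0 ab.
have mE : measurable E by exact: Fmeas FE.
have mN C i : measurable C -> measurable [set w | N w (slab a b C) = i%:R%:E].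
  move=> mC; apply: (Fmeas b0); have [_ mN _] := p_PPP.
  by apply: mN => //; [exact: slab_measurable|exact: slab_sub0].
have [_ _ law] := p_PPP.
pose C (i : 'I_2) := if i == ord0 then B else B'.
pose K (i : 'I_2) := if i == ord0 then k else j.
have mC i : measurable (C i) by rewrite /C; case: ifP.
have nC i : (nu (C i) < +oo)%E by rewrite /C; case: ifP.
have tC : trivIset setT (fun i => slab a b (C i)).
  move=> i i' _ _ [[s u] [[_ /= +] [_ /= +]]].
  rewrite /C; have [->|i0] := eqVneq i ord0; have [->|i'0] := eqVneq i' ord0 => //.
  - by move=> Bu B'u; have : (B `&` B') u by []; rewrite BB.
  - by move=> B'u Bu; have : (B `&` B') u by []; rewrite BB.
  - move=> _ _; apply: val_inj; move: i0 i'0; rewrite -!(inj_eq val_inj) /=.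
    by case: i => [[|[|//]] ?]; case: i' => [[|[|//]] ?].
have := law a E 2%N (fun i => slab a b (C i)) K a0 FE _ tC.
rewrite big_ord_recl big_ord1 /= => H.
set m' := poisson_mass _ j; set m := poisson_mass _ k.
have -> : (fine (P E) * m' * m)%:E = (P E * (m%:E * m'%:E))%E.
  by rewrite -[in RHS](fineK (fin_num_measure P E mE)) -!EFinM; congr (_%:E); ring.
rewrite /m /m'.
have H2 := H (fun i => And3 (slab_measurable a b (mC i)) (@slab_suba a b (C i)) (slab_fin ab (mC i) (nC i))).
rewrite -(slab_intensity ab mB nB) -(slab_intensity ab mB' nB') -H2.
apply: measure_ae_eq.
- by do ?apply: measurableI => //; exact: jslab_meas'.
- apply: measurableI => //.
  rewrite (_ : [set w | _] = [set w | N w (slab a b B) = k%:R%:E] `&`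
     [set w | N w (slab a b B') = j%:R%:E]).
    by apply: measurableI; exact: mN.
  apply/seteqP; split => w.
    by move=> Hw; split; [exact: (Hw ord0)|exact: (Hw (lift ord0 ord0))].
  by move=> [h1 h2] i; rewrite /C /K; case: ifP.
have := slab_finite a0 ab mB nB; apply: filterS2 (slab_finite a0 ab mB' nB').
move=> w Nw' Nw; split => [[[Ew /= h1] h2]|[Ew Hw]]; split => //=.
- by move=> i; rewrite /C /K; case: ifP => _; rewrite ?Nw ?Nw' ?h1 ?h2.
- by split => //=; apply: jump_jcount; exact: (Hw (lift ord0 ord0)).
- by apply: jump_jcount; exact: (Hw ord0).
Qed.

Definition ppp_incr (B : set U) (a b : R) (w : T) : R :=
  compensated_measure nu (jump_measure p) a b B w.

Lemma ppp_incrE B a b w : ppp_incr B a b w =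
  (jcount p (slab a b B) w)%:R - (b - a) * fine (nu B).
Proof. by rewrite /ppp_incr /compensated_measure fine_jump. Qed.

Lemma ppp_incrF B a b : ppp_incr B a b = fun w =>
  (jcount p (slab a b B) w)%:R - (b - a) * fine (nu B).
Proof. by apply/funext => w; exact: ppp_incrE. Qed.

Let l0 a b B : a <= b -> 0 <= (b - a) * fine (nu B).
Proof. by move=> ab; rewrite mulr_ge0 ?subr_ge0// fine_ge0. Qed.

Lemma ppp_incr_meas B a b : measurable B -> 0 <= a -> a <= b ->
  meas_wrt (F b) (ppp_incr B a b).
Proof.
move=> mB a0 ab; rewrite ppp_incrF.
apply: (@measurable_funB _ (g_sigma_algebraType (F b))) => //.
apply: measurable_natr => k.
by apply: sub_sigma_algebra; exact: jslab_meas.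
Qed.

Let FT a : 0 <= a -> F a setT.
Proof. by move=> /Fsigma[s0 sC _]; rewrite -(setD0 setT); exact: sC. Qed.

Lemma jslab_L2 a b B : 0 <= a -> a <= b -> measurable B -> (nu B < +oo)%E ->
  Ltwo P (fun w => (jcount p (slab a b B) w)%:R) /\
  ex P (fun w => (jcount p (slab a b B) w)%:R) = (b - a) * fine (nu B) /\
  ex P (fun w => (jcount p (slab a b B) w)%:R ^+ 2) =
    (b - a) * fine (nu B) + ((b - a) * fine (nu B)) ^+ 2.
Proof.
move=> a0 ab mB nB.
have law k : P (setT `&` jcount p (slab a b B) @^-1` [set k]) =
    (1 * poisson_mass ((b - a) * fine (nu B)) k)%:E.
  rewrite (jslab_law _ a0 ab mB nB (FT a0)); congr (_ * _)%:E.
  by have := probability_setT P => /(congr1 fine).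
have mD k : measurable (jcount p (slab a b B) @^-1` [set k]) by exact: jslab_meas'.
have := poisson_Ltwo (l0 B ab) mD measurableT law.
have := poisson_mean (l0 B ab) mD measurableT law.
have := poisson_square (l0 B ab) mD measurableT law.
under eq_fun do rewrite indicT mul1r; move=> ->.
under eq_fun do rewrite indicT mul1r; move=> ->.
by move=> L; rewrite !mul1r.
Qed.

Lemma ppp_integrator B : measurable B -> (nu B < +oo)%E ->
  integrator P F (ppp_incr B).
Proof.
move=> mB nB; split.
- by move=> a b; exact: ppp_incr_meas.
- move=> a b a0 ab; rewrite ppp_incrF.
  apply: LtwoB; last exact: Ltwo_cst.
  by have [] := jslab_L2 a0 ab mB nB.
- move=> a b E a0 ab FE; under eq_fun do rewrite ppp_incrE.
  apply: (poisson_centered_mean (l0 B ab) _ _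
    (fun k => jslab_law k a0 ab mB nB FE)).
  + by move=> k; exact: jslab_meas'.
  + exact: Fmeas FE.
(* Additivity holds on the almost sure event where the counts over the two slabs are finite;
   elsewhere the default value of [jcount] may break it. *)
- move=> a b c a0 ab bc; have b0 := le_trans a0 ab.
  have := slab_finite a0 ab mB nB; apply: filterS2 (slab_finite b0 bc mB nB).
  move=> w N2 N1; rewrite !ppp_incrE.
  have -> : slab a c B = slab a b B `|` slab b c B.
    apply/seteqP; split => [[s u] [/= + Bu]|[s u] [[/= + Bu]|[/= + Bu]]].
    - rewrite in_itv/= => /andP[sa sc]; have [sb|sb] := leP s b; [left|right];
        by split => //=; rewrite in_itv/= ?sa ?sb.
    - by rewrite in_itv/= => /andP[sa sb]; split => //=; rewrite in_itv/= sa (le_trans sb).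
    - by rewrite in_itv/= => /andP[sb sc]; split => //=; rewrite in_itv/= sc (le_lt_trans ab).
  rewrite jcountU//; first by rewrite natrD; ring.
  apply/seteqP; split => // -[s u] [[/= + _] [/= + _]].
  by rewrite !in_itv/= => /andP[_ sb] /andP[]; rewrite ltNge sb.
Qed.

Let ppp_covar_eq B : measurable B -> (nu B < +oo)%E ->
  covar P F (ppp_incr B) (ppp_incr B) (fine (nu B)).
Proof.
move=> mB nB a b E a0 ab FE.
have mE : measurable E by exact: Fmeas FE.
under eq_fun do rewrite !ppp_incrE -expr2.
rewrite (poisson_variance (l0 B ab) _ mE (fun k => jslab_law k a0 ab mB nB FE)).
  by rewrite ex_indic//; ring.
by move=> k; exact: jslab_meas'.
Qed.

Let ppp_covar_disj B B' : measurable B -> (nu B < +oo)%E ->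
  measurable B' -> (nu B' < +oo)%E -> B `&` B' = set0 ->
  covar P F (ppp_incr B) (ppp_incr B') 0.
Proof.
move=> mB nB mB' nB' BB a b E a0 ab FE; rewrite !mul0r.
have mE : measurable E by exact: Fmeas FE.
have LB := integrator_L2 (ppp_integrator mB nB) a0 ab.
have LB' := integrator_L2 (ppp_integrator mB' nB') a0 ab.
have LE : Ltwo P (fun w => \1_E w * ppp_incr B a b w).
  apply: (@LtwoM_bounded _ _ _ _ _ _ 1) => //.
  by move=> w; rewrite indicE; case: (_ \in _); rewrite ?normr1 ?normr0.
have -> : (fun w => \1_E w * (ppp_incr B a b w * ppp_incr B' a b w)) =
    (fun w => ((jcount p (slab a b B') w)%:R - (b - a) * fine (nu B')) *
      (\1_E w * ppp_incr B a b w)).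
  by apply/funext => w; rewrite -ppp_incrE; ring.
have mD C k : measurable C -> measurable (jcount p (slab a b C) @^-1` [set k]).
  by move=> mC; exact: jslab_meas'.
apply: (@ex_orth_nat _ _ _ P (jcount p (slab a b B')) _
  (fun w => \1_E w * ppp_incr B a b w)
  (fun k => k%:R - (b - a) * fine (nu B'))).
- by move=> k; exact: mD.
- move=> j.
  have := poisson_centered_mean (l0 B ab) (fun k => mD B k mB)
    (measurableI _ _ mE (mD B' j mB')) (fun k => jslab_law2 j k a0 ab mB nB mB' nB' BB FE).
  move=> H; rewrite -[RHS]H.
  by congr ex; apply/funext => w; rewrite ppp_incrE indicI /=; ring.
- exact: Ltwo_Lone.
- have := Ltwo_mul LB' LE; congr Lone; apply/funext => w.
  by rewrite ppp_incrE.
Qed.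

Let nu_sub B B' : measurable B -> measurable B' -> B `<=` B' -> (nu B' < +oo)%E ->
  (nu B < +oo)%E.
Proof.
move=> mB mB' BB; apply: le_lt_trans.
exact: (le_measure _ (mem_set mB) (mem_set mB') BB).
Qed.

Let ppp_split B C a b : measurable B -> (nu B < +oo)%E -> measurable C ->
  0 <= a -> a <= b ->
  {ae P, forall w, ppp_incr B a b w =
    ppp_incr (B `&` C) a b w + ppp_incr (B `\` C) a b w}.
Proof.
move=> mB nB mC a0 ab.
have mI : measurable (B `&` C) by exact: measurableI.
have mD : measurable (B `\` C) by exact: measurableD.
have nI : (nu (B `&` C) < +oo)%E by apply: (nu_sub mI mB) => //; exact: subIsetl.
have nD : (nu (B `\` C) < +oo)%E by apply: (nu_sub mD mB) => //; exact: subDsetl.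
have := slab_finite a0 ab mI nI; apply: filterS2 (slab_finite a0 ab mD nD).
move=> w N2 N1; rewrite !ppp_incrE.
have E : slab a b B = slab a b (B `&` C) `|` slab a b (B `\` C).
  apply/seteqP; split => [[s u] [/= abs Bu]|[s u] [[/= abs [Bu _]]|[/= abs [Bu _]]]] //.
  by have [Cu|Cu] := pselect (C u); [left|right].
rewrite E jcountU//; last first.
  by apply/seteqP; split => // -[s u] [[_ [_ Cu]] [_ [_ /=]]].
rewrite natrD (_ : fine (nu B) = fine (nu (B `&` C)) + fine (nu (B `\` C))); first by ring.
rewrite -fineD ?ge0_fin_numE// -measureU//.
- by congr (fine (nu _)); rewrite setDE -setIUr setUv setIT.
- by apply/seteqP; split => // u [[_ Cu] [_ /=]].
Qed.

(** Both sets are cut along [B]&[B']. Of the four products, three involve disjoint sets of marks and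
    vanish, and the remaining one is the variance of the common part. *)
Lemma ppp_covar B B' : measurable B -> (nu B < +oo)%E ->
  measurable B' -> (nu B' < +oo)%E ->
  covar P F (ppp_incr B) (ppp_incr B') (fine (nu (B `&` B'))).
Proof.
move=> mB nB mB' nB' a b E a0 ab FE.
have mE : measurable E by exact: Fmeas FE.
have mI : measurable (B `&` B') by exact: measurableI.
have mD : measurable (B `\` B') by exact: measurableD.
have mD' : measurable (B' `\` B) by exact: measurableD.
have nI : (nu (B `&` B') < +oo)%E by apply: (nu_sub mI mB) => //; exact: subIsetl.
have nD : (nu (B `\` B') < +oo)%E by apply: (nu_sub mD mB) => //; exact: subDsetl.
have nD' : (nu (B' `\` B) < +oo)%E by apply: (nu_sub mD' mB') => //; exact: subDsetl.
have L2 C : measurable C -> (nu C < +oo)%E -> Ltwo P (ppp_incr C a b).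
  by move=> mC nC; exact: (integrator_L2 (ppp_integrator mC nC)).
have LI := L2 _ mI nI; have LD := L2 _ mD nD; have LD' := L2 _ mD' nD'.
have LB := L2 _ mB nB; have LB' := L2 _ mB' nB'.
have E1 w : `|\1_E w : R| <= 1.
  by rewrite indicE; case: (_ \in _); rewrite ?normr1 ?normr0.
have Lpr f g : Ltwo P f -> Ltwo P g -> Lone P (fun w => \1_E w * (f w * g w)).
  by move=> Lf Lg; apply: (@LoneM_bounded _ _ _ _ _ _ 1) => //; exact: Ltwo_mul.
have mm C : measurable C -> (nu C < +oo)%E -> measurable_fun setT (ppp_incr C a b).
  by move=> mC nC; exact: (L2 C mC nC).1.
rewrite (@ex_ae _ _ _ _ _ (fun w =>
  (\1_E w * (ppp_incr (B `&` B') a b w * ppp_incr (B `&` B') a b w) +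
   \1_E w * (ppp_incr (B `&` B') a b w * ppp_incr (B' `\` B) a b w)) +
  (\1_E w * (ppp_incr (B `\` B') a b w * ppp_incr (B `&` B') a b w) +
   \1_E w * (ppp_incr (B `\` B') a b w * ppp_incr (B' `\` B) a b w)))).
- rewrite exD; [|by apply: LoneD; exact: Lpr|by apply: LoneD; exact: Lpr].
  rewrite !exD; do ?exact: Lpr.
  rewrite (ppp_covar_eq mI nI)// (ppp_covar_disj mI nI mD' nD')//; last first.
    by apply/seteqP; split => // u [[Bu _] [_ /=]].
  rewrite (ppp_covar_disj mD nD mI nI)//; last first.
    by apply/seteqP; split => // u [[_ /= nB'u] [_ B'u]].
  rewrite (ppp_covar_disj mD nD mD' nD')//; last first.
    by apply/seteqP; split => // u [[Bu _] [_ /=]].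
  by rewrite !mul0r !addr0.
- by apply: measurable_funM => //; apply: measurable_funM; exact: mm.
- by do 2 (apply: measurable_funD); apply: measurable_funM => //; apply: measurable_funM; exact: mm.
have S1 := ppp_split mB nB mB' a0 ab; have S2 := ppp_split mB' nB' mB a0 ab.
apply: filterS2 S1 S2 => w -> ->; rewrite (setIC B'); ring.
Qed.

End poisson_integrator.

(** * Brownian against Poisson increments *)

Section cross_covariance.
Context {R : realType} {dT : measure_display} {T : measurableType dT}.
Variable P : probability T R.
Variable F : R -> set (set T).
Hypothesis Fsigma : forall t, 0 <= t -> sigma_algebra setT (F t).
Hypothesis Fmeas : forall t, 0 <= t -> F t `<=` measurable.
Hypothesis Fmono : forall s t, 0 <= s -> s <= t -> F s `<=` F t.

Lemma additive_interval_bound (f : R -> R -> R) (s h g : R) : 0 <= h ->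
  (forall a b c, s <= a -> a <= b -> b <= c -> f a c = f a b + f b c) ->
  (forall a, s <= a -> `|f a (a + h)| <= g) ->
  forall n, `|f s (s + n%:R * h)| <= n%:R * g.
Proof.
move=> h0 fadd fg; elim=> [|n ih].
  rewrite !mul0r addr0 normr_le0; apply/eqP.
  by have := fadd s s s (lexx _) (lexx _) (lexx _); lra.
rewrite (fadd s (s + n%:R * h))//; last 2 first.
- by rewrite lerDl mulr_ge0.
- by rewrite lerD2l ler_wpM2r// ler_nat.
rewrite -natr1 mulrDl [X in _ <= X]mulrDl mul1r (le_trans (ler_normD _ _))//.
rewrite mul1r addrA lerD//; apply: fg; rewrite lerDl mulr_ge0//.
Qed.

Context {d : nat}.
Variables (W : R -> T -> 'cV[R]_d) (W_BM : brownian_motion P F W).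
Context {dU : measure_display} {U : measurableType dU}.
Variable nu : {sigma_finite_measure set U -> \bar R}.
Variables (p : R -> T -> option U) (p_PPP : poisson_point_process P F nu p).
Variables (i : 'I_d) (B : set U) (mB : measurable B) (nB : (nu B < +oo)%E).

Let iW := bm_integrator Fsigma Fmeas Fmono W_BM i.
Let iN := ppp_integrator Fsigma Fmeas p_PPP mB nB.
Let l := fine (nu B).
Let l0 : 0 <= l. Proof. exact: fine_ge0. Qed.

Let indic_le1 (E : set T) w : `|\1_E w : R| <= 1.
Proof. by rewrite indicE; case: (_ \in _); rewrite ?normr1 ?normr0. Qed.

(* Truncating at level [e], a product [|x| n] is at most
   [e n + e^-3 x^4 / 2 + e n^2 / 2]. *)
Let young (x n e : R) : 0 < e -> 0 <= n ->
  `|x| * n <= e * n + (e ^- 3 / 2 * x ^+ 4 + e / 2 * n ^+ 2).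
Proof.
move=> e0 n0; have y0 := normr_ge0 x.
rewrite (_ : x ^+ 4 = `|x| ^+ 4); last by rewrite -normrX ger0_norm// exprn_even_ge0.
move: (`|x|) y0 => y y0.
have e3 : 0 < e ^- 3 by rewrite invr_gt0 exprn_gt0.
have y4 : 0 <= y ^+ 4 by rewrite exprn_ge0.
have n2 := sqr_ge0 n.
have [ye|ey] := leP y e.
  have : y * n <= e * n by rewrite ler_wpM2r.
  have : 0 <= e ^- 3 / 2 * y ^+ 4 by rewrite mulr_ge0// divr_ge0// ltW.
  have : 0 <= e / 2 * n ^+ 2 by rewrite mulr_ge0// divr_ge0// ltW.
  lra.
have h1 : y * n <= y ^+ 2 / e * n.
  rewrite ler_wpM2r// expr2 -mulrA ler_peMr// ler_pdivlMr// mul1r ltW//.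
have h2 : y ^+ 2 / e * n <= e ^- 3 / 2 * y ^+ 4 + e / 2 * n ^+ 2.
  rewrite -subr_ge0.
  have -> : e ^- 3 / 2 * y ^+ 4 + e / 2 * n ^+ 2 - y ^+ 2 / e * n =
      e / 2 * (y ^+ 2 / e ^+ 2 - n) ^+ 2 by field; rewrite gt_eqF.
  by rewrite mulr_ge0 ?sqr_ge0// divr_ge0// ltW.
have : 0 <= e * n by rewrite mulr_ge0// ltW.
lra.
Qed.

(** The compensator contributes a constant times a martingale increment, hence nothing. To the rest
    [young] applies with moments of order [h] for the count and [h^2] for the fourth power, so to
    first order in [h] the bound is [3/2 e l h], with [e] still arbitrary. *)
Let small (E : set T) (e a h : R) : 0 < e -> 0 <= a -> 0 < h -> F a E ->
  `|ex P (fun w => \1_E w * (bm_incr W i a (a + h) w * ppp_incr nu p B a (a + h) w))|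
  <= h * (e * l + (e ^- 3 * 32 * h + e / 2 * (l + l ^+ 2 * h))).
Proof.
move=> e0 a0 h0 FE; set b := a + h.
have ab : a < b by rewrite ltrDl.
have mE : measurable E by exact: Fmeas FE.
have ba : b - a = h by rewrite /b; ring.
pose n w : R := (jcount p (slab a b B) w)%:R.
have [Ln [En En2]] := jslab_L2 Fsigma Fmeas p_PPP a0 (ltW ab) mB nB.
rewrite -/n -/l ba in Ln En En2.
have LW := integrator_L2 iW a0 (ltW ab).
have mW := Ltwo_meas LW.
have LEW : Lone P (fun w => \1_E w * bm_incr W i a b w).
  by apply: (@LoneM_bounded _ _ _ _ _ _ 1) => //; exact: Ltwo_Lone.
have LEWn : Lone P (fun w => \1_E w * (bm_incr W i a b w * n w)).
  by apply: (@LoneM_bounded _ _ _ _ _ _ 1) => //; exact: Ltwo_mul.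
have -> : (fun w => \1_E w * (bm_incr W i a b w * ppp_incr nu p B a b w)) =
    (fun w => \1_E w * (bm_incr W i a b w * n w) -
      (h * l) * (\1_E w * bm_incr W i a b w)).
  by apply/funext => w; rewrite ppp_incrE ba -/(n w) -/l; ring.
rewrite exB//; last exact: LoneZ.
rewrite exZ// (integrator_mart iW a0 (ltW ab) FE) mulr0 subr0.
apply: le_trans (ex_norm_le LEWn) _.
have m4 : measurable_fun setT (fun w => bm_incr W i a b w ^+ 4).
  exact: measurable_funX.
have W40 w : 0 <= bm_incr W i a b w ^+ 4 by exact: exprn_even_ge0.
have h4 := bm_incr_fourth Fsigma Fmeas Fmono W_BM i a0 ab.
rewrite ba in h4.
have L4 : Lone P (fun w => bm_incr W i a b w ^+ 4).
  by apply: Lone_ge0P => //; exact: le_lt_trans h4 (ltry _).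
have E4 : ex P (fun w => bm_incr W i a b w ^+ 4) <= 64 * h ^+ 2.
  by rewrite -lee_fin EFin_ex.
have Ln2 : Lone P (fun w => n w ^+ 2) by case: Ln.
have Ln1 := Ltwo_Lone Ln.
have Lr : Lone P (fun w => e * n w + (e ^- 3 / 2 * bm_incr W i a b w ^+ 4 + e / 2 * n w ^+ 2)).
  by apply: LoneD; [exact: LoneZ|apply: LoneD; exact: LoneZ].
apply: (@le_trans _ _ (ex P (fun w => e * n w + (e ^- 3 / 2 * bm_incr W i a b w ^+ 4 + e / 2 * n w ^+ 2)))).
  apply: ex_le => //; first exact: integrable_norm LEWn.
  move=> w; rewrite !normrM (le_trans _ (young _ e0 (_ : 0 <= n w)))//.
  by rewrite [X in _ * (_ * X)]ger0_norm// ler_piMl// mulr_ge0.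
rewrite exD; [|exact: LoneZ|by apply: LoneD; exact: LoneZ].
rewrite exD; [|exact: LoneZ|exact: LoneZ].
rewrite !exZ// En En2.
have e3 : 0 < e ^- 3 by rewrite invr_gt0 exprn_gt0.
have : e ^- 3 * ex P (fun w => bm_incr W i a b w ^+ 4) <= e ^- 3 * (64 * h ^+ 2).
  by rewrite ler_pM2l.
by lra.
Qed.

(* A Brownian increment and a Poisson increment over an interval of length [h]
   have a product of order [o(h)] in mean: summing over a subdivision shows
   that the covariance vanishes. *)
Lemma bm_ppp_covar : covar P F (bm_incr W i) (ppp_incr nu p B) 0.
Proof.
move=> s t E s0; rewrite le_eqVlt => /predU1P[<-|st] FE.
  under [X in ex P X]eq_fun do rewrite /bm_incr subrr mul0r mulr0.
  by rewrite !mul0r; exact: ex_cst.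
rewrite !mul0r.
have mE : measurable E by exact: Fmeas FE.
pose f a b := ex P (fun w => \1_E w * (bm_incr W i a b w * ppp_incr nu p B a b w)).
(* The mixed terms of the expansion pair an increment over [(b, c]] with an [F b]-measurable factor
   and vanish. *)
have fadd a b c : s <= a -> a <= b -> b <= c -> f a c = f a b + f b c.
  move=> sa ab bc; have a0 := le_trans s0 sa; have b0 := le_trans a0 ab.
  have ac := le_trans ab bc.
  have LW1 := integrator_L2 iW a0 ab; have LW2 := integrator_L2 iW b0 bc.
  have LN1 := integrator_L2 iN a0 ab; have LN2 := integrator_L2 iN b0 bc.
  have LW3 := integrator_L2 iW a0 ac; have LN3 := integrator_L2 iN a0 ac.
  have FaE : F a E by exact: (Fmono s0 sa).
  have bE : bmeas (F a) (\1_E : T -> R).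
    by split; [exact: meas_wrt_indic|exists 1].
  have bEb := bmeas_sub Fmono a0 ab bE.
  have LE f1 f2 : Ltwo P f1 -> Ltwo P f2 -> Lone P (fun w => \1_E w * (f1 w * f2 w)).
    by move=> L1 L2; apply: (@LoneM_bounded _ _ _ _ _ _ 1) => //; exact: Ltwo_mul.
  rewrite /f (@ex_ae _ _ _ _ _ (fun w =>
    (\1_E w * (bm_incr W i a b w * ppp_incr nu p B a b w) +
     \1_E w * (bm_incr W i b c w * ppp_incr nu p B b c w)) +
    ((\1_E w * bm_incr W i a b w) * ppp_incr nu p B b c w +
     (\1_E w * ppp_incr nu p B a b w) * bm_incr W i b c w))).
  - have L2W : Ltwo P (fun w => \1_E w * bm_incr W i a b w).
      exact: (bmeas_Ltwo Fmeas a0).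
    have L2N : Ltwo P (fun w => \1_E w * ppp_incr nu p B a b w).
      exact: (bmeas_Ltwo Fmeas a0).
    rewrite exD; last 2 first.
    + by apply: LoneD; exact: LE.
    + by apply: LoneD; exact: Ltwo_mul.
    rewrite exD; [|exact: LE|exact: LE].
    rewrite [X in _ + X]exD; [|exact: Ltwo_mul|exact: Ltwo_mul].
    rewrite (integrator_orth Fsigma Fmeas iN b0 bc)//; last first.
      by apply: meas_wrtM; [exact: bEb.1|exact: integrator_meas iW _ _ _ _].
    rewrite (integrator_orth Fsigma Fmeas iW b0 bc)//; last first.
      by apply: meas_wrtM; [exact: bEb.1|exact: integrator_meas iN _ _ _ _].
    by rewrite !addr0.
  - by apply: Lone_meas; exact: LE.
  - apply: Lone_meas; apply: LoneD; apply: LoneD; do ?exact: LE.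
    + by apply: Ltwo_mul => //; exact: (bmeas_Ltwo Fmeas a0).
    + by apply: Ltwo_mul => //; exact: (bmeas_Ltwo Fmeas a0).
  apply: filterS2 (integrator_add iW a0 ab bc) (integrator_add iN a0 ab bc).
  by move=> w -> ->; ring.
(* The total of the bounds [small], divided by [e]; the summand 1 pays for the term
   [e ^- 3 * 32 * h], which the choice of [n] below makes at most [e]. *)
pose C := (t - s) * (l + 1 + (l + l ^+ 2 * (t - s)) / 2).
have C0 : 0 < C.
  have : 0 <= l ^+ 2 * (t - s) by rewrite mulr_ge0 ?sqr_ge0// subr_ge0 ltW.
  by move=> h; rewrite mulr_gt0 ?subr_gt0//; have := l0; lra.
have key e : 0 < e -> `|f s t| <= e * C.
  move=> e0; have e3 : 0 < e ^- 3 by rewrite invr_gt0 exprn_gt0.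
  pose n := (Num.truncn (e ^- 3 * 32 * (t - s) / e)).+1.
  have n0 : (0 : R) < n%:R by rewrite ltr0n.
  have nE : e ^- 3 * 32 * ((t - s) / n%:R) <= e.
    rewrite mulrA ler_pdivrMr// [leRHS]mulrC -ler_pdivrMr// ltW//.
    by rewrite /n; exact: truncnS_gt.
  pose h := (t - s) / n%:R.
  have h0 : 0 < h by rewrite divr_gt0// subr_gt0.
  have hts : h <= t - s.
    rewrite ler_pdivrMr//; apply: ler_peMr; last by rewrite ler1n.
    by rewrite subr_ge0 ltW.
  have := @additive_interval_bound f s h
    (h * (e * l + (e ^- 3 * 32 * h + e / 2 * (l + l ^+ 2 * h)))) (ltW h0) fadd _ n.
  have -> : s + n%:R * h = t by rewrite /h; field; rewrite gt_eqF.
  move=> H; apply: (le_trans (H _)).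
    move=> a sa; apply: small => //; first exact: le_trans sa.
    exact: (Fmono s0 sa).
  rewrite mulrA (_ : n%:R * h = t - s); last by rewrite /h; field; rewrite gt_eqF.
  rewrite /C [leRHS]mulrCA; apply: ler_wpM2l; first by rewrite subr_ge0 ltW.
  have : l ^+ 2 * h <= l ^+ 2 * (t - s) by rewrite ler_wpM2l ?sqr_ge0.
  move=> hl; have : e * (l ^+ 2 * h) <= e * (l ^+ 2 * (t - s)) by rewrite ler_pM2l.
  by move: nE; rewrite -/h; nra.
apply/eqP; rewrite -normr_le0; apply/ler_addgt0Pr => e e0; rewrite add0r.
have := key (e / C) (divr_gt0 e0 C0); rewrite divfK ?gt_eqF//.
Qed.

End cross_covariance.

(** * Simple integrands *)

Section clipping.
Context {R : realType}.
Notation lam := (@lebesgue_measure R).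

(** For [s <= t], the projection of [x] onto [[s, t]]: clipping both ends of an interval intersects
    it with [(s, t]], up to degenerate intervals. *)
Definition clip (s t x : R) : R := Num.max s (Num.min x t).

Lemma clip_ge s t x : s <= clip s t x.
Proof. by rewrite /clip le_max lexx. Qed.

Lemma clip_homo s t x y : x <= y -> clip s t x <= clip s t y.
Proof.
move=> xy; rewrite /clip ge_max !le_max lexx/=.
suff -> : Num.min x t <= Num.min y t by rewrite orbT.
by rewrite le_min !ge_min xy lexx orbT.
Qed.

Lemma clip_mem s t x y r : s <= t -> x <= y ->
  (r \in `]s, t]) && (r \in `]x, y]) = (r \in `]clip s t x, clip s t y]).
Proof.
move=> st xy; rewrite !in_itv/= /clip maxEle minEle minEle maxEle.
apply/idP/idP => [/andP[/andP[h1 h2] /andP[h3 h4]]|/andP[]].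
  by repeat case: ifPn; rewrite -?ltNge => *; apply/andP; split; lra.
repeat case: ifPn; rewrite -?ltNge => *; repeat (apply/andP; split); lra.
Qed.

Lemma overlap_measure u v u' v' :
  lam (`]u, v]%classic `&` `]u', v']%classic) = (overlap u v u' v')%:E.
Proof.
have -> : `]u, v]%classic `&` `]u', v']%classic =
    `]Num.max u u', Num.min v v']%classic.
  apply/seteqP; split => r /=; rewrite !in_itv/= gt_max le_min.
    by move=> [/andP[-> ->] /andP[-> ->]].
  by move=> /andP[/andP[-> ->] /andP[-> ->]].
rewrite lebesgue_measure_itv/= lte_fin /overlap; case: ltP => h.
  by rewrite -EFinB; congr (_%:E); apply/esym/max_idPr; rewrite subr_ge0 ltW.
by congr (_%:E); apply/esym/max_idPl; rewrite subr_le0.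
Qed.

Lemma integral_itv_quad (I : finType) (lo hi : I -> R) (C : I -> I -> R) s t :
  s <= t -> (forall k, lo k <= hi k) ->
  (\int[lam]_(r in `]s, t]) (\sum_k \sum_l C k l *
     (\1_(`]lo k, hi k]) r * \1_(`]lo l, hi l]) r))%:E =
   (\sum_k \sum_l C k l * overlap (clip s t (lo k)) (clip s t (hi k))
      (clip s t (lo l)) (clip s t (hi l)))%:E)%E.
Proof.
move=> st lohi.
pose J k l : set (measurableTypeR R) :=
  `]lo k, hi k]%classic `&` `]lo l, hi l]%classic.
have mJ k l : measurable (J k l) by exact: measurableI.
have LJ k l : lam.-integrable `]s, t] (fun r => (\1_(J k l) r)%:E).
  apply: (integrableS measurableT) => //.
  rewrite (_ : J k l = [set` Interval (BSide false (Num.max (lo k) (lo l)))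
     (BSide false (Num.min (hi k) (hi l)))]); first exact: integrable_indic_itv.
  rewrite /J; apply/seteqP; split => r /=; rewrite !in_itv/= gt_max le_min.
    by move=> [/andP[-> ->] /andP[-> ->]].
  by move=> /andP[/andP[-> ->] /andP[-> ->]].
pose G k l r := ((C k l)%:E * (\1_(J k l) r)%:E)%E.
have LG k l : lam.-integrable `]s, t] (G k l) by exact: integrableZl.
transitivity (\int[lam]_(r in `]s, t]) (\sum_k (\sum_l G k l r)))%E.
  apply: eq_integral => r _; rewrite -sumEFin; apply: eq_bigr => k _.
  by rewrite -sumEFin; apply: eq_bigr => l _; rewrite /G -EFinM indicI.
rewrite integral_sum//; last by move=> k; exact: integrable_sum.
rewrite -sumEFin; apply: eq_bigr => k _.
rewrite integral_sum// -sumEFin; apply: eq_bigr => l _.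
rewrite /G integralZl//.
rewrite EFinM; congr (_ * _)%E; rewrite integral_indic//.
rewrite -overlap_measure; congr (lam _); rewrite /J; apply/seteqP; split => r /=.
  by move=> [[h1 h2] h3]; split; rewrite -(clip_mem _ st)// h3.
by rewrite -!(clip_mem _ st)// => -[/andP[-> ->] /andP[_ ->]].
Qed.

Lemma integral_indic_quad {d} {V : measurableType d}
    (m : {measure set V -> \bar R}) (I : finType) (a : I -> R) (B : I -> set V) :
  (forall k, measurable (B k)) -> (forall k, (m (B k) < +oo)%E) ->
  (\int[m]_u ((\sum_k a k * \1_(B k) u) ^+ 2)%:E =
   (\sum_k \sum_l a k * a l * fine (m (B k `&` B l)))%:E)%E.
Proof.
move=> mB fB.
have mI k l : measurable (B k `&` B l) by exact: measurableI.
have fI k l : (m (B k `&` B l) < +oo)%E.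
  apply: le_lt_trans (fB k).
  apply: (le_measure _ (mem_set (mI k l)) (mem_set (mB k))); exact: subIsetl.
have Li k l : m.-integrable setT (fun u => (\1_(B k `&` B l) u)%:E).
  apply/integrableP; split; first by apply/measurable_EFinP; exact: measurable_indic.
  under eq_integral do rewrite gee0_abs//.
  by rewrite integral_indic// setIT.
pose G k l u := ((a k * a l)%:E * (\1_(B k `&` B l) u)%:E)%E.
have LG k l : m.-integrable setT (G k l) by exact: integrableZl.
transitivity (\int[m]_u (\sum_k (\sum_l G k l u)))%E.
  apply: eq_integral => u _; rewrite expr2 big_distrlr/= -sumEFin.
  apply: eq_bigr => k _; rewrite -sumEFin; apply: eq_bigr => l _.
  by rewrite /G -EFinM indicI/=; congr (_%:E); ring.
rewrite integral_sum//; last first.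
  by move=> k; exact: integrable_sum.
rewrite -sumEFin; apply: eq_bigr => k _.
rewrite integral_sum//.
rewrite -sumEFin; apply: eq_bigr => l _.
rewrite /G integralZl// integral_indic// setIT [RHS]EFinM fineK//.
by rewrite ge0_fin_numE.
Qed.

End clipping.

(** * Increments of simple stochastic integrals *)

Section simple_integrals.
Context {R : realType} {dT : measure_display} {T : measurableType dT}.
Variable P : probability T R.
Notation lam := (@lebesgue_measure R).
Variable F : R -> set (set T).
Hypothesis Fsigma : forall t, 0 <= t -> sigma_algebra setT (F t).
Hypothesis Fmeas : forall t, 0 <= t -> F t `<=` measurable.
Hypothesis Fmono : forall s t, 0 <= s -> s <= t -> F s `<=` F t.

Lemma integrator_diag L a : integrator P F L -> 0 <= a ->
  {ae P, forall w, L a a w = 0}.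
Proof.
move=> iL a0; apply: filterS (integrator_add iL a0 (lexx a) (lexx a)) => w.
lra.
Qed.

(** The common form of [sp_integral] and [sf_integral], with one integrator for each term. *)
Definition simp_sum (h : simple_process F) (L : 'I_(sp_size h) -> R -> R -> T -> R)
    (t : R) (w : T) : R :=
  \sum_k sp_coef k w * L k (Num.min (sp_lo k) t) (Num.min (sp_hi k) t) w.

Variable (h : simple_process F).
Notation lo := (@sp_lo _ _ _ F h).
Notation hi := (@sp_hi _ _ _ F h).
Notation coef := (@sp_coef _ _ _ F h).

Lemma sp_coef_bmeas k : bmeas (F (lo k)) (coef k).
Proof.
split; last exact: sp_coef_bounded.
by apply/(meas_wrtP _ (Fsigma (sp_lo_ge0 k))) => B mB; exact: sp_coef_meas.
Qed.

Variable (L : 'I_(sp_size h) -> R -> R -> T -> R).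
Hypothesis iL : forall k, integrator P F (L k).

Lemma simp_sum_meas t : 0 <= t -> measurable_fun setT (simp_sum L t).
Proof.
move=> t0; apply: measurable_sum => k; apply: measurable_funM.
  exact: (bmeas_meas Fmeas (sp_lo_ge0 k)) (sp_coef_bmeas k).
have := sp_lo_ge0 k; have := sp_lo_le_hi k => lh l0.
have m0 : 0 <= Num.min (lo k) t by rewrite le_min l0.
have mm : Num.min (lo k) t <= Num.min (hi k) t.
  by rewrite le_min !ge_min lh lexx !orbT.
by have [] := integrator_L2 (iL k) m0 mm.
Qed.

Variables (s t : R) (s0 : 0 <= s) (st : s <= t).

(** A coefficient with [lo k > t] is not known at the clipped left end, which is [t]. Setting it to
    0 restores measurability, and is harmless since the clipped interval is then degenerate. *)
Definition clip_coef (k : 'I_(sp_size h)) (w : T) : R :=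
  if lo k <= t then coef k w else 0.

Notation clo := (fun k => clip s t (lo k)).
Notation chi := (fun k => clip s t (hi k)).

Lemma simp_elem_ok : elem_ok P F s clip_coef L clo chi.
Proof.
move=> k; split => //; [exact: clip_ge|exact/clip_homo/sp_lo_le_hi|].
have lk0 := sp_lo_ge0 k.
have [bm [M bM]] := sp_coef_bmeas k.
have [lt|lt] := leP (lo k) t; last first.
  rewrite (_ : clip_coef k = cst 0); last first.
    by apply/funext => w; rewrite /clip_coef leNgt lt.
  by split; [exact: measurable_cst|exists 0 => w; rewrite normr0].
rewrite (_ : clip_coef k = coef k); last by apply/funext => w; rewrite /clip_coef lt.
apply: (bmeas_sub Fmono lk0); last exact: sp_coef_bmeas.
by rewrite /clip (min_idPl lt) le_max lexx orbT.
Qed.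

(** The proof goes through the positions of [lo k] and [hi k] relative to [s] and [t]. The equality
    is almost sure because additivity of the integrators, and with it [L a a = 0], is. *)
Lemma simp_sum_incr : {ae P, forall w, simp_sum L t w - simp_sum L s w =
  elem_sum clip_coef L clo chi w}.
Proof.
have t0 := le_trans s0 st.
have : forall k, {ae P, forall w,
    coef k w * L k (Num.min (lo k) t) (Num.min (hi k) t) w -
    coef k w * L k (Num.min (lo k) s) (Num.min (hi k) s) w =
    clip_coef k w * L k (clo k) (chi k) w}.
  move=> k; have l0 := sp_lo_ge0 k; have lh := sp_lo_le_hi k.
  have Ls := integrator_diag (iL k) s0; have Lt := integrator_diag (iL k) t0.
  rewrite /clip_coef /clip; have [ks|] := boolP (hi k <= s).
    have lks := le_trans lh ks.
    rewrite (min_idPl lks) (min_idPl ks) (min_idPl (le_trans lks st)).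
    rewrite (min_idPl (le_trans ks st)) (max_idPl lks) (max_idPl ks).
    by rewrite (le_trans lks st); apply: filterS Ls => w ->; rewrite subrr mulr0.
  rewrite -ltNge => ks.
  have sht : s <= Num.min (hi k) t by rewrite le_min st ltW.
  rewrite (max_idPr sht) (min_idPr (ltW ks)).
  have [ls|] := boolP (lo k <= s).
    rewrite (min_idPl ls) (min_idPl (le_trans ls st)) (max_idPl ls) (le_trans ls st).
    by apply: filterS (integrator_add (iL k) l0 ls sht) => w ->; ring.
  rewrite -ltNge => /ltW sl; rewrite (min_idPr sl).
  have [lt|] := boolP (lo k <= t).
    rewrite (min_idPl lt) (max_idPr sl).
    by apply: filterS Ls => w ->; rewrite mulr0 subr0.
  rewrite -ltNge => /ltW tl; rewrite (min_idPr tl) (min_idPr (le_trans tl lh)).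
  by apply: filterS2 Ls Lt => w -> ->; rewrite mul0r !mulr0 subrr.
move=> H; have {}H : {ae P, forall w k,
    coef k w * L k (Num.min (lo k) t) (Num.min (hi k) t) w -
    coef k w * L k (Num.min (lo k) s) (Num.min (hi k) s) w =
    clip_coef k w * L k (clo k) (chi k) w}.
  exact: filter_forall.
apply: filterS H => w Hw; rewrite /simp_sum -sumrB; apply: eq_bigr => k _.
exact: Hw.
Qed.

Lemma simp_sum0 : {ae P, forall w, simp_sum L 0 w = 0}.
Proof.
have H k : {ae P, forall w, L k 0 0 w = 0} by exact: integrator_diag.
have {}H : {ae P, forall w k, L k 0 0 w = 0} by exact: filter_forall.
apply: filterS H => w Hw; apply: big1 => k _.
have := sp_lo_ge0 k; have := sp_lo_le_hi k => lh l0.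
by rewrite (min_idPr l0) (min_idPr (le_trans l0 lh)) Hw mulr0.
Qed.

Lemma simp_sum_L2 : Ltwo P (fun w => simp_sum L t w - simp_sum L s w).
Proof.
have t0 := le_trans s0 st.
apply: (Ltwo_ae _ _ (elem_sum_L2 Fmeas s0 simp_elem_ok)).
  by apply: measurable_funB; exact: simp_sum_meas.
by apply: filterS simp_sum_incr => w ->.
Qed.

Variables (Z : T -> R) (bZ : bmeas (F s) Z).

Lemma simp_sum_mean : ex P (fun w => Z w * (simp_sum L t w - simp_sum L s w)) = 0.
Proof.
have t0 := le_trans s0 st.
rewrite -[RHS](elem_sum_mean Fsigma Fmeas Fmono s0 bZ simp_elem_ok).
have mZ := bmeas_meas Fmeas s0 bZ.
apply: ex_ae.
- apply: measurable_funM => //; apply: measurable_funB; exact: simp_sum_meas.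
- apply: measurable_funM => //.
  by case: (elem_sum_L2 Fmeas s0 simp_elem_ok).
- by apply: filterS simp_sum_incr => w ->.
Qed.

End simple_integrals.

(** * Covariance and isometry of simple stochastic integrals *)

Section simple_isometry.
Context {R : realType} {dT : measure_display} {T : measurableType dT}.
Variable P : probability T R.
Notation lam := (@lebesgue_measure R).
Variable F : R -> set (set T).
Hypothesis Fsigma : forall t, 0 <= t -> sigma_algebra setT (F t).
Hypothesis Fmeas : forall t, 0 <= t -> F t `<=` measurable.
Hypothesis Fmono : forall s t, 0 <= s -> s <= t -> F s `<=` F t.
Variables (s t : R) (s0 : 0 <= s) (st : s <= t).

Section covariance.
Variables (Z : T -> R) (bZ : bmeas (F s) Z).
Variables (h h' : simple_process F) (L : 'I_(sp_size h) -> R -> R -> T -> R).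
Variable (L' : 'I_(sp_size h') -> R -> R -> T -> R).
Hypothesis iL : forall k, integrator P F (L k).
Hypothesis iL' : forall k, integrator P F (L' k).
Variable q : 'I_(sp_size h) -> 'I_(sp_size h') -> R.
Hypothesis cq : forall k l, covar P F (L k) (L' l) (q k l).

Lemma simp_sum_cov :
  ex P (fun w => Z w * ((simp_sum L t w - simp_sum L s w) *
    (simp_sum L' t w - simp_sum L' s w))) =
  \sum_k \sum_l q k l * overlap (clip s t (sp_lo k)) (clip s t (sp_hi k))
      (clip s t (sp_lo l)) (clip s t (sp_hi l)) *
    ex P (fun w => Z w * (clip_coef t k w * clip_coef t l w)).
Proof.
have ok := simp_elem_ok Fsigma Fmono iL s t.
have ok' := simp_elem_ok Fsigma Fmono iL' s t.
rewrite -(elem_sum_cov Fsigma Fmeas Fmono s0 bZ ok ok' cq).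
have mZ := bmeas_meas Fmeas s0 bZ.
have [m1 _] := simp_sum_L2 Fsigma Fmeas Fmono iL s0 st.
have [m2 _] := simp_sum_L2 Fsigma Fmeas Fmono iL' s0 st.
have [m3 _] := elem_sum_L2 Fmeas s0 ok.
have [m4 _] := elem_sum_L2 Fmeas s0 ok'.
apply: ex_ae.
- by do 2 apply: measurable_funM => //.
- by do 2 apply: measurable_funM => //.
by apply: filterS2 (simp_sum_incr iL s0 st) (simp_sum_incr iL' s0 st) => w -> ->.
Qed.

Lemma simp_sum_ortho : (forall k l, q k l = 0) ->
  ex P (fun w => Z w * ((simp_sum L t w - simp_sum L s w) *
    (simp_sum L' t w - simp_sum L' s w))) = 0.
Proof.
move=> q0; rewrite simp_sum_cov; apply: big1 => k _; apply: big1 => l _.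
by rewrite q0 !mul0r.
Qed.

End covariance.

Section isometry.
Variables (h : simple_process F) (L : 'I_(sp_size h) -> R -> R -> T -> R).
Hypothesis iL : forall k, integrator P F (L k).
Variable q : 'I_(sp_size h) -> 'I_(sp_size h) -> R.
Hypothesis cq : forall k l, covar P F (L k) (L l) (q k l).
Variables (Z : T -> R) (bZ : bmeas (F s) Z).

Definition simp_energy (w : T) : R :=
  \sum_k \sum_l (sp_coef k w * sp_coef l w * q k l) *
    overlap (clip s t (sp_lo k)) (clip s t (sp_hi k))
      (clip s t (sp_lo l)) (clip s t (sp_hi l)).

Let overlap_clip0 x y u v : x <= y -> t < x ->
  overlap (clip s t x) (clip s t y) (clip s t u) (clip s t v) = 0.
Proof.
move=> xy tx; have ty := lt_le_trans tx xy.
rewrite /overlap [clip s t x]/clip [clip s t y]/clip (min_idPr (ltW tx)).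
rewrite (min_idPr (ltW ty)) (max_idPr st); apply/max_idPl.
by rewrite subr_le0 ge_min le_max lexx.
Qed.

Let bcoef (k : 'I_(sp_size h)) : exists M, forall w, `|sp_coef k w : R| <= M.
Proof. exact: sp_coef_bounded. Qed.

Let mcoef (k : 'I_(sp_size h)) : measurable_fun setT (sp_coef k : T -> R).
Proof. exact: (bmeas_meas Fmeas (sp_lo_ge0 k)) (sp_coef_bmeas Fsigma k). Qed.

Let Lcc (k l : 'I_(sp_size h)) : Lone P (fun w => Z w * (sp_coef k w * sp_coef l w)).
Proof.
have [M HM] := bcoef k; have [N HN] := bcoef l.
apply: (bmeas_Lone Fmeas s0) => //; apply: (@Lone_bounded _ _ _ _ _ (M * N)).
  exact: measurable_funM.
by move=> w; rewrite normrM ler_pM.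
Qed.

Lemma simp_energy_Lone : Lone P (fun w => Z w * simp_energy w).
Proof.
under eq_fun do rewrite mulr_sumr.
apply: Lone_sum => k; under eq_fun do rewrite mulr_sumr.
apply: Lone_sum => l.
set o := overlap _ _ _ _.
rewrite (_ : (fun w => _) = fun w => (q k l * o) * (Z w * (sp_coef k w * sp_coef l w))).
  exact: LoneZ.
by apply/funext => w; ring.
Qed.

(** The covariance formula involves [clip_coef], the energy of the integrand the original
    coefficients. They differ only for terms starting after [t], whose overlap is 0 by
    [overlap_clip0]. *)
Lemma simp_isometry :
  ex P (fun w => Z w * (simp_sum L t w - simp_sum L s w) ^+ 2) =
  ex P (fun w => Z w * simp_energy w).
Proof.
under [X in ex P X]eq_fun do rewrite expr2.
rewrite (simp_sum_cov bZ iL iL cq).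
have -> : (fun w => Z w * simp_energy w) = (fun w => \sum_k \sum_l
    (q k l * overlap (clip s t (sp_lo k)) (clip s t (sp_hi k))
      (clip s t (sp_lo l)) (clip s t (sp_hi l))) *
     (Z w * (sp_coef k w * sp_coef l w))).
  apply/funext => w; rewrite mulr_sumr; apply: eq_bigr => k _.
  by rewrite mulr_sumr; apply: eq_bigr => l _; ring.
rewrite ex_sum; last by move=> k; apply: Lone_sum => l; exact: LoneZ.
apply: eq_bigr => k _; rewrite ex_sum; last by move=> l; exact: LoneZ.
apply: eq_bigr => l _; rewrite exZ//.
have [kt|tk] := leP (sp_lo k) t; last first.
  by rewrite (overlap_clip0 _ _ (sp_lo_le_hi k) tk) mulr0 !mul0r.
have [lt|tl] := leP (sp_lo l) t; last first.
  by rewrite overlapC (overlap_clip0 _ _ (sp_lo_le_hi l) tl) mulr0 !mul0r.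
by congr (_ * ex P _); apply/funext => w; rewrite /clip_coef kt lt.
Qed.

End isometry.

Context {dU : measure_display} {U : measurableType dU}.
Variable nu : {sigma_finite_measure set U -> \bar R}.

Lemma sf_energy (h : simple_field F nu) w :
  (\int[lam]_(r in `]s, t]) \int[nu]_u (sf_val h r u w ^+ 2)%:E =
   (simp_energy (h := h) (fun k l => fine (nu (sf_set k `&` sf_set l))) w)%:E)%E.
Proof.
rewrite -(@integral_itv_quad _ _ _ _ (fun k l => sp_coef k w * sp_coef l w *
  fine (nu (sf_set k `&` sf_set l)))).
- apply: eq_integral => r _.
  rewrite (integral_indic_quad (fun k => sp_coef k w * \1_(`]sp_lo k, sp_hi k]) r)).
  + congr (_%:E).
    by apply: eq_bigr => k _; apply: eq_bigr => l _; ring.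
  + exact: sf_set_meas.
  + exact: sf_set_fin.
- exact: st.
- exact: sp_lo_le_hi.
Qed.

End simple_isometry.

(** * Differences of simple integrands *)

Section differences.
Context {R : realType} {dT : measure_display} {T : measurableType dT}.
Variable F : R -> set (set T).

Section processes.
Variables h h' : simple_process F.

Definition split_with {A : Type} (f : 'I_(sp_size h) -> A) (g : 'I_(sp_size h') -> A)
    (k : 'I_(sp_size h + sp_size h')) : A :=
  match fintype.split k with inl i => f i | inr j => g j end.

Lemma split_with_lshift A (f : 'I_(sp_size h) -> A) g i :
  split_with f g (lshift _ i) = f i.
Proof. by rewrite /split_with (unsplitK (inl _ i)). Qed.

Lemma split_with_rshift A f (g : 'I_(sp_size h') -> A) i :
  split_with f g (rshift _ i) = g i.
Proof. by rewrite /split_with (unsplitK (inr _ i)). Qed.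

Let lo := split_with (@sp_lo _ _ _ F h) (@sp_lo _ _ _ F h').
Let hi := split_with (@sp_hi _ _ _ F h) (@sp_hi _ _ _ F h').
Let coef := split_with (@sp_coef _ _ _ F h) (fun k w => - @sp_coef _ _ _ F h' k w).

Let lo_ge0 k : 0 <= lo k.
Proof. by rewrite /lo /split_with; case: fintype.split => i; exact: sp_lo_ge0. Qed.

Let lo_le_hi k : lo k <= hi k.
Proof. by rewrite /lo /hi /split_with; case: fintype.split => i; exact: sp_lo_le_hi. Qed.

Let coef_meas k (B : set R) : measurable B -> F (lo k) (coef k @^-1` B).
Proof.
rewrite /lo /coef /split_with; case: fintype.split => i mB; first exact: sp_coef_meas.
have mN : measurable (-%R @^-1` B : set R).
  by rewrite -[_ @^-1` _]setTI; exact: oppr_measurable.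
exact: (sp_coef_meas i mN).
Qed.

Let coef_bounded k : exists M, forall w, `|coef k w| <= M.
Proof.
rewrite /coef /split_with; case: fintype.split => i; first exact: sp_coef_bounded.
by have [M HM] := sp_coef_bounded i; exists M => w; rewrite normrN.
Qed.

(** Two approximating sequences of one integrand are compared by applying the isometry to their
    difference, which must therefore be a simple process itself. *)
Definition sp_sub : simple_process F :=
  SimpleProcess lo_ge0 lo_le_hi coef_meas coef_bounded.

End processes.

Context {dU : measure_display} {U : measurableType dU}.
Variable nu : {sigma_finite_measure set U -> \bar R}.
Variables h h' : simple_field F nu.

Let sset : 'I_(sp_size (sp_sub h h')) -> set U :=
  split_with (@sf_set _ _ _ F _ _ nu h) (@sf_set _ _ _ F _ _ nu h').

Let sset_meas k : measurable (sset k).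
Proof. by rewrite /sset /split_with; case: fintype.split => i; exact: sf_set_meas. Qed.

Let sset_fin k : (nu (sset k) < +oo)%E.
Proof. by rewrite /sset /split_with; case: fintype.split => i; exact: sf_set_fin. Qed.

Definition sf_sub : simple_field F nu := SimpleField sset_meas sset_fin.

Lemma sf_sub_val s u w : sf_val sf_sub s u w = sf_val h s u w - sf_val h' s u w.
Proof.
rewrite /sf_val /= big_split_ord/=; congr (_ + _).
  by apply: eq_bigr => k _; rewrite /sset !split_with_lshift.
rewrite -sumrN; apply: eq_bigr => k _.
by rewrite /sset !split_with_rshift !mulNr.
Qed.

End differences.

(** * Energies of integrands and their weighted means *)

Section noise.
Context {R : realType} {dT : measure_display} {T : measurableType dT}.
Variable P : probability T R.
Notation lam := (@lebesgue_measure R).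
Context {dV : measure_display} {V : measurableType dV}.
Variable mu : {sigma_finite_measure set V -> \bar R}.
Implicit Types (A B C G H : R -> V -> T -> R).

Definition jmeas G := measurable_fun setT (fun z : R * V * T => G z.1.1 z.1.2 z.2).

Definition energy G (s t : R) (w : T) : \bar R :=
  (\int[lam]_(r in `]s, t]) \int[mu]_v (G r v w ^+ 2)%:E)%E.

Lemma jmeasB A B : jmeas A -> jmeas B -> jmeas (fun r v w => A r v w - B r v w).
Proof. by move=> mA mB; exact: measurable_funB. Qed.

Let m1 G : jmeas G ->
  measurable_fun setT (fun z : R * T => (\int[mu]_v (G z.1 v z.2 ^+ 2)%:E)%E).
Proof.
move=> mG.
have mf : measurable_fun setT (fun y : (R * T) * V => (G y.1.1 y.2 y.1.2 ^+ 2)%:E).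
  apply/measurable_EFinP; apply: measurable_funX.
  apply: (measurableT_comp (f := fun z : R * V * T => G z.1.1 z.1.2 z.2)
    (g := fun y : (R * T) * V => ((y.1.1, y.2), y.1.2))) => //.
  apply: measurable_fun_pair; last exact: measurableT_comp.
  by apply: measurable_fun_pair => //; exact: measurableT_comp.
have := @measurable_fun_fubini_tonelli_F _ _ _ _ _ mu _ mf.
apply => x; rewrite lee_fin; exact: sqr_ge0.
Qed.

Lemma energy_meas_time G w : jmeas G ->
  measurable_fun setT (fun r : R => (\int[mu]_v (G r v w ^+ 2)%:E)%E).
Proof.
move=> mG; apply: (measurableT_comp (m1 mG) (g := fun r : R => (r, w))).
exact: measurable_fun_pair.
Qed.

Lemma energy_meas_space G r w : jmeas G ->
  measurable_fun setT (fun v => (G r v w ^+ 2)%:E).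
Proof.
move=> mG; apply/measurable_EFinP; apply: measurable_funX.
apply: (measurableT_comp mG (g := fun v => ((r, v), w))).
by apply: measurable_fun_pair => //; exact: measurable_fun_pair.
Qed.

Lemma energy_meas G s t : jmeas G -> measurable_fun setT (energy G s t).
Proof.
move=> mG; rewrite /energy; under eq_fun do rewrite integral_mkcond.
have mf : measurable_fun setT (fun y : T * R =>
    if y.2 \in `]s, t]%classic then \int[mu]_v (G y.2 v y.1 ^+ 2)%:E else 0)%E.
  apply: measurable_fun_ifT => //.
    apply: (measurable_fun_bool true).
    rewrite setTI (_ : _ @^-1` _ = setT `*` `]s, t]%classic); first exact: measurableX.
    by apply/seteqP; split => [[x y] /= /set_mem h|[x y] [_ h]] //=; apply/mem_set.
  apply: (measurableT_comp (m1 mG) (g := fun y : T * R => (y.2, y.1))).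
  exact: measurable_fun_pair.
have := @measurable_fun_fubini_tonelli_F _ _ T (measurableTypeR R) R lam _ mf.
move=> H; have {}H := H _; apply: (eq_measurable_fun _ _ (H _)).
  by move=> w _; apply: eq_integral => r _; rewrite patchE.
move=> x; case: ifP => // _; apply: integral_ge0 => v _; rewrite lee_fin.
exact: sqr_ge0.
Qed.

Lemma energy_ge0 G s t w : (0 <= energy G s t w)%E.
Proof.
apply: integral_ge0 => r _; apply: integral_ge0 => v _.
by rewrite lee_fin sqr_ge0.
Qed.

Lemma energy_le A B C (a b s t : R) w : jmeas A -> jmeas B -> jmeas C ->
  0 <= a -> 0 <= b ->
  (forall r v, C r v w ^+ 2 <= a * A r v w ^+ 2 + b * B r v w ^+ 2) ->
  (energy C s t w <= a%:E * energy A s t w + b%:E * energy B s t w)%E.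
Proof.
move=> mA mB mC a0 b0 CAB.
have s0 G r v : (0 <= (G r v w ^+ 2)%:E)%E by rewrite lee_fin sqr_ge0.
have i0 G r : (0 <= \int[mu]_v (G r v w ^+ 2)%:E)%E by exact: integral_ge0.
have it G : jmeas G -> measurable_fun `]s, t]%classic (fun r : R => (\int[mu]_v (G r v w ^+ 2)%:E)%E).
  by move=> mG; apply: measurable_funTS; exact: energy_meas_time.
rewrite -!ge0_integralZl//; [|exact: it..].
rewrite -ge0_integralD//; last 4 first.
- by move=> r _; rewrite mule_ge0.
- by apply: measurable_funeM; exact: it.
- by move=> r _; rewrite mule_ge0.
- by apply: measurable_funeM; exact: it.
apply: ge0_le_integral => //; first exact: it.
- apply: emeasurable_funD; apply: measurable_funeM; exact: it.
move=> r _.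
rewrite -!ge0_integralZl//; [|exact: energy_meas_space..].
rewrite -ge0_integralD//; last 4 first.
- by move=> v _; rewrite mule_ge0.
- by apply: measurable_funeM; exact: energy_meas_space.
- by move=> v _; rewrite mule_ge0.
- by apply: measurable_funeM; exact: energy_meas_space.
apply: ge0_le_integral => //; first exact: energy_meas_space.
- apply: emeasurable_funD; apply: measurable_funeM; exact: energy_meas_space.
by move=> v _; rewrite -!EFinM -EFinD lee_fin.
Qed.

Lemma energy_sub G s s' t t' w : jmeas G -> s' <= s -> t <= t' ->
  (energy G s t w <= energy G s' t' w)%E.
Proof.
move=> mG ss tt; apply: ge0_subset_integral => //.
- by apply: measurable_funTS; exact: energy_meas_time.
- move=> r _; apply: integral_ge0 => v _; rewrite lee_fin; exact: sqr_ge0.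
- move=> r /=; rewrite !in_itv/= => /andP[sr rt].
  by rewrite (le_lt_trans ss sr) (le_trans rt tt).
Qed.

(** Kept in the extended reals: it is applied to energies before anything is known of their
    finiteness. *)
Definition mean (Z : T -> R) (E : T -> \bar R) : \bar R :=
  (\int[P]_w ((Z w)%:E * E w))%E.

Lemma mean_ge0 (Z : T -> R) (E : T -> \bar R) : (forall w, 0 <= Z w) -> (forall w, (0 <= E w)%E) ->
  (0 <= mean Z E)%E.
Proof. by move=> Z0 E0; apply: integral_ge0 => w _; rewrite mule_ge0// lee_fin. Qed.

Lemma mean_le (Z : T -> R) (a b : R) (E1 E2 E3 : T -> \bar R) : measurable_fun setT Z ->
  (forall w, 0 <= Z w) -> 0 <= a -> 0 <= b ->
  measurable_fun setT E1 -> measurable_fun setT E2 -> measurable_fun setT E3 ->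
  (forall w, (0 <= E1 w)%E) -> (forall w, (0 <= E2 w)%E) -> (forall w, (0 <= E3 w)%E) ->
  {ae P, forall w, (E3 w <= a%:E * E1 w + b%:E * E2 w)%E} ->
  (mean Z E3 <= a%:E * mean Z E1 + b%:E * mean Z E2)%E.
Proof.
move=> mZ Z0 a0 b0 mE1 mE2 mE3 E10 E20 E30 EE.
have mZ' : measurable_fun setT (EFin \o Z) by exact/measurable_EFinP.
have mZE E : measurable_fun setT E -> measurable_fun setT (fun w => (Z w)%:E * E w)%E.
  by move=> mE; exact: (emeasurable_funM mZ' mE).
have ZE0 E w : (forall w, (0 <= E w)%E) -> (0 <= (Z w)%:E * E w)%E.
  by move=> E0; rewrite mule_ge0// lee_fin.
rewrite /mean -!ge0_integralZl//; do ?[exact: mZE | by move=> w _; exact: ZE0].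
rewrite -ge0_integralD//; last 4 first.
- by move=> w _; rewrite mule_ge0// ZE0.
- by apply: measurable_funeM; exact: mZE.
- by move=> w _; rewrite mule_ge0// ZE0.
- by apply: measurable_funeM; exact: mZE.
apply: ae_ge0_le_integral => //.
- by move=> w _; exact: ZE0.
- exact: mZE.
- by move=> w _; rewrite adde_ge0// mule_ge0// ZE0.
- by apply: emeasurable_funD; apply: measurable_funeM; exact: mZE.
apply: filterS EE => w EE _; rewrite muleCA [X in (_ + X)%E]muleCA -ge0_muleDr ?mule_ge0//.
by rewrite lee_wpmul2l// lee_fin.
Qed.

End noise.

(** * Stochastic integrals as L2 limits *)

Section noise_integral.
Context {R : realType} {dT : measure_display} {T : measurableType dT}.
Variable P : probability T R.
Notation lam := (@lebesgue_measure R).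

Definition normsq (f : T -> R) : \bar R := (\int[P]_w (f w ^+ 2)%:E)%E.

Lemma null_squeeze (u v w : nat -> \bar R) (a b : R) :
  (forall n, (0 <= u n)%E) -> (forall n, (u n <= a%:E * v n + b%:E * w n)%E) ->
  v n @[n --> \oo] --> 0%E -> w n @[n --> \oo] --> 0%E ->
  u n @[n --> \oo] --> 0%E.
Proof.
move=> u0 uvw v0 w0.
apply: (@squeeze_cvge _ _ _ _ (cst 0%E) _ (fun n => a%:E * v n + b%:E * w n)%E).
- by apply: nearW => n; rewrite u0 uvw.
- exact: cvg_cst.
- have := cvgeD _ (cvgeZl (isT : a%:E \is a fin_num) v0)
    (cvgeZl (isT : b%:E \is a fin_num) w0).
  by rewrite !mule0 adde0; apply.
Qed.

Lemma int_le (a b : R) (E1 E2 E3 : T -> \bar R) : 0 <= a -> 0 <= b ->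
  measurable_fun setT E1 -> measurable_fun setT E2 -> measurable_fun setT E3 ->
  (forall w, (0 <= E1 w)%E) -> (forall w, (0 <= E2 w)%E) -> (forall w, (0 <= E3 w)%E) ->
  {ae P, forall w, (E3 w <= a%:E * E1 w + b%:E * E2 w)%E} ->
  (\int[P]_w E3 w <= a%:E * \int[P]_w E1 w + b%:E * \int[P]_w E2 w)%E.
Proof.
move=> a0 b0 m1 m2 m3 e1 e2 e3 EE.
have := @mean_le _ _ _ P (cst 1) a b E1 E2 E3 (measurable_cst _) (fun=> ler01) a0 b0
  m1 m2 m3 e1 e2 e3 EE.
rewrite /mean; under eq_integral do rewrite mul1e.
under [X in (_ <= _ * X + _)%E -> _]eq_integral do rewrite mul1e.
by under [X in (_ <= _ + _ * X)%E -> _]eq_integral do rewrite mul1e.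
Qed.

Let msq (f : T -> R) : measurable_fun setT f ->
  measurable_fun setT (fun w => (f w ^+ 2)%:E).
Proof. by move=> mf; apply/measurable_EFinP; exact: measurable_funX. Qed.

Lemma normsq_le (a b : R) (f g h : T -> R) : 0 <= a -> 0 <= b ->
  measurable_fun setT f -> measurable_fun setT g -> measurable_fun setT h ->
  {ae P, forall w, h w ^+ 2 <= a * f w ^+ 2 + b * g w ^+ 2} ->
  (normsq h <= a%:E * normsq f + b%:E * normsq g)%E.
Proof.
move=> a0 b0 mf mg mh H; apply: int_le => //; do ?exact: msq.
all: by move=> w; rewrite lee_fin sqr_ge0.
Qed.

Lemma normsq_ge0 f : (0 <= normsq f)%E.
Proof. by apply: integral_ge0 => w _; rewrite lee_fin sqr_ge0. Qed.

Lemma normsqD_null (f g h : nat -> T -> R) :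
  (forall n, measurable_fun setT (f n)) -> (forall n, measurable_fun setT (g n)) ->
  (forall n, measurable_fun setT (h n)) ->
  (forall n, {ae P, forall w, h n w = f n w + g n w}) ->
  normsq (f n) @[n --> \oo] --> 0%E -> normsq (g n) @[n --> \oo] --> 0%E ->
  normsq (h n) @[n --> \oo] --> 0%E.
Proof.
move=> mf mg mh hfg f0 g0; apply: (null_squeeze _ _ f0 g0 (a := 2) (b := 2)).
  by move=> n; exact: normsq_ge0.
move=> n; apply: normsq_le => //; apply: filterS (hfg n) => w ->.
by have := sqr_ge0 (f n w - g n w); nra.
Qed.

Variable F : R -> set (set T).
Hypothesis Fsigma : forall t, 0 <= t -> sigma_algebra setT (F t).
Hypothesis Fmeas : forall t, 0 <= t -> F t `<=` measurable.
Hypothesis Fmono : forall s t, 0 <= s -> s <= t -> F s `<=` F t.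

Section one_noise.
Context {dV : measure_display} {V : measurableType dV}.
Variable mu : {sigma_finite_measure set V -> \bar R}.
Variable L : set V -> R -> R -> T -> R.

(** An orthogonal martingale measure with intensity [mu]. The Brownian coordinates and the
    compensated Poisson measure are both of this kind, so the isometry and its passage to the limit
    are proved once. *)
Record noise : Prop := Noise {
  noise_integrator : forall B, measurable B -> (mu B < +oo)%E ->
    integrator P F (L B);
  noise_covar : forall B B', measurable B -> (mu B < +oo)%E ->
    measurable B' -> (mu B' < +oo)%E ->
    covar P F (L B) (L B') (fine (mu (B `&` B'))) }.

Hypothesis nL : noise.

Definition gint (h : simple_field F mu) (t : R) (w : T) : R :=
  @simp_sum _ _ _ F h (fun k => L (sf_set (s := h) k)) t w.

Definition is_gint (H : R -> V -> T -> R) (t : R) (I : T -> R) : Prop :=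
  [/\ jmeas H, measurable_fun setT I &
   exists h : nat -> simple_field F mu,
     (\int[P]_w energy mu (fun r v w => sf_val (h k) r v w - H r v w)%R 0 t w
        @[k --> \oo] --> 0)%E /\
     normsq (fun w => gint (h k) t w - I w) @[k --> \oo] --> 0%E].

Let iL (h : simple_field F mu) k : integrator P F (L (sf_set (s := h) k)).
Proof. by apply: (noise_integrator nL); [exact: sf_set_meas|exact: sf_set_fin]. Qed.

Lemma sf_val_jmeas (h : simple_field F mu) : jmeas (sf_val h).
Proof.
apply: measurable_sum => k.
apply: measurable_funM; first apply: measurable_funM.
- apply: measurableT_comp => //.
  exact: (bmeas_meas Fmeas (sp_lo_ge0 k)) (sp_coef_bmeas Fsigma k).
- apply: (measurableT_comp (f := \1_(`]sp_lo k, sp_hi k]) : R -> R)).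
    exact: measurable_indic.
  exact: measurableT_comp.
- apply: (measurableT_comp (f := \1_(sf_set k) : V -> R)).
    by apply: measurable_indic; exact: sf_set_meas.
  exact: measurableT_comp.
Qed.

Lemma gint_meas h t : 0 <= t -> measurable_fun setT (gint h t).
Proof. by move=> t0; exact: (simp_sum_meas Fsigma Fmeas (iL (h := h))). Qed.

Lemma gint_L2 h s t : 0 <= s -> s <= t ->
  Ltwo P (fun w => gint h t w - gint h s w).
Proof. by move=> s0 st; exact: (simp_sum_L2 Fsigma Fmeas Fmono (iL (h := h))). Qed.

Lemma gint_mean h s t Z : 0 <= s -> s <= t -> bmeas (F s) Z ->
  ex P (fun w => Z w * (gint h t w - gint h s w)) = 0.
Proof. by move=> s0 st; exact: (simp_sum_mean Fsigma Fmeas Fmono (iL (h := h))). Qed.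

Lemma gint_isometry h s t Z : 0 <= s -> s <= t -> bmeas (F s) Z ->
  (\int[P]_w (Z w * (gint h t w - gint h s w) ^+ 2)%:E =
   mean P Z (energy mu (sf_val h) s t))%E.
Proof.
move=> s0 st bZ.
have cq k l : covar P F (L (sf_set (s := h) k)) (L (sf_set (s := h) l))
    (fine (mu (sf_set k `&` sf_set l))).
  by apply: (noise_covar nL); do ?[exact: sf_set_meas|exact: sf_set_fin].
have [_ LL] := gint_L2 h s0 st.
rewrite -EFin_ex; last exact: (bmeas_Lone Fmeas s0).
rewrite (simp_isometry Fsigma Fmeas Fmono s0 st (iL (h := h)) cq bZ).
rewrite EFin_ex; last exact: (simp_energy_Lone P Fsigma Fmeas t s0 _ bZ).
apply: eq_integral => w _; rewrite EFinM; congr (_ * _)%E.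
by rewrite /energy sf_energy.
Qed.

Lemma gint_norm h t : 0 <= t ->
  normsq (gint h t) = (\int[P]_w energy mu (sf_val h) 0 t w)%E.
Proof.
move=> t0; have b1 : bmeas (F 0) (cst 1 : T -> R).
  by split; [exact: measurable_cst|exists 1 => w; rewrite normr1].
have := gint_isometry h (lexx 0) t0 b1; rewrite /mean.
under [X in _ = X -> _]eq_integral do rewrite mul1e.
move=> <-; apply: ge0_ae_eq_integral => //.
- by apply: msq; exact: gint_meas.
- apply/measurable_EFinP; apply: measurable_funM => //; apply: measurable_funX.
  by apply: measurable_funB; exact: gint_meas.
- by move=> w _; rewrite lee_fin sqr_ge0.
- by move=> w _; rewrite lee_fin mul1r sqr_ge0.
- apply: filterS (simp_sum0 (iL (h := h))) => w Hw _ /=.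
  by rewrite mul1r [X in _ - X]Hw subr0.
Qed.

Lemma gint_sub h h' t w : gint (sf_sub h h') t w = gint h t w - gint h' t w.
Proof.
rewrite /gint /simp_sum /= big_split_ord/=; congr (_ + _).
  by apply: eq_bigr => k _; rewrite !split_with_lshift.
rewrite -sumrN; apply: eq_bigr => k _.
by rewrite !split_with_rshift mulNr.
Qed.

(* The two approximating sequences given at times [s] and [t] have asymptotically
   equal integrals at [s], by the isometry. *)
Lemma gint_increment H s t I J : 0 <= s -> s <= t ->
  is_gint H s I -> is_gint H t J ->
  exists h : nat -> simple_field F mu,
    (\int[P]_w energy mu (fun r v w => sf_val (h k) r v w - H r v w)%R 0 t w
        @[k --> \oo] --> 0)%E /\
    normsq (fun w => (gint (h k) t w - gint (h k) s w) - (J w - I w))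
      @[k --> \oo] --> 0%E.
Proof.
move=> s0 st [mH mI [h' [eh' nh']]] [_ mJ [h [eh nh]]]; have t0 := le_trans s0 st.
exists h; split => //.
have mhH (g : simple_field F mu) : jmeas (fun r v w => sf_val g r v w - H r v w)%R.
  by apply: jmeasB => //; exact: sf_val_jmeas.
have diff : normsq (gint (sf_sub (h k) (h' k)) s) @[k --> \oo] --> 0%E.
  apply: (null_squeeze _ _ eh eh' (a := 2) (b := 2)).
    by move=> n; exact: normsq_ge0.
  move=> n; rewrite gint_norm//.
  apply: (@le_trans _ _ (2%:E * (\int[P]_w energy mu (fun r v w => sf_val (h n) r v w - H r v w)%R 0 t w)
     + 2%:E * (\int[P]_w energy mu (fun r v w => sf_val (h' n) r v w - H r v w)%R 0 s w))%E) => //.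
  apply: int_le => //; do ?[exact: energy_ge0].
  - by apply: energy_meas; exact: mhH.
  - by apply: energy_meas; exact: mhH.
  - by apply: energy_meas; exact: sf_val_jmeas.
  apply: aeW => w.
  have := @energy_le _ _ _ _ _ mu _ _ (sf_val (sf_sub (h n) (h' n))) 2 2 0 s w
    (mhH (h n)) (mhH (h' n)) (sf_val_jmeas _) (ler0n _ _) (ler0n _ _) _.
  move=> /(_ _)/le_trans; apply.
    move=> r v; rewrite sf_sub_val.
    by have := sqr_ge0 (sf_val (h n) r v w + sf_val (h' n) r v w - 2 * H r v w); nra.
  apply: leeD => //; apply: lee_wpmul2l => //.
  by apply: energy_sub => //; exact: mhH.
have nhs : normsq (fun w => gint (h k) s w - I w) @[k --> \oo] --> 0%E.
  apply: normsqD_null diff nh'.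
  - by move=> n; exact: gint_meas.
  - by move=> n; apply: measurable_funB => //; exact: gint_meas.
  - by move=> n; apply: measurable_funB => //; exact: gint_meas.
  - by move=> n; apply: aeW => w; rewrite gint_sub; ring.
have nhs' : normsq (fun w => - (gint (h k) s w - I w)) @[k --> \oo] --> 0%E.
  by apply: cvg_trans nhs; apply: near_eq_cvg; apply: nearW => n;
    apply: eq_integral => w _; rewrite sqrrN.
apply: normsqD_null nh nhs'.
- by move=> n; apply: measurable_funB => //; exact: gint_meas.
- move=> n; under eq_fun do rewrite opprB.
  by apply: measurable_funB => //; exact: gint_meas.
- move=> n; apply: measurable_funB; apply: measurable_funB => //; exact: gint_meas.
- by move=> n; apply: aeW => w; ring.
Qed.

End one_noise.

Lemma gint_ortho {dV dV'} {V : measurableType dV} {V' : measurableType dV'}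
    (mu : {sigma_finite_measure set V -> \bar R})
    (mu' : {sigma_finite_measure set V' -> \bar R}) L L'
    (h : simple_field F mu) (h' : simple_field F mu') s t Z :
  noise mu L -> noise mu' L' ->
  (forall B B', measurable B -> (mu B < +oo)%E -> measurable B' -> (mu' B' < +oo)%E ->
     covar P F (L B) (L' B') 0) ->
  0 <= s -> s <= t -> bmeas (F s) Z ->
  ex P (fun w => Z w * ((gint L h t w - gint L h s w) *
    (gint L' h' t w - gint L' h' s w))) = 0.
Proof.
move=> nL nL' c0 s0 st bZ.
apply: (simp_sum_ortho Fsigma Fmeas Fmono s0 st bZ _ _ _ (fun _ _ => erefl)).
- by move=> k; apply: (noise_integrator nL); [exact: sf_set_meas|exact: sf_set_fin].
- by move=> k; apply: (noise_integrator nL'); [exact: sf_set_meas|exact: sf_set_fin].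
- by move=> k l; apply: c0; do ?[exact: sf_set_meas|exact: sf_set_fin].
Qed.

(* Brownian integrals are handled as integrals over a one-point mark space. *)
Section brownian_noise.
Context {d : nat}.
Variables (W : R -> T -> 'cV[R]_d) (W_BM : brownian_motion P F W).

Definition point_mass : {sigma_finite_measure set unit -> \bar R} := dirac tt.

Definition bm_noise (j : 'I_d) (B : set unit) (a b : R) (w : T) : R :=
  \1_B tt * bm_incr W j a b w.

Lemma bm_noise_integrator j B : integrator P F (bm_noise j B).
Proof.
have iW := bm_integrator Fsigma Fmeas Fmono W_BM j; split.
- move=> a b a0 ab; apply: meas_wrtM; first exact: measurable_cst.
  exact: (@integrator_meas _ _ _ _ _ _ iW a b a0 ab).
- by move=> a b a0 ab; apply: LtwoZ; exact: (@integrator_L2 _ _ _ _ _ _ iW a b a0 ab).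
- move=> a b E a0 ab FE; rewrite /bm_noise.
  have L1 : Lone P (fun w => \1_E w * bm_incr W j a b w).
    apply: (@LoneM_bounded _ _ _ _ _ _ 1).
    + by apply: Ltwo_Lone; exact: (@integrator_L2 _ _ _ _ _ _ iW a b a0 ab).
    + by apply: measurable_indic; exact: Fmeas FE.
    + by move=> w; rewrite indicE; case: (_ \in _); rewrite ?normr1 ?normr0.
  under [X in ex P X]eq_fun do rewrite mulrCA.
  by rewrite exZ// (integrator_mart iW)// mulr0.
- move=> a b c a0 ab bc; apply: filterS (integrator_add iW a0 ab bc) => w.
  by rewrite /bm_noise => ->; rewrite mulrDr.
Qed.

Lemma bm_noise_covar i j B B' :
  covar P F (bm_noise i B) (bm_noise j B') ((i == j)%:R * \1_(B `&` B') tt).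
Proof.
move=> a b E a0 ab FE; rewrite /bm_noise.
have iWi := bm_integrator Fsigma Fmeas Fmono W_BM i.
have iWj := bm_integrator Fsigma Fmeas Fmono W_BM j.
have L1 : Lone P (fun w => \1_E w * (bm_incr W i a b w * bm_incr W j a b w)).
  apply: (@LoneM_bounded _ _ _ _ _ _ 1).
  + exact: Ltwo_mul (integrator_L2 iWi a0 ab) (integrator_L2 iWj a0 ab).
  + by apply: measurable_indic; exact: Fmeas FE.
  + by move=> w; rewrite indicE; case: (_ \in _); rewrite ?normr1 ?normr0.
have -> : (fun w => \1_E w * (\1_B tt * bm_incr W i a b w * (\1_B' tt * bm_incr W j a b w))) =
    (fun w => \1_(B `&` B') tt * (\1_E w * (bm_incr W i a b w * bm_incr W j a b w))).
  by apply/funext => w; rewrite [\1_(_ `&` _)]indicI /=; ring.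
rewrite exZ// (bm_covar Fsigma Fmeas Fmono W_BM i j)//; ring.
Qed.

Lemma bm_is_noise j : noise point_mass (bm_noise j).
Proof.
split; first by move=> B _ _; exact: bm_noise_integrator.
move=> B B' _ _ _ _; have := @bm_noise_covar j j B B'.
rewrite eqxx mul1r; exact.
Qed.

Let lift_fin (k : unit) : (point_mass setT < +oo)%E.
Proof. by rewrite /point_mass /= diracT ltry. Qed.

Definition sp_lift (h : simple_process F) : simple_field F point_mass :=
  @SimpleField _ _ _ F _ _ point_mass h (fun=> setT) (fun=> measurableT)
    (fun=> lift_fin tt).

Lemma sp_lift_val h r v w : sf_val (sp_lift h) r v w = sp_val h r w.
Proof.
rewrite /sf_val /sp_val; apply: eq_bigr => k _ /=.
by rewrite indicT mulr1.
Qed.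

Lemma sp_lift_gint h j t w :
  gint (bm_noise j) (sp_lift h) t w = sp_integral h (fun s w => W s w j 0) t w.
Proof.
rewrite /gint /simp_sum /sp_integral; apply: eq_bigr => k _ /=.
by rewrite /bm_noise indicT mul1r.
Qed.

Lemma point_energy (G : R -> T -> R) s t w :
  energy point_mass (fun r _ w => G r w) s t w =
  (\int[lam]_(r in `]s, t]) (G r w ^+ 2)%:E)%E.
Proof.
apply: eq_integral => r _; rewrite /point_mass /= integral_dirac//.
by rewrite diracT mul1e.
Qed.

Lemma ito_gint (H : R -> T -> R) j t I :
  is_ito_integral P F (fun s w => W s w j 0) H t I ->
  is_gint point_mass (bm_noise j) (fun r _ w => H r w) t I.
Proof.
move=> [mH mI [h [eh nh]]]; split => //.
  apply: (measurableT_comp (f := fun z : R * T => H z.1 z.2)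
    (g := fun z : R * unit * T => (z.1.1, z.2))) => //.
  by apply: measurable_fun_pair => //; exact: measurableT_comp.
exists (fun k => sp_lift (h k)); split.
- apply: cvg_trans eh; apply: near_eq_cvg; apply: nearW => k.
  apply: eq_integral => w _.
  rewrite -(point_energy (fun r w => sp_val (h k) r w - H r w)); apply: eq_integral => r _.
  by apply: eq_integral => v _; rewrite sp_lift_val.
- apply: cvg_trans nh; apply: near_eq_cvg; apply: nearW => k.
  by apply: eq_integral => w _; rewrite sp_lift_gint.
Qed.

End brownian_noise.

Section poisson_noise.
Context {dU : measure_display} {U : measurableType dU}.
Variable nu : {sigma_finite_measure set U -> \bar R}.
Variables (p : R -> T -> option U) (p_PPP : poisson_point_process P F nu p).

Lemma ppp_is_noise : noise nu (ppp_incr nu p).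
Proof.
split; first by move=> B mB nB; exact: ppp_integrator.
by move=> B B' mB nB mB' nB'; exact: ppp_covar.
Qed.

Lemma compensated_gint (H : R -> U -> T -> R) t I :
  is_compensated_integral P F nu (jump_measure p) H t I ->
  is_gint nu (ppp_incr nu p) H t I.
Proof. by move=> [mH mI [h [eh nh]]]; split => //; exists h. Qed.

End poisson_noise.

End noise_integral.

(** * Products under L2 convergence *)

Section L2_limits.
Context {R : realType} {dT : measure_display} {T : measurableType dT}.
Variable P : probability T R.

Lemma discriminant_le (p q r : R) : 0 <= r -> (forall a, 0 <= p + 2 * a * q + a ^+ 2 * r) ->
  q ^+ 2 <= p * r.
Proof.
move=> r0 H; have [r1|r1] := eqVneq r 0.
  rewrite r1 mulr0; have [->|q0] := eqVneq q 0; first by rewrite expr0n.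
  (* When [r = 0] the form is affine in [a]; this value of [a] would make it equal to -1. *)
  have := H (- (p + 1) / (2 * q)); rewrite r1 mulr0 addr0.
  rewrite (_ : 2 * _ * q = - (p + 1)); first by lra.
  by field.
have rp : 0 < r by rewrite lt_def r1.
have := H (- q / r); rewrite (_ : _ + _ = (p * r - q ^+ 2) / r); last by field.
by rewrite divr_ge0_eq0 // || (rewrite pmulr_lge0 ?invr_gt0// subr_ge0).
Qed.

Lemma ex_cauchy f g : Ltwo P f -> Ltwo P g ->
  (ex P (fun w => f w * g w)) ^+ 2 <=
  ex P (fun w => f w ^+ 2) * ex P (fun w => g w ^+ 2).
Proof.
move=> Lf Lg; apply: discriminant_le; first by apply: ex_ge0 => w; exact: sqr_ge0.
move=> a; have Lfg := Ltwo_mul Lf Lg.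
have -> : ex P (fun w => f w ^+ 2) + 2 * a * ex P (fun w => f w * g w) +
    a ^+ 2 * ex P (fun w => g w ^+ 2) = ex P (fun w => (f w + a * g w) ^+ 2).
  rewrite -exZ// -exD//; [|exact: Lf.2|exact: LoneZ].
  rewrite -exZ; last exact: Lg.2.
  rewrite -exD; [|by apply: LoneD; [exact: Lf.2|exact: LoneZ]|by apply: LoneZ; exact: Lg.2].
  by congr ex; apply/funext => w; ring.
by apply: ex_ge0 => w; exact: sqr_ge0.
Qed.

Lemma normsq_ex f : Ltwo P f -> normsq P f = (ex P (fun w => f w ^+ 2))%:E.
Proof. by move=> Lf; rewrite EFin_ex//; exact: Lf.2. Qed.

Lemma Ltwo_close (f g : T -> R) : Ltwo P f -> measurable_fun setT g ->
  (normsq P (fun w => f w - g w)%R < +oo)%E -> Ltwo P g.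
Proof.
move=> Lf mg fg.
have Lfg : Ltwo P (fun w => f w - g w).
  split; first by apply: measurable_funB => //; exact: Ltwo_meas Lf.
  apply: Lone_ge0P => //; last by move=> w; exact: sqr_ge0.
  by apply: measurable_funX; apply: measurable_funB => //; exact: Ltwo_meas Lf.
have := LtwoB Lf Lfg; congr Ltwo.
by apply/funext => w; rewrite opprB addrC subrK.
Qed.

Lemma cvg_sqr0 (u v : nat -> R) : (forall n, u n ^+ 2 <= v n) ->
  v n @[n --> \oo] --> 0 -> u n @[n --> \oo] --> 0.
Proof.
move=> uv v0; apply/norm_cvg0P.
apply: (squeeze_cvgr (f := cst 0) (h := fun n => Num.sqrt (v n))).
- apply: nearW => n; rewrite normr_ge0/= -sqrtr_sqr ler_sqrt// (le_trans (sqr_ge0 _) (uv n))//.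
- exact: cvg_cst.
- rewrite -[X in _ --> X](@sqrtr0 R).
  exact: (continuous_cvg _ (@sqrt_continuous R 0) v0).
Qed.

Section limit.
Variables (f : T -> R) (fn : nat -> T -> R).
Hypotheses (mf : measurable_fun setT f) (Lfn : forall n, Ltwo P (fn n)).
Hypothesis fnf : normsq P (fun w => fn n w - f w) @[n --> \oo] --> 0%E.

Lemma Ltwo_limit : Ltwo P f.
Proof.
have /fine_cvgP[[N _ /(_ N (leqnn N)) fin] _] := fnf.
by apply: Ltwo_close (Lfn N) mf _; rewrite ltey_eq fin.
Qed.

Lemma real_limit : ex P (fun w => (fn n w - f w) ^+ 2) @[n --> \oo] --> 0.
Proof.
have Lf := Ltwo_limit.
have /fine_cvgP[_] := fnf; apply: cvg_trans; apply: near_eq_cvg; apply: nearW => n /=.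
by rewrite normsq_ex//; exact: LtwoB.
Qed.
End limit.

(** The difference of products is [(fn - f) gn + f (gn - g)]. Each term is handled by
    Cauchy-Schwarz, the first one with the bound [gnq] on the second moments of [gn]. *)
Lemma ex_bilinear_cvg (f g : T -> R) (fn gn : nat -> T -> R) (Z : T -> R) (C : R) :
  measurable_fun setT f -> measurable_fun setT g ->
  (forall n, Ltwo P (fn n)) -> (forall n, Ltwo P (gn n)) ->
  normsq P (fun w => fn n w - f w) @[n --> \oo] --> 0%E ->
  normsq P (fun w => gn n w - g w) @[n --> \oo] --> 0%E ->
  measurable_fun setT Z -> (forall w, `|Z w| <= C) ->
  ex P (fun w => Z w * (fn n w * gn n w)) @[n --> \oo] -->
  ex P (fun w => Z w * (f w * g w)).
Proof.
move=> mf mg Lfn Lgn fnf gng mZ ZC.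
have Lf := Ltwo_limit mf Lfn fnf; have Lg := Ltwo_limit mg Lgn gng.
have qf := real_limit mf Lfn fnf; have qg := real_limit mg Lgn gng.
set p := fun n => ex P _ in qf; set q := fun n => ex P _ in qg.
have LZ h : Ltwo P h -> Ltwo P (fun w => Z w * h w).
  by move=> Lh; exact: LtwoM_bounded Lh mZ ZC.
have exZ2 h : Ltwo P h -> ex P (fun w => (Z w * h w) ^+ 2) <= C ^+ 2 * ex P (fun w => h w ^+ 2).
  move=> Lh; rewrite -exZ; last exact: Lh.2.
  apply: ex_le; [exact: (LZ _ Lh).2|by apply: LoneZ; exact: Lh.2|move=> w].
  rewrite exprMn ler_wpM2r ?sqr_ge0// -real_normK ?num_real//.
  by apply: lerXn2r; rewrite ?nnegrE// (le_trans (normr_ge0 _) (ZC w)).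
have p0 n : 0 <= p n by apply: ex_ge0 => w; exact: sqr_ge0.
have q0 n : 0 <= q n by apply: ex_ge0 => w; exact: sqr_ge0.
have gnq n : ex P (fun w => gn n w ^+ 2) <= 2 * q n + 2 * ex P (fun w => g w ^+ 2).
  have L1 : Lone P (fun w => 2 * (gn n w - g w) ^+ 2).
    by apply: LoneZ; exact: (LtwoB (Lgn n) Lg).2.
  have L2 : Lone P (fun w => 2 * g w ^+ 2) by apply: LoneZ; exact: Lg.2.
  rewrite -(exZ 2 Lg.2) -(exZ 2 (LtwoB (Lgn n) Lg).2) -exD//.
  apply: ex_le; [exact: (Lgn n).2|exact: LoneD|move=> w].
  by have := sqr_ge0 (gn n w - 2 * g w); nra.
have one : ex P (fun w => (Z w * (fn n w - f w)) * gn n w) @[n --> \oo] --> 0.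
  apply: (@cvg_sqr0 _ (fun n => C ^+ 2 * p n * (2 * q n + 2 * ex P (fun w => g w ^+ 2)))).
    move=> n; have Lfnf := LtwoB (Lfn n) Lf.
    apply: le_trans (ex_cauchy (LZ _ Lfnf) (Lgn n)) _.
    apply: ler_pM => //; [by apply: ex_ge0 => w; exact: sqr_ge0|
      by apply: ex_ge0 => w; exact: sqr_ge0|exact: exZ2].
  rewrite (_ : 0 = C ^+ 2 * 0 * (2 * 0 + 2 * ex P (fun w => g w ^+ 2))); last by ring.
  apply: cvgM; first by apply: cvgM => //; exact: cvg_cst.
  by apply: cvgD; [apply: cvgM => //; exact: cvg_cst|exact: cvg_cst].
have two : ex P (fun w => (Z w * f w) * (gn n w - g w)) @[n --> \oo] --> 0.
  apply: (@cvg_sqr0 _ (fun n => C ^+ 2 * ex P (fun w => f w ^+ 2) * q n)).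
    move=> n; have Lgng := LtwoB (Lgn n) Lg.
    apply: le_trans (ex_cauchy (LZ _ Lf) Lgng) _.
    by apply: ler_wpM2r; [exact: q0|exact: exZ2].
  rewrite [X in _ --> X](_ : 0 = C ^+ 2 * ex P (fun w => f w ^+ 2) * 0); last by ring.
  by apply: cvgM => //; exact: cvg_cst.
have : (ex P (fun w => Z w * (fn n w - f w) * gn n w) +
    ex P (fun w => Z w * f w * (gn n w - g w)) +
    ex P (fun w => Z w * (f w * g w))) @[n --> \oo] --> 0 + 0 + ex P (fun w => Z w * (f w * g w)).
  by apply: cvgD; [exact: cvgD|exact: cvg_cst].
rewrite !add0r; apply: cvg_trans; apply: near_eq_cvg; apply: nearW => n /=.
have L1 := Ltwo_mul (LZ _ (LtwoB (Lfn n) Lf)) (Lgn n).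
have L2 := Ltwo_mul (LZ _ Lf) (LtwoB (Lgn n) Lg).
have L3 : Lone P (fun w => Z w * (f w * g w)).
  by apply: (LoneM_bounded (Ltwo_mul Lf Lg) mZ ZC).
rewrite -!exD//; last exact: LoneD.
by congr ex; apply/funext => w /=; ring.
Qed.

End L2_limits.

(** The main term [a] keeps a factor as close to 1 as desired, while the large factor falls on a
    difference that will tend to 0. The gap between the two sides is a square divided by [e]. *)
Lemma sqr_split {R : realFieldType} (e a b : R) : 0 < e ->
  b ^+ 2 <= (1 + e) * a ^+ 2 + (1 + e^-1) * (b - a) ^+ 2.
Proof.
move=> e0; rewrite -subr_ge0.
rewrite [leRHS](_ : _ = (e * a - (b - a)) ^+ 2 / e).
  by rewrite divr_ge0 ?sqr_ge0// ltW.
by field; rewrite gt_eqF.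
Qed.

Lemma mean_bounded {R : realType} {dT : measure_display} {T : measurableType dT}
    (P : probability T R) (Z : T -> R) (C : R) (E : T -> \bar R) : 0 <= C ->
  measurable_fun setT Z -> (forall w, 0 <= Z w) -> (forall w, `|Z w| <= C) ->
  measurable_fun setT E -> (forall w, (0 <= E w)%E) ->
  (mean P Z E <= C%:E * \int[P]_w E w)%E.
Proof.
move=> C0 mZ Z0 ZC mE E0.
rewrite -ge0_integralZl//; apply: ge0_le_integral => //.
- by move=> w _; rewrite mule_ge0 ?lee_fin.
- by apply: emeasurable_funM => //; exact/measurable_EFinP.
- by apply: emeasurable_funM.
- move=> w _; apply: lee_wpmul2r => //.
  by rewrite lee_fin (le_trans (ler_norm _)).
Qed.

(** * Moments of the increments of stochastic integrals *)

Section increments.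
Context {R : realType} {dT : measure_display} {T : measurableType dT}.
Variable P : probability T R.
Notation lam := (@lebesgue_measure R).
Variable F : R -> set (set T).
Hypothesis Fsigma : forall t, 0 <= t -> sigma_algebra setT (F t).
Hypothesis Fmeas : forall t, 0 <= t -> F t `<=` measurable.
Hypothesis Fmono : forall s t, 0 <= s -> s <= t -> F s `<=` F t.
Variables (s t : R) (s0 : 0 <= s) (st : s <= t).

Let t0 : 0 <= t. Proof. exact: le_trans s0 st. Qed.

Definition approx {dV : measure_display} {V : measurableType dV}
    (mu : {sigma_finite_measure set V -> \bar R}) (L : set V -> R -> R -> T -> R)
    (H : R -> V -> T -> R) (D : T -> R) (h : nat -> simple_field F mu) : Prop :=
  [/\ measurable_fun setT D, jmeas H,
   (\int[P]_w energy mu (fun r v w => sf_val (h k) r v w - H r v w)%R 0 t w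
        @[k --> \oo] --> 0)%E &
   normsq P (fun w => gint L (h k) t w - gint L (h k) s w - D w) @[k --> \oo] --> 0%E].

Section one.
Context {dV : measure_display} {V : measurableType dV}.
Variables (mu : {sigma_finite_measure set V -> \bar R}) (L : set V -> R -> R -> T -> R).
Hypothesis nL : noise P F mu L.

Lemma approx_exists H I J : is_gint P F mu L H s I -> is_gint P F mu L H t J ->
  exists h : nat -> simple_field F mu, approx L H (fun w => J w - I w) h.
Proof.
move=> gI gJ; have [h [h1 h2]] := gint_increment Fsigma Fmeas Fmono nL s0 st gI gJ.
exists h; split => //; last by case: gI.
by apply: measurable_funB; [case: gJ|case: gI].
Qed.

Variables (H : R -> V -> T -> R) (D : T -> R) (h : nat -> simple_field F mu).
Hypothesis aD : approx L H D h.

Let gL n : Ltwo P (fun w => gint L (h n) t w - gint L (h n) s w).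
Proof. exact: (gint_L2 Fsigma Fmeas Fmono nL). Qed.

Lemma approx_Ltwo : Ltwo P D.
Proof. by case: aD => mD _ _ cD; exact: Ltwo_limit mD gL cD. Qed.

(** The bilinear limit theorem is used with the constant 1 as second factor. *)
Lemma approx_mean Z : bmeas (F s) Z -> ex P (fun w => Z w * D w) = 0.
Proof.
move=> bZ; have [_ [C ZC]] := bZ; have mZ := bmeas_meas Fmeas s0 bZ.
case: aD => mD _ _ cD.
have c1 : normsq P (fun w => cst 1 w - cst 1 w : R) @[n --> \oo] --> 0%E.
  rewrite /normsq; under eq_integral do rewrite subrr expr0n.
  by rewrite integral0; exact: cvg_cst.
have := @ex_bilinear_cvg _ _ _ P D (cst 1) _ (fun=> cst 1) Z C mD (measurable_cst _) gL
  (fun=> Ltwo_cst _ _) cD c1 mZ ZC.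
under eq_fun => n do under [X in ex P X]eq_fun => w do rewrite /= mulr1.
under [X in ex P X]eq_fun => w do rewrite /= mulr1.
under eq_fun => n do rewrite (gint_mean Fsigma Fmeas Fmono nL _ s0 st bZ).
by move/(cvg_unique (@norm_hausdorff _ R)) => /(_ _ (cvg_cst 0)).
Qed.

(** The isometry holds along the approximating sequence; [sqr_split] compares the energy of
    [sf_val (h n)] with that of [H] up to the factor [1 + e], then [n] tends to infinity and [e] to
    0. An inequality makes sense and holds even when the energy has infinite mean. *)
Lemma approx_square Z : bmeas (F s) Z -> (forall w, 0 <= Z w) ->
  ((ex P (fun w => Z w * D w ^+ 2))%:E <= mean P Z (energy mu H s t))%E.
Proof.
move=> bZ Z0; have [_ [C ZC]] := bZ; have mZ := bmeas_meas Fmeas s0 bZ.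
have [mD mH eH cD] := aD.
(* A negative bound on [|Z|] would make the sample space empty, against total mass 1. *)
have C0 : 0 <= C.
  have [//|CN] := lerP 0 C.
  suff : P setT = 0%E by move/eqP; rewrite probability_setT onee_eq0.
  rewrite (_ : setT = set0) ?measure0//; apply/seteqP; split => // w _.
  by have := le_lt_trans (ZC w) CN; rewrite ltNge normr_ge0.
set S := mean P Z (energy mu H s t).
have S0 : (0 <= S)%E by apply: mean_ge0 => // w; exact: energy_ge0.
set r := fun k => (\int[P]_w _)%E in eH.
have xn := @ex_bilinear_cvg _ _ _ P D D _ _ Z C mD mD gL gL cD cD mZ ZC.
set x := fun n => ex P _ in xn.
have xle e n : 0 < e -> ((x n)%:E <= (1 + e)%:E * S + ((1 + e^-1) * C)%:E * r n)%E.
  move=> e0; have mh : jmeas (sf_val (h n)).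
    exact: (sf_val_jmeas Fsigma Fmeas).
  have md : jmeas (fun r v w => sf_val (h n) r v w - H r v w) by exact: jmeasB.
  have -> : (x n)%:E = mean P Z (energy mu (sf_val (h n)) s t).
    rewrite -(gint_isometry Fsigma Fmeas Fmono nL _ s0 st bZ) EFin_ex//.
    exact: (bmeas_Lone Fmeas s0 bZ (Ltwo_mul (gL n) (gL n))).
  have ei : 0 <= 1 + e^-1 by rewrite addr_ge0// invr_ge0 ltW.
  have e1 : 0 <= 1 + e by rewrite addr_ge0// ltW.
  apply: (le_trans (@mean_le _ _ _ P Z (1 + e) (1 + e^-1) (energy mu H s t)
    (energy mu (fun r v w => sf_val (h n) r v w - H r v w) 0 t)
    (energy mu (sf_val (h n)) s t) mZ Z0 e1 ei _ _ _ _ _ _ _)).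
  - exact: energy_meas.
  - exact: energy_meas.
  - exact: energy_meas.
  - by move=> w; exact: energy_ge0.
  - by move=> w; exact: energy_ge0.
  - by move=> w; exact: energy_ge0.
  - apply: aeW => w; apply: le_trans (leeD (lexx _) (lee_wpmul2l _ (energy_sub mu w md s0 (lexx t)))).
      apply: energy_le => // u v.
      set a := H u v w; set b := sf_val (h n) u v w.
      by apply: sqr_split.
    by rewrite lee_fin.
  - rewrite leeD2l// EFinM -muleA lee_wpmul2l ?lee_fin// /r.
    by apply: mean_bounded => // [|w]; [exact: energy_meas|exact: energy_ge0].
have -> : ex P (fun w => Z w * D w ^+ 2) = ex P (fun w => Z w * (D w * D w)) by [].
have [->|Sfin] := eqVneq S +oo%E; first exact: leey.
have {Sfin}Sfin : S \is a fin_num by rewrite ge0_fin_numE// ltey.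
have xe e : 0 < e -> ((ex P (fun w => Z w * (D w * D w)))%:E <= (1 + e)%:E * S)%E.
  move=> e0.
  have yn : ((x n)%:E - ((1 + e^-1) * C)%:E * r n)%E @[n --> \oo] -->
      (ex P (fun w => Z w * (D w * D w)))%:E.
    rewrite -[X in _ --> X]sube0; apply: cvgeB => //.
      by apply: cvg_EFin => //; exact: nearW.
    by rewrite -[X in _ --> X](mule0 ((1 + e^-1) * C)%:E); exact: cvgeZl.
  have /fine_cvgP[rfin _] := eH.
  apply: (cvge_to_le yn); apply: filterS rfin => n rn.
  by rewrite leeBlDr ?xle// fin_numM.
apply/lee_addgt0Pr => e e0.
have S1 : 0 < fine S + 1 by rewrite ltr_wpDl// fine_ge0.
apply: le_trans (xe (e / (fine S + 1)) _) _; first by rewrite divr_gt0.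
rewrite -(fineK Sfin) -EFinM -EFinD lee_fin mulrDl mul1r lerD2l.
by rewrite mulrAC ler_pdivrMr// ler_pM2l// lerDl.
Qed.
End one.

Lemma approx_ortho {dV dV'} {V : measurableType dV} {V' : measurableType dV'}
    (mu : {sigma_finite_measure set V -> \bar R})
    (mu' : {sigma_finite_measure set V' -> \bar R}) L L' H H'
    (h : nat -> simple_field F mu) (h' : nat -> simple_field F mu') D D' Z :
  noise P F mu L -> noise P F mu' L' -> approx L H D h -> approx L' H' D' h' ->
  (forall B B', measurable B -> (mu B < +oo)%E -> measurable B' -> (mu' B' < +oo)%E ->
     covar P F (L B) (L' B') 0) -> bmeas (F s) Z ->
  ex P (fun w => Z w * (D w * D' w)) = 0.
Proof.
move=> nL nL' [mD _ _ cD] [mD' _ _ cD'] c0 bZ.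
have [_ [C ZC]] := bZ; have mZ := bmeas_meas Fmeas s0 bZ.
have gL n : Ltwo P (fun w => gint L (h n) t w - gint L (h n) s w).
  exact: (gint_L2 Fsigma Fmeas Fmono nL).
have gL' n : Ltwo P (fun w => gint L' (h' n) t w - gint L' (h' n) s w).
  exact: (gint_L2 Fsigma Fmeas Fmono nL').
have := ex_bilinear_cvg mD mD' gL gL' cD cD' mZ ZC.
under eq_fun => n do rewrite (gint_ortho Fsigma Fmeas Fmono _ _ nL nL' c0 s0 st bZ).
by move/(cvg_unique (@norm_hausdorff _ R)) => /(_ _ (cvg_cst 0)).
Qed.

Lemma ex_sum_ortho (K : finType) (D : K -> T -> R) Z : (forall k, Ltwo P (D k)) ->
  bmeas (F s) Z -> (forall k l, k != l -> ex P (fun w => Z w * (D k w * D l w)) = 0) ->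
  ex P (fun w => Z w * (\sum_k D k w) ^+ 2) = \sum_k ex P (fun w => Z w * D k w ^+ 2).
Proof.
move=> LD bZ oD.
have L1 k l : Lone P (fun w => Z w * (D k w * D l w)).
  exact: (bmeas_Lone Fmeas s0 bZ (Ltwo_mul (LD k) (LD l))).
transitivity (ex P (fun w => \sum_k \sum_l Z w * (D k w * D l w))).
  congr ex; apply/funext => w; rewrite expr2 mulr_suml mulr_sumr.
  by apply: eq_bigr => k _; rewrite !mulr_sumr.
rewrite ex_sum; last by move=> k; exact: Lone_sum.
apply: eq_bigr => k _; rewrite ex_sum// (bigD1 k)//= big1 ?addr0// => l lk.
by apply: oD; rewrite eq_sym.
Qed.

Context {d : nat} {dU : measure_display} {U : measurableType dU}.
Variable nu : {sigma_finite_measure set U -> \bar R}.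
Variables (W : R -> T -> 'cV[R]_d) (W_BM : brownian_motion P F W).
Variables (p : R -> T -> option U) (p_PPP : poisson_point_process P F nu p).
Variables (H : 'I_d -> R -> T -> R) (G : R -> U -> T -> R).
Variables (I I' : 'I_d -> T -> R) (J J' : T -> R).
Hypothesis Is : forall j, is_ito_integral P F (fun s w => W s w j 0) (H j) s (I j).
Hypothesis It : forall j, is_ito_integral P F (fun s w => W s w j 0) (H j) t (I' j).
Hypothesis Js : is_compensated_integral P F nu (jump_measure p) G s J.
Hypothesis Jt : is_compensated_integral P F nu (jump_measure p) G t J'.

Definition total_increment (w : T) : R := \sum_j (I' j w - I j w) + (J' w - J w).

Definition total_energy (w : T) : \bar R :=
  (\sum_j \int[lam]_(r in `]s, t]) (H j r w ^+ 2)%:E + energy nu G s t w)%E.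

Lemma sum_option (A : Type) (idx : A) (op : Monoid.com_law idx) (f : option 'I_d -> A) :
  \big[op/idx]_k f k = op (\big[op/idx]_j f (Some j)) (f None).
Proof.
rewrite (bigD1 None)//= Monoid.mulmC; congr (op _ _).
rewrite (reindex_omap Some id) => [|[]//].
by apply: eq_bigl => j; rewrite eqxx.
Qed.

Let nW j := bm_is_noise Fsigma Fmeas Fmono W_BM j.
Let nN := ppp_is_noise Fsigma Fmeas p_PPP.

(** Indexing by [option 'I_d], with [None] for the jumps, gathers the Brownian integrals and the
    jump integral into one orthogonal family. *)
Let D (k : option 'I_d) (w : T) : R :=
  if k is Some j then I' j w - I j w else J' w - J w.
Let E (k : option 'I_d) (w : T) : \bar R :=
  if k is Some j then energy point_mass (fun r _ w => H j r w) s t w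
  else energy nu G s t w.

Let total_sum : total_increment = fun w => \sum_k D k w.
Proof. by apply/funext => w; rewrite sum_option. Qed.

Let energy_sum : total_energy = fun w => (\sum_k E k w)%E.
Proof.
apply/funext => w; rewrite sum_option; congr (_ + _)%E.
by apply: eq_bigr => j _; rewrite /E point_energy.
Qed.

Let approxW j : exists h : nat -> simple_field F point_mass,
  approx (bm_noise W j) (fun r _ w => H j r w) (fun w => I' j w - I j w) h.
Proof. exact: (approx_exists (nW j) (ito_gint (Is j)) (ito_gint (It j))). Qed.

Let approxN : exists h : nat -> simple_field F nu,
  approx (ppp_incr nu p) G (fun w => J' w - J w) h.
Proof. exact: (approx_exists nN (compensated_gint Js) (compensated_gint Jt)). Qed.

Let D_Ltwo k : Ltwo P (D k).
Proof.
case: k => [j|].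
  by have [h a] := approxW j; exact: (approx_Ltwo (nW j) a).
by have [h a] := approxN; exact: (approx_Ltwo nN a).
Qed.

Let cWN j B B' : measurable B' -> (nu B' < +oo)%E ->
  covar P F (bm_noise W j B) (ppp_incr nu p B') 0.
Proof.
move=> mB' nB' a b A a0 ab FA.
have L1 : Lone P (fun w => \1_A w * (bm_incr W j a b w * ppp_incr nu p B' a b w)).
  apply: (@LoneM_bounded _ _ _ _ _ _ 1).
  + apply: Ltwo_mul.
      exact: (@integrator_L2 _ _ _ _ _ _ (bm_integrator Fsigma Fmeas Fmono W_BM j) a b a0 ab).
    exact: (@integrator_L2 _ _ _ _ _ _ (ppp_integrator Fsigma Fmeas p_PPP mB' nB') a b a0 ab).
  + by apply: measurable_indic; exact: Fmeas FA.
  + by move=> w; rewrite indicE; case: (_ \in _); rewrite ?normr1 ?normr0.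
have -> : (fun w => \1_A w * (bm_noise W j B a b w * ppp_incr nu p B' a b w)) =
    (fun w => \1_B tt * (\1_A w * (bm_incr W j a b w * ppp_incr nu p B' a b w))).
  by apply/funext => w; rewrite /bm_noise; ring.
rewrite exZ// (bm_ppp_covar Fsigma Fmeas Fmono W_BM p_PPP j mB' nB' a0 ab FA); ring.
Qed.

Let D_ortho Z k l : bmeas (F s) Z -> k != l ->
  ex P (fun w => Z w * (D k w * D l w)) = 0.
Proof.
move=> bZ; case: k => [i|]; case: l => [j|] //= kl.
- have [h a] := approxW i; have [h' a'] := approxW j.
  apply: (approx_ortho (nW i) (nW j) a a' _ bZ) => B B' _ _ _ _.
  have := bm_noise_covar Fsigma Fmeas Fmono W_BM i j B B'.
  by rewrite (_ : (i == j) = false) ?mul0r//; apply/negP => /eqP ij; rewrite ij eqxx in kl.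
- have [h a] := approxW i; have [h' a'] := approxN.
  by apply: (approx_ortho (nW i) nN a a' _ bZ) => B B' _ _; exact: cWN.
- have [h a] := approxW j; have [h' a'] := approxN.
  under [X in ex P X]eq_fun => w do rewrite [(J' w - J w) * _]mulrC.
  by apply: (approx_ortho (nW j) nN a a' _ bZ) => B B' _ _; exact: cWN.
Qed.

Lemma total_Ltwo : Ltwo P total_increment.
Proof. by rewrite total_sum; exact: Ltwo_sum. Qed.

Lemma total_mean Z : bmeas (F s) Z -> ex P (fun w => Z w * total_increment w) = 0.
Proof.
move=> bZ; rewrite total_sum; under [X in ex P X]eq_fun => w do rewrite mulr_sumr.
rewrite ex_sum; last by move=> k; apply: (bmeas_Lone Fmeas s0 bZ); exact: Ltwo_Lone.
rewrite big1// => -[j|] _.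
  by have [h a] := approxW j; exact: (approx_mean (nW j) a bZ).
by have [h a] := approxN; exact: (approx_mean nN a bZ).
Qed.

Lemma total_square Z : bmeas (F s) Z -> (forall w, 0 <= Z w) ->
  ((ex P (fun w => Z w * total_increment w ^+ 2))%:E <= mean P Z total_energy)%E.
Proof.
move=> bZ Z0; have mZ := bmeas_meas Fmeas s0 bZ.
have mE k : measurable_fun setT (E k).
  by case: k => [j|]; [have [h [_ m _ _]] := approxW j|have [h [_ m _ _]] := approxN];
    exact: energy_meas.
have E0 k w : (0 <= E k w)%E by case: k => [j|]; exact: energy_ge0.
have -> : mean P Z total_energy = (\sum_k mean P Z (E k))%E.
  rewrite energy_sum /mean -ge0_integral_sum//.
  - by apply: eq_integral => w _; rewrite ge0_sume_distrr.
  - by move=> k; apply: emeasurable_funM => //; exact/measurable_EFinP.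
  - by move=> k w _; rewrite mule_ge0// lee_fin.
rewrite total_sum ex_sum_ortho//; last by move=> k l; exact: D_ortho.
rewrite -sumEFin; apply: lee_sum => -[j|] _.
  by have [h a] := approxW j; exact: (approx_square (nW j) a bZ Z0).
by have [h a] := approxN; exact: (approx_square nN a bZ Z0).
Qed.

End increments.

(** * The Lyapunov function *)

Section lyapunov.
Context {R : realType}.
Notation lam := (@lebesgue_measure R).
Variable zeta : R -> R.
Hypothesis zeta_ge1 : forall r, 0 <= r -> 1 <= zeta r.
Hypothesis zeta_nd : forall r s, 0 <= r -> r <= s -> zeta r <= zeta s.

(* Extended by a constant to negative arguments, so as to be monotone on R. *)
Definition growth_rate (r : R) : R := Num.max r 0 * zeta (Num.max r 0) + 1.
Notation h := growth_rate.

Definition lyap (r : R) : R := \int[lam]_(x in `[0, r]) (h x)^-1.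

Lemma growth_rateE r : 0 <= r -> h r = r * zeta r + 1.
Proof. by move=> r0; rewrite /h max_l. Qed.

Lemma growth_rate_nd : {homo h : r s / r <= s}.
Proof.
move=> r s rs; rewrite /h lerD2r.
have m0 (x : R) : 0 <= Num.max x 0 by rewrite le_max lexx orbT.
have mm : Num.max r 0 <= Num.max s 0.
  by rewrite ge_max m0 andbT le_max rs.
by apply: ler_pM => //; [exact: le_trans (zeta_ge1 _)|exact: zeta_nd].
Qed.

Lemma growth_rate_ge1 r : 1 <= h r.
Proof.
have m0 (x : R) : 0 <= Num.max x 0 by rewrite le_max lexx orbT.
by rewrite /h lerDr mulr_ge0// (le_trans ler01)// zeta_ge1.
Qed.

Lemma growth_rate_gt0 r : 0 < h r.
Proof. exact: lt_le_trans ltr01 (growth_rate_ge1 r). Qed.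

Lemma inv_growth_meas : measurable_fun setT (fun x => (h x)^-1).
Proof.
suff : measurable_fun setT (fun x => - (h x)^-1).
  move=> m; rewrite (_ : (fun x => _) = \- (fun x => - (h x)^-1)).
    exact: measurable_funN.
  by apply/funext => x /=; rewrite opprK.
apply: nondecreasing_measurable => // x y xy.
by rewrite lerN2 lef_pV2 ?posrE ?growth_rate_gt0//; exact: growth_rate_nd.
Qed.

Lemma inv_growth_bound x : 0 <= (h x)^-1 <= 1.
Proof.
by rewrite invr_ge0 ltW ?growth_rate_gt0//= invf_le1 ?growth_rate_gt0 ?growth_rate_ge1.
Qed.

Lemma inv_growth_integrable (i : interval R) : (lam [set` i] < +oo)%E ->
  lam.-integrable [set` i] (EFin \o (fun x => (h x)^-1)).
Proof.
move=> ifin; have mi : measurable [set` i] by exact: measurable_itv.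
apply: measurable_bounded_integrable => //.
  exact: measurable_funTS inv_growth_meas.
exists 1; split; first exact: num_real.
move=> M M1 x _ /=; have /andP[x0 x1] := inv_growth_bound x.
by rewrite ger0_norm// (le_trans x1)// ltW.
Qed.

Let cc_fin (a b : bool) (x y : R) :
  (lam [set` Interval (BSide a x) (BSide b y)] < +oo)%E.
Proof. by rewrite lebesgue_measure_itv/=; case: ifP => _; rewrite ?ltry. Qed.

Lemma lyap_diff a b : 0 <= a -> a <= b ->
  lyap b - lyap a = \int[lam]_(x in `]a, b]) (h x)^-1.
Proof.
move=> a0 ab; rewrite /lyap Rintegral_itvB//.
- by apply: inv_growth_integrable; exact: cc_fin.
Qed.

Let lam_oc a b : a <= b -> fine (lam `]a, b]%classic) = b - a.
Proof.
rewrite le_eqVlt => /predU1P[->|ab]; first by rewrite set_itvoc0 measure0 subrr.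
by rewrite lebesgue_measure_itv/= lte_fin ab.
Qed.

(** The tangent inequality for a concave function, read off the integral: [1 / h] is at most
    [1 / h a] to the right of [a] and at least that to its left, where the increment is counted
    negatively. *)
Lemma lyap_increment a b : 0 <= a -> 0 <= b -> lyap b - lyap a <= (b - a) / h a.
Proof.
move=> a0 b0; have cst_int x y : lam.-integrable `]x, y] (EFin \o cst ((h a)^-1)).
  by apply: measurable_bounded_integrable => //; [exact: cc_fin|exact: bounded_cst].
have [ab|/ltW ba] := lerP a b.
  rewrite lyap_diff// mulrC -lam_oc// -Rintegral_cst//.
  apply: le_Rintegral => //; first by apply: inv_growth_integrable; exact: cc_fin.
  move=> x /=; rewrite in_itv/= => /andP[ax _].
  by rewrite lef_pV2 ?posrE ?growth_rate_gt0//; apply: growth_rate_nd; exact: ltW.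
rewrite -opprB lyap_diff// -(opprB a b) mulNr lerN2 mulrC -lam_oc// -Rintegral_cst//.
apply: le_Rintegral => //; first by apply: inv_growth_integrable; exact: cc_fin.
move=> x /=; rewrite in_itv/= => /andP[_ xa].
by rewrite lef_pV2 ?posrE ?growth_rate_gt0//; apply: growth_rate_nd.
Qed.

Lemma lyap_ge0 r : 0 <= lyap r.
Proof. by apply: Rintegral_ge0 => x _; have /andP[] := inv_growth_bound x. Qed.

Lemma lyap_nd : {homo lyap : a b / a <= b}.
Proof.
move=> a b ab; have [a0|a0] := lerP 0 a.
  rewrite -subr_ge0 lyap_diff//; apply: Rintegral_ge0 => x _.
  by have /andP[] := inv_growth_bound x.
rewrite {1}/lyap set_itv_ge ?Rintegral_set0 ?lyap_ge0//.
by rewrite bnd_simp -ltNge.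
Qed.

(** Stated at squares because [lyap] is applied to [|X|^2]. Divergence along the integers comes from
    exhausting the half-line by [[0, n]], and [n <= n^2] transfers it. *)
Lemma lyap_unbounded :
  (\int[lam]_(r in `[0%R, +oo[) ((r * zeta r + 1)^-1)%:E = +oo)%E ->
  forall M, exists n : nat, M <= lyap (n%:R ^+ 2).
Proof.
move=> infty M.
have mE (D : set R) : measurable D -> measurable_fun D (fun x => ((h x)^-1)%:E).
  by move=> mD; apply/measurable_EFinP; exact: measurable_funTS inv_growth_meas.
have nd : nondecreasing_seq (fun n : nat => `[0, n%:R]%classic : set R).
  move=> m n mn; apply/subsetPset => x /=; rewrite !in_itv/= => /andP[-> xm].
  by rewrite (le_trans xm)// ler_nat.
have mi (n : nat) : measurable (`[0, n%:R]%classic : set (measurableTypeR R)).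
  exact: measurable_itv.
have cv := @ge0_nondecreasing_set_cvg_integral _ (measurableTypeR R) R _
  (fun x => ((h x)^-1)%:E) lam nd mi (fun n => mE _ (mi n)) _.
have cv' : (\int[lam]_(x in `[0%R, n%:R]) ((h x)^-1)%:E)%E @[n --> \oo] --> +oo%E.
  rewrite -infty; have -> : (\int[lam]_(r in `[0%R, +oo[) ((r * zeta r + 1)^-1)%:E =
    \int[lam]_(r in \bigcup_n `[0%R, n%:R]%classic) ((h r)^-1)%:E)%E.
    rewrite (_ : \bigcup_n _ = `[0, +oo[%classic).
      by apply: eq_integral => x /set_mem/=; rewrite in_itv/= andbT => x0; rewrite growth_rateE.
    apply/seteqP; split => x /=; first by move=> [n _] /=; rewrite !in_itv/= => /andP[->].
    rewrite in_itv/= andbT => x0; exists (Num.truncn x).+1 => //=.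
    by rewrite in_itv/= x0 ltW// truncnS_gt.
  by apply: cv => // n x _; rewrite lee_fin; have /andP[] := inv_growth_bound x.
have [N _ /(_ N (leqnn N)) HN] := cvgey_ge cv' M.
exists N; apply: (@le_trans _ _ (lyap N%:R)).
  by rewrite -lee_fin /lyap fineK//; apply: integrable_fin_num => //;
   apply: inv_growth_integrable; exact: cc_fin.
apply: lyap_nd; case: N {HN} => [|N]; first by rewrite expr0n.
by rewrite ler_eXnr// ler1n.
Qed.

End lyapunov.

(** * Paths and exit times *)

Section euclidean_norm.
Context {R : realType}.

Lemma enorm_sqr m n (A : 'M[R]_(m, n)) : enorm A ^+ 2 = \sum_i \sum_j A i j ^+ 2.
Proof.
rewrite /enorm; have -> : \tr (A *m A^T) = \sum_i \sum_j A i j ^+ 2.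
  apply: eq_bigr => i _; rewrite mxE; apply: eq_bigr => j _.
  by rewrite mxE expr2.
by rewrite sqr_sqrtr// sumr_ge0// => i _; rewrite sumr_ge0// => j _; exact: sqr_ge0.
Qed.

Lemma enorm_cV_sqr d (x : 'cV[R]_d) : enorm x ^+ 2 = \sum_i x i 0 ^+ 2.
Proof. by rewrite enorm_sqr; apply: eq_bigr => i _; rewrite big_ord1. Qed.

Lemma enorm_ge0 m n (A : 'M[R]_(m, n)) : 0 <= enorm A.
Proof. exact: sqrtr_ge0. Qed.

Lemma enorm_entry d (x : 'cV[R]_d) i : `|x i 0| <= enorm x.
Proof.
rewrite -(ler_pXn2r (n := 2)) ?nnegrE ?enorm_ge0// real_normK ?num_real//.
rewrite enorm_cV_sqr (bigD1 i)//= lerDl sumr_ge0// => j _; exact: sqr_ge0.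
Qed.

Lemma continuous_sum (U : topologicalType) (I : Type) (r : seq I) (f : I -> U -> R) :
  (forall i, continuous (f i)) -> continuous (fun x => \sum_(i <- r) f i x).
Proof.
move=> cf x; elim: r => [|i r ih].
  by under eq_fun do rewrite big_nil; exact: cvg_cst.
under eq_fun do rewrite big_cons.
by apply: (@continuousD _ _ _ (f i) _ x) => //; exact: cf.
Qed.

Lemma continuous_enorm m n : continuous (@enorm R m n).
Proof.
move=> A; apply: (continuous_comp (f := fun A : 'M[R]_(m, n) => \tr (A *m A^T))); last first.
  exact: sqrt_continuous.
have -> : (fun A : 'M[R]_(m, n) => \tr (A *m A^T)) = fun A => \sum_i \sum_j A i j * A i j.
  apply/funext => B; apply: eq_bigr => i _; rewrite mxE; apply: eq_bigr => j _.
  by rewrite mxE.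
apply: continuous_sum => i; apply: continuous_sum => j B.
by apply: continuousM; exact: coord_continuous.
Qed.

Lemma mx_norm_le m n (A : 'M[R]_(m, n)) e : 0 <= e -> (forall i j, `|A i j| <= e) ->
  `|A| <= e.
Proof.
move=> e0 Ae; rewrite /Num.norm/= mx_normrE; apply/bigmax_leP; split => // ij _.
Qed.

Lemma continuous_tr m n : continuous (@trmx R m n).
Proof.
move=> A S [Q QA QS]; exists (fun i j => Q j i) => [i j|M QM].
  by have := QA j i; rewrite mxE.
by apply: QS => i j; rewrite mxE; exact: QM.
Qed.

(** Compactness of the Euclidean ball comes from [bounded_closed_compact], which concerns row
    vectors; hence the transpositions. *)
Lemma continuous_bounded_ball d (f : 'cV[R]_d -> R) (r : R) : continuous f ->
  exists C, 0 <= C /\ forall x, enorm x <= r -> `|f x| <= C.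
Proof.
move=> cf; pose B := [set x : 'rV[R]_d | enorm x^T <= r].
have cB : compact B.
  apply: bounded_closed_compact.
    exists r; split; first exact: num_real.
    move=> M rM x /= Bx; apply: mx_norm_le => [|i j].
      by apply: le_trans (ltW rM); exact: le_trans (enorm_ge0 _) Bx.
    rewrite ord1 (_ : x 0 j = x^T j 0); last by rewrite mxE.
    by rewrite (le_trans (enorm_entry _ _))// (le_trans Bx)// ltW.
  have -> : B = (fun x : 'rV[R]_d => enorm x^T) @^-1` [set y | y <= r] by [].
  apply: (closed_comp _ (@closed_le _ r)) => x _.
  by apply: continuous_comp; [exact: continuous_tr|exact: continuous_enorm].
have cg : {within B, continuous (fun x : 'rV[R]_d => f x^T)}.
  apply: continuous_subspaceT => x.
  by apply: continuous_comp; [exact: continuous_tr|exact: cf].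
have [M [_ MB]] := compact_bounded (continuous_compact cg cB).
exists (`|M| + 1); split; first by rewrite addr_ge0.
move=> x xr; apply: MB; first by rewrite (le_lt_trans (ler_norm M))// ltrDl.
by exists x^T; rewrite /B/= trmxK.
Qed.

End euclidean_norm.

Section exit_times.
Context {R : realType} {dT : measure_display} {T : measurableType dT} {d : nat}.
Variable X : R -> T -> 'cV[R]_d.
Hypothesis cX : forall n w,
  cadlag_on [set t | 0 <= t /\ (t%:E <= exit_time X n w)%E] (X ^~ w).
Notation lam := (@lebesgue_measure R).
Notation tau := (exit_time X).

Lemma exit_time_ge0 n w : (0 <= tau n w)%E.
Proof. by apply: le_ereal_inf_tmp => _ [t [t0 _] <-]; rewrite lee_fin. Qed.

Lemma before_exit n w t : 0 <= t -> (t%:E < tau n w)%E -> enorm (X t w) <= n%:R.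
Proof.
move=> t0; rewrite leNgt; apply: contraPN => nX.
by apply/negP; rewrite -leNgt; apply: ereal_inf_lbound; exists t.
Qed.

Lemma exit_time_le n w t : 0 <= t -> n%:R < enorm (X t w) -> (tau n w <= t%:E)%E.
Proof. by move=> t0 nX; apply: ereal_inf_lbound; exists t. Qed.

Lemma exit_right n w t : 0 <= t -> (t%:E <= tau n w)%E ->
  enorm (X s w) @[s --> t^'+] --> enorm (X t w).
Proof.
move=> t0 tt; have [c _] := @cX n w t (conj t0 tt).
exact: (continuous_cvg _ (continuous_enorm (x := _)) c).
Qed.

Lemma at_right_ex (Q : R -> Prop) (t : R) : (\forall s \near t^'+, Q s) ->
  exists2 e, 0 < e & forall s, t < s -> s < t + e -> Q s.
Proof.
move=> [e /= e0 H]; exists e => // s ts se; apply: H => //=.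
by rewrite distrC ger0_norm ?subr_ge0 ?ltW// ltrBlDl.
Qed.

(* Right-continuity at the exit time keeps the path bounded for a while
   afterwards, so that it is also right-continuous there. *)
Lemma exit_lt_witness n w t : (tau n w < t%:E)%E ->
  exists s m, [/\ 0 <= s < t, n%:R < enorm (X s w) & (s%:E <= tau m w)%E].
Proof.
move=> tt; have t0 := exit_time_ge0 n w.
have [r rE] : exists r, tau n w = r%:E.
  by move: tt t0; case: (tau n w) => [r| |] //; exists r.
have rt : (r%:E <= tau n w)%E by rewrite rE.
rewrite rE lte_fin in tt; rewrite rE lee_fin in t0.
have X1 : enorm (X r w) < enorm (X r w) + 1 by rewrite ltrDl.
have [e e0 He] := at_right_ex (cvgr_lt _ (exit_right t0 rt) _ X1).
(* After [r] the bound [|X r| + 1] is available for a while, before [r] only the bound [n]: [m] has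
   to dominate both. *)
pose m := maxn n (Num.truncn (enorm (X r w) + 1)).+1.
have mr : enorm (X r w) + 1 <= m%:R.
  by rewrite (le_trans (ltW (truncnS_gt _)))// ler_nat leq_maxr.
have tm : ((r + e)%:E <= tau m w)%E.
  apply: le_ereal_inf_tmp => _ [s [s0 ms] <-]; rewrite lee_fin leNgt; apply/negP => se.
  have [rs|sr|rs] := ltgtP r s.
  - by have := lt_trans ms (He _ rs se); rewrite ltNge mr.
  - have := before_exit s0 (n := n) (w := w); rewrite rE lte_fin => /(_ sr) sn.
    by have := lt_le_trans ms sn; rewrite ltr_nat ltnNge leq_maxl.
  - by have := lt_le_trans ms (le_trans _ mr); rewrite rs lerDl ler01 ltxx => /(_ isT).
have : (tau n w < (Num.min t (r + e))%:E)%E.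
  by rewrite rE lte_fin lt_min tt ltrDl.
move=> /ereal_inf_lt[_ [s [s0 ns] <-]]; rewrite lte_fin lt_min => /andP[st se].
exists s, m; split => //; first by rewrite s0.
by apply: le_trans tm; rewrite lee_fin ltW.
Qed.

(** The witness of an early exit is a point of right-continuity, so a rational time slightly later
    serves as well. The event becomes a countable union, whence [exit_meas]. *)
Lemma exit_ltP n w t : (tau n w < t%:E)%E <->
  exists q : rat, ((0 : R) <= ratr q < t) && (n%:R < enorm (X (ratr q) w)).
Proof.
split=> [/exit_lt_witness[s [m [/andP[s0 st] ns sm]]]|[q /andP[/andP[q0 qt] nq]]].
  have [e e0 He] := at_right_ex (cvgr_gt _ (exit_right s0 sm) _ ns).
  have : s < Num.min t (s + e) by rewrite lt_min st ltrDl.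
  move=> /rat_in_itvoo[q]; rewrite in_itv/= lt_min => /andP[sq /andP[qt qe]].
  by exists q; rewrite qt (le_trans s0 (ltW sq)) He.
by apply: le_lt_trans (exit_time_le q0 nq) _; rewrite lte_fin.
Qed.

(** If the norm were below [n] at the exit time, right-continuity would keep it there for a while
    and postpone the exit. *)
Lemma exit_value n w r : tau n w = r%:E -> n%:R <= enorm (X r w).
Proof.
move=> rE; have r0 : 0 <= r by rewrite -lee_fin -rE exit_time_ge0.
rewrite leNgt; apply/negP => Xn.
have rt : (r%:E <= tau n w)%E by rewrite rE.
have [e e0 He] := at_right_ex (cvgr_lt _ (exit_right r0 rt) _ Xn).
have : ((r + e)%:E <= tau n w)%E.
  apply: le_ereal_inf_tmp => _ [s [s0 ns] <-]; rewrite lee_fin leNgt; apply/negP => se.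
  have [rs|sr|rs] := ltgtP r s.
  - by have := lt_trans ns (He _ rs se); rewrite ltxx.
  - have := before_exit s0 (n := n) (w := w); rewrite rE lte_fin => /(_ sr) sn.
    by have := lt_le_trans ns sn; rewrite ltxx.
  - by rewrite rs in Xn; have := lt_trans ns Xn; rewrite ltxx.
by rewrite rE lee_fin leNgt ltrDl e0.
Qed.

Lemma stopped_before n t w : (t%:E <= tau n w)%E -> stopped_time X n t w = t.
Proof. by move=> tt; rewrite /stopped_time min_l. Qed.

Lemma stopped_after n t r w : tau n w = r%:E -> r <= t -> stopped_time X n t w = r.
Proof. by move=> rE rt; rewrite /stopped_time rE min_r// lee_fin. Qed.

Lemma stopped_value n t w : (tau n w < t%:E)%E ->
  n%:R <= enorm (X (stopped_time X n t w) w).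
Proof.
move=> tt; have t0 := exit_time_ge0 n w.
have [r rE] : exists r, tau n w = r%:E.
  by move: tt t0; case: (tau n w) => [r| |] //; exists r.
by rewrite (stopped_after rE) ?exit_value//; move: tt; rewrite rE lte_fin => /ltW.
Qed.

Lemma exit_meas (F : R -> set (set T)) n t : adapted F X ->
  (forall s, 0 <= s -> sigma_algebra setT (F s)) ->
  (forall s u, 0 <= s -> s <= u -> F s `<=` F u) -> 0 <= t ->
  F t [set w | (t%:E <= tau n w)%E].
Proof.
move=> aX Fs Fm t0.
suff : measurable ([set w | (tau n w < t%:E)%E] : set (g_sigma_algebraType (F t))).
  move=> /measurableC; rewrite /measurable/= sigma_algebra_id; last exact: Fs.
  by congr (F t _); apply/seteqP; split => w /=; rewrite leNgt; [move/negP|move=> /negP].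
rewrite (_ : [set w | _] = \bigcup_(q : rat)
    [set w | ((0 : R) <= ratr q < t) && (n%:R < enorm (X (ratr q) w))]); last first.
  by apply/seteqP; split => w /=; [move=> /exit_ltP[q]; exists q|move=> [q _] H; apply/exit_ltP; exists q].
apply: bigcupT_measurable_rat => q.
have [/andP[q0 qt]|qn] := boolP ((0 : R) <= ratr q < t); last first.
  by rewrite (_ : [set w | _] = set0)//; apply/seteqP; split => w.
have mq : meas_wrt (F t) (fun w => enorm (X (ratr q) w)).
  apply: (meas_wrt_sub (Fm _ _ q0 (ltW qt))).
  exact: (adapted_continuous Fs aX (@continuous_enorm _ _ _) q0).
have := mq measurableT _ (measurable_itv `]n%:R, +oo[).
by rewrite setTI; congr measurable; apply/seteqP; split => w /=; rewrite in_itv/= andbT.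
Qed.

Lemma left_limit n w s : 0 < s -> (s%:E <= tau n w)%E ->
  X r w @[r --> s^'-] --> leftlim (X ^~ w) s.
Proof.
by move=> s0 st; have [_ /(_ s0)[y /cvgP]] := @cX n w s (conj (ltW s0) st).
Qed.

(* A jump of size larger than [e] at [s] excludes further ones just after [s]:
   choosing a rational there injects these times into the rationals. *)
Lemma jumps_countable n w e : 0 < e ->
  countable [set s | [/\ 0 < s, (s%:E < tau n w)%E & e < `|leftlim (X ^~ w) s - X s w|]].
Proof.
move=> e0; set D := [set s | _].
have step s : exists q : rat, D s -> s < ratr q /\ forall r, s < r -> r < ratr q -> ~ D r.
  have [[s0 st es]|nD] := pselect (D s); last by exists 0 => /nD.
  have [c _] := @cX n w s (conj (ltW s0) (ltW st)).
  have e4 : 0 < e / 4 by rewrite divr_gt0.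
  have [a a0 Ha] := at_right_ex (cvgr_dist_lt _ _ c _ e4).
  have : s < s + a by rewrite ltrDl.
  move=> /rat_in_itvoo[q]; rewrite in_itv/= => /andP[sq qa]; exists q => _; split => //.
  move=> r sr rq [r0 rt er].
  have l := left_limit r0 (ltW rt).
  have [b /= b0 Hb] := cvgr_dist_lt _ _ l _ e4.
  (* A time in [(s, r)] close to [r]: [X u] is within [e / 4] of the left limit at [r] and of [X s],
     and [X s] is within [e / 4] of [X r], so the jump at [r] is smaller than [e]. *)
  pose u := Num.max (r - b / 2) ((s + r) / 2).
  have su : s < u by rewrite lt_max midf_lt // orbT.
  have ur : u < r by rewrite gt_max midf_lt// andbT ltrBlDr ltrDl divr_gt0.
  have lu : `|leftlim (X ^~ w) r - X u w| < e / 4.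
    apply: Hb => //=; rewrite gtr0_norm ?subr_gt0// ltrBlDr -ltrBlDl lt_max.
    by apply/orP; left; lra.
  have Xu := Ha _ su (lt_trans ur (lt_trans rq qa)).
  have Xr := Ha _ sr (lt_trans rq qa).
  have : `|leftlim (X ^~ w) r - X r w| < e.
    rewrite (_ : _ - _ = (leftlim (X ^~ w) r - X u w) - (X s w - X u w) + (X s w - X r w)).
      apply: le_lt_trans (ler_normD _ _) _.
      apply: le_lt_trans (lerD (ler_normB _ _) (lexx _)) _.
      by lra.
    by apply/matrixP => i j; rewrite !mxE; ring.
  by rewrite ltNge (ltW er).
have [q Hq] := choice step.
apply/countable_injP; exists (fun s => choice.pickle (q s)) => s r /set_mem Ds /set_mem Dr.
move=> /(pcan_inj choice.pickleK) qq.
have [sq Hs] := Hq _ Ds; have [rq Hr] := Hq _ Dr.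
have [sr|rs|//] := ltgtP s r; exfalso.
- by apply: (Hs r sr _ Dr); rewrite qq.
- by apply: (Hr s rs _ Ds); rewrite -qq.
Qed.

(** The exceptional set consists of the exit time (index 0) and of the jumps larger than
    [1 / (k + 1)] before it (index [k + 1]), all countable. Outside it, integrals in time may use
    values for left limits and strict inequality for [<=]. *)
Lemma left_continuous_ae n w :
  exists2 N : set R, lam N = 0%E & measurable (N : set R) /\ (forall s, 0 < s -> ~ N s ->
    (s%:E <= tau n w)%E -> (s%:E < tau n w)%E /\ X r w @[r --> s^'-] --> X s w).
Proof.
pose N := \bigcup_k (if k is k'.+1 then [set s | [/\ 0 < s, (s%:E < tau n w)%E &
  k'.+1%:R^-1 < `|leftlim (X ^~ w) s - X s w|]] else [set s : R | s%:E = tau n w]).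
have cN : countable N.
  apply: bigcup_countable => // -[|k] _; last by apply: jumps_countable; rewrite invr_gt0.
  apply: sub_countable (countable1 (fine (tau n w))).
  by apply: subset_card_le => s /= <-.
exists N; first exact: countable_lebesgue_measure0.
split; first exact: countable_measurable.
move=> s s0 Ns st; have stt : (s%:E < tau n w)%E.
  rewrite lt_neqAle st andbT; apply/eqP => E; by apply: Ns; exists 0%N.
split => //; have := left_limit s0 st; suff -> : leftlim (X ^~ w) s = X s w by [].
apply/eqP; rewrite -subr_eq0 -normr_eq0; apply/negPn/negP => nz.
apply: Ns; exists (Num.truncn `|leftlim (X ^~ w) s - X s w|^-1).+1 => //=; split => //.
rewrite invf_plt ?posrE ?ltr0n// ?truncnS_gt//.
by rewrite lt_def nz normr_ge0.
Qed.

End exit_times.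

(** * Joint measurability in time and sample point *)

Lemma measurable_nat_family {R : realType} {d : measure_display} {S : measurableType d}
    {dT : measure_display} {T : measurableType dT} (N : S -> nat) (G : nat -> T -> R) :
  (forall k, measurable (N @^-1` [set k])) -> (forall k, measurable_fun setT (G k)) ->
  measurable_fun setT (fun z : S * T => G (N z.1) z.2).
Proof.
move=> mN mG _ B mB; rewrite setTI.
rewrite (_ : _ @^-1` _ = \bigcup_k ((N @^-1` [set k]) `*` (G k @^-1` B))).
  apply: bigcupT_measurable => k; apply: measurableX => //.
  by rewrite -[_ @^-1` _]setTI; exact: mG.
apply/seteqP; split => [[s w] /= H|[s w] [k _ [/= <-]]//].
by exists (N s).
Qed.

Section joint_measurability.
Context {R : realType} {dT : measure_display} {T : measurableType dT} {d : nat}.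
Variable X : R -> T -> 'cV[R]_d.
Hypothesis cX : forall n w,
  cadlag_on [set t | 0 <= t /\ (t%:E <= exit_time X n w)%E] (X ^~ w).
Notation tau := (exit_time X).

(** Differs from [stop_ind] at most at 0 and at the exit time. The strict inequality ensures
    [|X s| <= n], whereas at the exit time the path may have jumped out of the ball. *)
Definition active (n : nat) (s : R) (w : T) : R := ((0 <= s) && (s%:E < tau n w)%E)%:R.

Variable f : 'cV[R]_d -> R.
Hypotheses (cf : continuous f).
Hypothesis mX : forall t, 0 <= t -> measurable_fun setT (fun w => f (X t w)).
Hypothesis mtau : forall n t, 0 <= t -> measurable [set w | (t%:E <= tau n w)%E].

Let grid (m k : nat) : R := k.+1%:R / m.+1%:R.
Let idx (m : nat) (s : R) : nat := Num.truncn (s * m.+1%:R).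
Let G n m k w : R := f (X (grid m k) w) * ((grid m k)%:E <= tau n w)%E%:R.

Let grid_ge0 m k : 0 <= grid m k. Proof. by rewrite divr_ge0. Qed.

Let G_meas n m k : measurable_fun setT (G n m k).
Proof.
apply: measurable_funM; first exact: mX.
rewrite (_ : (fun w => _) = \1_[set w | ((grid m k)%:E <= tau n w)%E]).
  by apply: measurable_indic; exact: mtau.
apply/funext => w; rewrite indicE; congr (nat_of_bool _)%:R.
by apply/idP/idP => [H|/set_mem//]; exact/mem_set.
Qed.

Let idx_meas m k : measurable (idx m @^-1` [set k]).
Proof.
have mi : measurable_fun setT (fun s : R => (idx m s)%:R : R).
  apply: nondecreasing_measurable => // s r sr; rewrite ler_nat.
  by apply: le_truncn; rewrite ler_pM2r.
have := mi measurableT [set k%:R] (measurable_set1 _); rewrite setTI; congr measurable.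
apply/seteqP; split => s /=; last by move=> ->.
by move/eqP; rewrite eqr_nat => /eqP.
Qed.

Let grid_above m s : 0 <= s -> s < grid m (idx m s) <= s + m.+1%:R^-1.
Proof.
move=> s0; have m0 : 0 < m.+1%:R :> R by rewrite ltr0n.
rewrite /grid ltr_pdivlMr// truncnS_gt/= ler_pdivrMr// mulrDl mulVf ?gt_eqF//.
by rewrite -natr1 lerD2r truncn_le// mulr_ge0// ltW.
Qed.

(** The path is sampled at the first grid point strictly to the right of [s], as right-continuity
    allows. Strictness also gives the right indicator: for [s >= tau n] the grid point is past the
    exit, and for [s < tau n] it is eventually before it. *)
Let grid_cvg n (s : R) w :
  G n m (idx m s) w * (0 <= s)%R%:R @[m --> \oo] --> f (X s w) * active n s w.
Proof.
rewrite /active; have [s0|s0] := boolP (0 <= s); last first.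
  by rewrite /= mulr0; under eq_fun do rewrite mulr0; exact: cvg_cst.
have [st|st] /= := boolP (s%:E < tau n w)%E; last first.
  rewrite mulr0 (_ : (fun m => _) = cst 0); first exact: cvg_cst.
  apply/funext => m; rewrite /G (_ : (_ <= _)%E = false) ?mulr0 ?mul0r//.
  apply/negbTE; rewrite -ltNge; apply: le_lt_trans (_ : (s%:E < _)%E).
    by rewrite leNgt.
  by rewrite lte_fin; have /andP[] := grid_above m s0.
rewrite mulr1; under eq_fun do rewrite mulr1.
have [e e0 se] : exists2 e, 0 < e & ((s + e)%:E <= tau n w)%E.
  move: st; case: (tau n w) => [r| |] //; rewrite ?lte_fin => sr.
    by exists (r - s); rewrite ?subr_gt0// addrC subrK.
  by exists 1 => //; exact: leey.
have [c _] := @cX n w s (conj s0 (ltW st)).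
have cr : f (X r w) @[r --> s^'+] --> f (X s w).
  exact: (continuous_cvg _ (@cf (X s w)) c).
apply/cvgrPdist_lt => a a0.
have [b b0 Hb] := at_right_ex (cvgr_dist_lt _ _ cr _ a0).
near=> m; have /andP[g1 g2] := grid_above m s0.
have gb : m.+1%:R^-1 < Num.min b e :> R.
  by near: m; apply: near_infty_natSinv_lt (PosNum _); rewrite lt_min b0.
move: gb; rewrite lt_min => /andP[gb ge].
rewrite /G (_ : (_ <= _)%E = true) ?mulr1; last first.
  by apply: le_trans se; rewrite lee_fin (le_trans g2)// lerD2l ltW.
by apply: Hb => //; apply: le_lt_trans g2 _; rewrite ltrD2l.
Unshelve. all: by end_near. Qed.

Lemma path_joint_meas n :
  measurable_fun setT (fun z : R * T => f (X z.1 z.2) * active n z.1 z.2).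
Proof.
pose h (m : nat) (z : R * T) : R := G n m (idx m z.1) z.2 * (0 <= z.1)%R%:R.
apply: (measurable_fun_cvg (h := h)).
  move=> m; apply: measurable_funM.
    exact: (measurable_nat_family (idx_meas m) (G_meas n m)).
  rewrite (_ : (fun z => _) = \1_(`[0, +oo[%classic : set R) \o fst).
    by apply: measurableT_comp => //; apply: measurable_indic.
  apply/funext => -[s w]/=; rewrite indicE; congr (nat_of_bool _)%:R.
  by rewrite mem_setE in_itv/= andbT.
by move=> [s w] _; exact: grid_cvg.
Qed.

End joint_measurability.

(** * The stopped equation *)

Section growth_continuity.
Context {R : realType}.
Variable zeta : R -> R.
Hypothesis zeta_C1 : C1_halfline zeta.

(** Near [r] the difference quotient stays below [|df r| + 1]; this is how continuity of
    [growth_rate] is obtained. *)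
Lemma C1_halfline_lipschitz r : 0 <= r ->
  exists e L, [/\ 0 < e, 0 <= L & forall s, 0 <= s -> `|s - r| < e ->
    `|zeta s - zeta r| <= L * `|s - r|].
Proof.
move=> r0; have [df _ H] := zeta_C1.
have := H r r0 => /cvgr_dist_lt/(_ _ ltr01).
rewrite near_withinE => -[e /= e0 He].
exists e, (`|df r| + 1); split => // s s0 sr.
have [->|nsr] := eqVneq s r; first by rewrite !subrr normr0 mulr0.
have := He s; rewrite /= distrC => /(_ sr (conj s0 nsr)) q1.
have q2 : `|(zeta s - zeta r) / (s - r)| <= `|df r| + 1.
  rewrite -[X in `|X|](subrK (df r)) addrC; apply: le_trans (ler_normD _ _) _.
  by rewrite lerD2l distrC ltW.
have nz : s - r != 0 by rewrite subr_eq0.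
by move: q2; rewrite normrM normfV ler_pdivrMr ?normr_gt0.
Qed.

Lemma continuous_growth_rate : continuous (growth_rate zeta).
Proof.
have cm : continuous (fun r : R => Num.max r 0).
  move=> r; apply: continuous_max; [exact: cvg_id|exact: cvg_cst].
have cz : continuous (fun r : R => zeta (Num.max r 0)).
  move=> r; set q := Num.max r 0.
  have q0 : 0 <= q by rewrite le_max lexx orbT.
  have [e [L [e0 L0 H]]] := C1_halfline_lipschitz q0.
  apply/cvgrPdist_lt => a a0.
  have e1 : 0 < Num.min e (a / (L + 1)) by rewrite lt_min e0 divr_gt0// ltr_wpDl.
  have := cm r => /cvgr_dist_lt/(_ _ e1); apply: filterS => s /=.
  rewrite -/q distrC lt_min => /andP[s1 s2]; rewrite distrC.
  apply: le_lt_trans (H _ _ s1) _; first by rewrite le_max lexx orbT.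
  have L1 : 0 < L + 1 by rewrite ltr_wpDl.
  move: s2; rewrite ltr_pdivlMr// => s2; apply: le_lt_trans s2.
  by rewrite mulrC ler_wpM2l// lerDl.
by move=> r; apply: cvgD; [apply: cvgM; [exact: cm|exact: cz]|exact: cvg_cst].
Qed.

End growth_continuity.

Section stopped_integrands.
Context {R : realType} {dT : measure_display} {T : measurableType dT} {d : nat}.
Context {dU : measure_display} {U : measurableType dU}.
Notation lam := (@lebesgue_measure R).
Variable nu : {sigma_finite_measure set U -> \bar R}.
Variables (b : 'cV[R]_d -> 'cV[R]_d) (sigma : 'cV[R]_d -> 'M[R]_d)
  (c : 'cV[R]_d -> U -> 'cV[R]_d).
Hypothesis c_meas1 : forall x i, measurable_fun setT (fun u => c x u i 0).
Hypothesis c_int : forall x, (\int[nu]_u (enorm (c x u) ^+ 2)%:E < +oo)%E.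
Variable X : R -> T -> 'cV[R]_d.
Hypothesis cX : forall n w,
  cadlag_on [set t | 0 <= t /\ (t%:E <= exit_time X n w)%E] (X ^~ w).
Notation tau := (exit_time X).
Notation active := (active X).

Definition jump_energy (x : 'cV[R]_d) : R := \int[nu]_u (enorm (c x u) ^+ 2).

Lemma jump_energyE x :
  (\sum_i \int[nu]_u (c x u i 0 ^+ 2)%:E)%E = (jump_energy x)%:E.
Proof.
have m i : measurable_fun setT (fun u => (c x u i 0 ^+ 2)%:E).
  by apply/measurable_EFinP; apply: measurable_funX.
rewrite -ge0_integral_sum//; last by move=> i u _; rewrite lee_fin sqr_ge0.
rewrite /jump_energy fineK; last first.
  by rewrite ge0_fin_numE ?c_int// integral_ge0// => u _; rewrite lee_fin sqr_ge0.
by apply: eq_integral => u _; rewrite sumEFin -enorm_cV_sqr.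
Qed.

Lemma jump_energy_ge0 x : 0 <= jump_energy x.
Proof. by apply: Rintegral_ge0 => u _; exact: sqr_ge0. Qed.

Variable n : nat.

(** The rate at which the stopped process accumulates quadratic variation in mean, summed over its
    coordinates. *)
Definition gam (r : R) (w : T) : R :=
  (enorm (sigma (X r w)) ^+ 2 + jump_energy (X r w)) * active n r w.

Definition diffusion_part i j r w : R := sigma (X r w) i j * stop_ind X n r w.
Definition jump_part i r u w : R := c (leftlim (X ^~ w) r) u i 0 * stop_ind X n r w.

Hypothesis mH : forall i j,
  measurable_fun setT (fun z : R * T => diffusion_part i j z.1 z.2).
Hypothesis mG : forall i, jmeas (jump_part i).
Hypothesis mgam : measurable_fun setT (fun z : R * T => gam z.1 z.2).

(** The stochastic integrands carry left limits and [stop_ind], while the growth condition is to be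
    applied to values of the path with [active]. By [left_continuous_ae] the two versions agree at
    almost every time. *)
Lemma total_energyE s t w : 0 <= s ->
  (\sum_i total_energy s t nu (diffusion_part i) (jump_part i) w)%E =
  (\int[lam]_(r in `]s, t]) (gam r w)%:E)%E.
Proof.
move=> s0.
have mh i j : measurable_fun `]s, t] (fun r => (diffusion_part i j r w ^+ 2)%:E).
  apply: measurable_funTS; apply/measurable_EFinP; apply: measurable_funX.
  exact: (measurableT_comp (mH i j) (g := fun r : R => (r, w)) (measurable_fun_pair _ _)).
have mg i : measurable_fun `]s, t] (fun r => (\int[nu]_u (jump_part i r u w ^+ 2)%:E)%E).
  by apply: measurable_funTS; exact: energy_meas_time.
have mhs i : measurable_fun `]s, t] (fun r => (\sum_j (diffusion_part i j r w ^+ 2)%:E)%E).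
  exact: (emeasurable_sum (index_enum 'I_d) (mh i)).
have h0 i j r : (0 <= (diffusion_part i j r w ^+ 2)%:E)%E by rewrite lee_fin sqr_ge0.
have g0 i r : (0 <= \int[nu]_u (jump_part i r u w ^+ 2)%:E)%E.
  by apply: integral_ge0 => u _; rewrite lee_fin sqr_ge0.
transitivity (\int[lam]_(r in `]s, t]) \sum_i (\sum_j (diffusion_part i j r w ^+ 2)%:E +
    \int[nu]_u (jump_part i r u w ^+ 2)%:E))%E.
  rewrite ge0_integral_sum//; last 2 first.
  - by move=> i; exact: (emeasurable_funD (mhs i) (mg i)).
  - by move=> i r _; rewrite adde_ge0// sume_ge0.
  apply: eq_bigr => i _; rewrite ge0_integralD//; last 3 first.
  - by move=> r _; exact: sume_ge0.
  - exact: mhs.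
  - exact: mg.
  by rewrite /total_energy ge0_integral_sum// => j; exact: mh.
have [N N0 [mN HN]] := left_continuous_ae cX n w.
apply: ge0_ae_eq_integral => //.
- by apply: emeasurable_sum => i; exact: (emeasurable_funD (mhs i) (mg i)).
- apply: measurable_funTS; apply/measurable_EFinP.
  exact: (measurableT_comp mgam (g := fun r : R => (r, w)) (measurable_fun_pair _ _)).
- by move=> r _; apply: sume_ge0 => i _; rewrite adde_ge0// sume_ge0.
- move=> r _; rewrite lee_fin mulr_ge0 ?ler0n// addr_ge0 ?sqr_ge0 ?jump_energy_ge0//.
exists N; split => // r /= nr; apply: contrapT => Nr; apply: nr.
rewrite in_itv/= => /andP[sr rt]; have r0 : 0 < r by exact: le_lt_trans sr.
rewrite /diffusion_part /jump_part /gam /stop_ind /active r0 (ltW r0) /=.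
have [rtau|rtau] := boolP (r%:E <= tau n w)%E; last first.
  rewrite (_ : (r%:E < _)%E = false) ?mulr0; last first.
    by apply/negbTE; apply: contra rtau => /ltW.
  rewrite big1// => i _; rewrite big1 => [|j _]; last by rewrite mulr0 expr0n.
  by rewrite add0e integral0_eq// => u _; rewrite mulr0 expr0n.
have [rt' lX] := HN r r0 Nr rtau; rewrite rt' mulr1.
have -> : leftlim (X ^~ w) r = X r w by apply: cvg_lim lX; exact: norm_hausdorff.
rewrite big_split/= EFinD; congr (_ + _)%E; last first.
  rewrite -jump_energyE; apply: eq_bigr => i _; apply: eq_integral => u _.
  by rewrite mulr1.
rewrite enorm_sqr -sumEFin; apply: eq_bigr => i _; rewrite -sumEFin.
by apply: eq_bigr => j _; rewrite mulr1.
Qed.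

Variable i : 'I_d.
Definition drift_part (r : R) (w : T) : R := b (X r w) i 0 * active n r w.

Variable C : R.
Hypothesis mdrift : measurable_fun setT (fun z : R * T => drift_part z.1 z.2).
Hypothesis drift_le : forall r w, `|drift_part r w| <= C.

Lemma drift_integrable w (I : interval R) : (lam [set` I] < +oo)%E ->
  lam.-integrable [set` I] (EFin \o (drift_part ^~ w)).
Proof.
move=> Ifin; apply: measurable_bounded_integrable => //.
  apply: measurable_funTS.
  exact: (measurableT_comp mdrift (g := fun r : R => (r, w)) (measurable_fun_pair _ _)).
exists C; split; first exact: num_real.
by move=> M CM r _ /=; rewrite (le_trans (drift_le r w))// ltW.
Qed.

Lemma drift_stopped t w : 0 <= t ->
  \int[lam]_(r in `]0, stopped_time X n t w]) (b (X r w) i 0) =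
  \int[lam]_(r in `]0, t]) (drift_part r w).
Proof.
move=> t0; have [tt|] := boolP (t%:E < tau n w)%E.
  rewrite stopped_before ?ltW//; apply: eq_Rintegral => r /set_mem/=.
  rewrite in_itv/= => /andP[r0 rt]; rewrite /drift_part /active (ltW r0)/=.
  by rewrite (le_lt_trans _ tt) ?lee_fin// mulr1.
rewrite -leNgt => tt; have e0 := exit_time_ge0 X n w.
have [r0 rE] : exists r, tau n w = r%:E.
  by move: tt e0; case: (tau n w) => [r| |] //; exists r.
rewrite rE !lee_fin in tt e0.
rewrite (stopped_after rE tt).
have fin (I : bool * bool * R * R) :
    (lam [set` Interval (BSide I.1.1.1 I.1.2) (BSide I.1.1.2 I.2)] < +oo)%E.
  by rewrite lebesgue_measure_itv/=; case: ifP => _; rewrite ?ltry.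
have eqf r : r \in `]0, r0[%classic -> drift_part r w = b (X r w) i 0.
  move=> /set_mem/=; rewrite in_itv/= => /andP[rp rr].
  by rewrite /drift_part /active (ltW rp)/= rE lte_fin rr mulr1.
(* At the exit time [active] vanishes while [b (X r w)] need not; this single point is removed from
   the interval. *)
rewrite -Rintegral_itv_bndo_bndc; last first.
  apply: eq_integrable (drift_integrable w (fin (false, true, 0, r0))) => //.
  by move=> r rI /=; rewrite eqf.
transitivity (\int[lam]_(r in `]0, r0[) (drift_part r w)).
  by apply: eq_Rintegral => r rI; rewrite eqf.
have -> : `]0, r0[%classic = `]0, t] `&` `]0, r0[ :> set R.
  apply/seteqP; split => [r /=|r [_]//]; rewrite !in_itv/= => /andP[r1 r2].
  by rewrite r1 r2 (le_trans (ltW r2)).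
rewrite Rintegral_mkcondr; apply: eq_Rintegral => r /set_mem/=.
rewrite in_itv/= => /andP[r1 r2]; rewrite patchE; case: ifPn => // /negP nr.
rewrite /drift_part /active (ltW r1)/= rE lte_fin; case: ltP; last by rewrite mulr0.
by move=> rr; exfalso; apply: nr; apply/mem_set => /=; rewrite in_itv/= r1.
Qed.

End stopped_integrands.

(** * Bounded integrands on a bounded interval *)

Section interval_integral.
Context {R : realType}.
Notation lam := (@lebesgue_measure R).

Definition bounded_meas (f : R -> R) : Prop :=
  measurable_fun setT f /\ exists C, forall r, `|f r| <= C.

Lemma bounded_meas_cst a : bounded_meas (cst a).
Proof. by split; [exact: measurable_cst|exists `|a|]. Qed.

Lemma bounded_measD f g : bounded_meas f -> bounded_meas g ->
  bounded_meas (fun r => f r + g r).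
Proof.
move=> [mf [C fC]] [mg [D gD]]; split; first exact: measurable_funD.
by exists (C + D) => r; rewrite (le_trans (ler_normD _ _))// lerD.
Qed.

Lemma bounded_measZ a f : bounded_meas f -> bounded_meas (fun r => a * f r).
Proof.
move=> [mf [C fC]]; split; first exact: measurable_funM.
by exists (`|a| * C) => r; rewrite normrM ler_wpM2l.
Qed.

Lemma bounded_meas_sum (I : Type) (q : seq I) (f : I -> R -> R) :
  (forall i, bounded_meas (f i)) -> bounded_meas (fun r => \sum_(i <- q) f i r).
Proof.
move=> bf; elim: q => [|i q ih].
  by under eq_fun do rewrite big_nil; exact: bounded_meas_cst.
by under eq_fun do rewrite big_cons; exact: bounded_measD.
Qed.

Variables (s u : R) (su : s <= u).
Notation J f := (\int[lam]_(r in `]s, u]) f r).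

Let lam_fin : (lam `]s, u]%classic < +oo)%E.
Proof. by rewrite lebesgue_measure_itv/=; case: ifP => _; rewrite ?ltry. Qed.

Let lam_oc : fine (lam `]s, u]%classic) = u - s.
Proof.
move: su; rewrite le_eqVlt => /predU1P[->|ab]; first by rewrite set_itvoc0 measure0 subrr.
by rewrite lebesgue_measure_itv/= lte_fin ab.
Qed.

Lemma bounded_meas_int f : bounded_meas f -> lam.-integrable `]s, u] (EFin \o f).
Proof.
move=> [mf [C fC]]; apply: measurable_bounded_integrable => //.
  exact: measurable_funTS mf.
exists C; split; first exact: num_real.
by move=> M CM r _ /=; rewrite (le_trans (fC r))// ltW.
Qed.

Lemma itv_intD f g : bounded_meas f -> bounded_meas g ->
  J (fun r => f r + g r) = J f + J g.
Proof. by move=> bf bg; apply: RintegralD => //; exact: bounded_meas_int. Qed.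

Lemma itv_intZ a f : bounded_meas f -> J (fun r => a * f r) = a * J f.
Proof. by move=> bf; apply: RintegralZl => //; exact: bounded_meas_int. Qed.

Lemma itv_int_sum (I : Type) (q : seq I) (f : I -> R -> R) :
  (forall i, bounded_meas (f i)) ->
  J (fun r => \sum_(i <- q) f i r) = \sum_(i <- q) J (f i).
Proof.
move=> bf; elim: q => [|i q ih].
  by rewrite big_nil; under eq_Rintegral do rewrite big_nil; rewrite Rintegral_cst// mul0r.
rewrite big_cons -ih -itv_intD//; last exact: bounded_meas_sum.
by under eq_Rintegral do rewrite big_cons.
Qed.

Lemma itv_int_cst a : J (cst a) = a * (u - s).
Proof.
rewrite Rintegral_cst//; congr (a * _); exact: lam_oc.
Qed.

Lemma itv_int_le f g : bounded_meas f -> bounded_meas g ->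
  (forall r, s < r -> r <= u -> f r <= g r) -> J f <= J g.
Proof.
move=> bf bg fg; apply: le_Rintegral => //; try exact: bounded_meas_int.
by move=> r /=; rewrite in_itv/= => /andP[]; exact: fg.
Qed.

Lemma itv_int_ge0 f : (forall r, 0 <= f r) -> 0 <= J f.
Proof. by move=> f0; apply: Rintegral_ge0. Qed.

Lemma itv_int_abs f C : bounded_meas f -> (forall r, `|f r| <= C) ->
  `|J f| <= C * (u - s).
Proof.
move=> bf fC; rewrite ler_norml -mulNr -!itv_int_cst.
by apply/andP; split; apply: itv_int_le => //; try exact: bounded_meas_cst;
  move=> r _ _; have := fC r; rewrite ler_norml => /andP[].
Qed.

Lemma itv_int_meas {dT : measure_display} {T : measurableType dT} (f : R -> T -> R) C :
  measurable_fun setT (fun z : R * T => f z.1 z.2) -> (forall r w, `|f r w| <= C) ->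
  measurable_fun setT (fun w => J (f ^~ w)).
Proof.
move=> mf fC.
have bf w : bounded_meas (f ^~ w).
  split; last by exists C.
  exact: (measurableT_comp mf (g := fun r : R => (r, w)) (measurable_fun_pair _ _)).
(* Adding the bound [C] makes the integrand nonnegative, as the Tonelli theorem requires. *)
have -> : (fun w => J (f ^~ w)) = fun w => J (fun r => f r w + C) - C * (u - s).
  apply/funext => w; rewrite itv_intD//; last exact: bounded_meas_cst.
  by rewrite itv_int_cst addrK.
apply: measurable_funB => //.
apply: (measurableT_comp (f := fine)) => //.
have f0 r w : 0 <= f r w + C by have := fC r w; rewrite ler_norml => /andP[]; lra.
under eq_fun do rewrite integral_mkcond.
have mg : measurable_fun setT (fun y : T * R =>
    if y.2 \in `]s, u]%classic then (f y.2 y.1 + C)%:E else 0%E).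
  apply: measurable_fun_ifT => //.
    apply: (measurable_fun_bool true).
    rewrite setTI (_ : _ @^-1` _ = setT `*` `]s, u]%classic); first exact: measurableX.
    by apply/seteqP; split => y /=; [move=> /set_mem|move=> [_ /mem_set]].
  apply/measurable_EFinP; apply: measurable_funD => //.
  apply: (measurableT_comp mf (g := fun y : T * R => (y.2, y.1))).
  exact: measurable_fun_pair.
have g0 y : (0 <= if y.2 \in `]s, u]%classic then (f y.2 y.1 + C)%:E else 0%E)%E.
  by case: ifP => // _; rewrite lee_fin.
have := @measurable_fun_fubini_tonelli_F _ _ T (measurableTypeR R) R lam _ mg g0.
congr measurable_fun; apply/funext => w; exact: eq_integral.
Qed.

End interval_integral.

(** * One step of the discretisation *)

Section one_step.
Context {R : realType} {dT : measure_display} {T : measurableType dT} {d : nat}.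
Context {dU : measure_display} {U : measurableType dU}.
Variable P : probability T R.
Notation lam := (@lebesgue_measure R).
Variable F : R -> set (set T).
Hypothesis Fsigma : forall t, 0 <= t -> sigma_algebra setT (F t).
Hypothesis Fmeas : forall t, 0 <= t -> F t `<=` measurable.
Hypothesis Fmono : forall s t, 0 <= s -> s <= t -> F s `<=` F t.
Variable nu : {sigma_finite_measure set U -> \bar R}.
Variables (b : 'cV[R]_d -> 'cV[R]_d) (sigma : 'cV[R]_d -> 'M[R]_d)
  (c : 'cV[R]_d -> U -> 'cV[R]_d).
Hypotheses (b_cont : continuous b) (sigma_cont : continuous sigma).
Hypothesis c_meas1 : forall x i, measurable_fun setT (fun u => c x u i 0).
Hypothesis c_int : forall x, (\int[nu]_u (enorm (c x u) ^+ 2)%:E < +oo)%E.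
Hypothesis c_int_cont : continuous (jump_energy nu c).
Variables (kappa : R) (zeta : R -> R).
Hypothesis kappa_gt0 : 0 < kappa.
Hypothesis zeta_ge1 : forall r, 0 <= r -> 1 <= zeta r.
Hypothesis zeta_nd : forall r s, 0 <= r -> r <= s -> zeta r <= zeta s.
Hypothesis zeta_C1 : C1_halfline zeta.
Notation hx x := (growth_rate zeta (enorm x ^+ 2)).
Hypothesis growth : forall x,
  2 * dotv x (b x) + enorm (sigma x) ^+ 2 + jump_energy nu c x <= kappa * hx x.
Variables (W : R -> T -> 'cV[R]_d) (W_BM : brownian_motion P F W).
Variables (p : R -> T -> option U) (p_PPP : poisson_point_process P F nu p).
Variable X : R -> T -> 'cV[R]_d.
Hypothesis aX : adapted F X.
Hypothesis cX : forall n w,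
  cadlag_on [set t | 0 <= t /\ (t%:E <= exit_time X n w)%E] (X ^~ w).
Notation tau := (exit_time X).

Lemma path_meas (f : 'cV[R]_d -> R) t : continuous f -> 0 <= t ->
  measurable_fun setT (fun w => f (X t w)).
Proof.
move=> cf t0; apply: meas_wrt_meas (Fmeas t0) _.
exact: (adapted_continuous Fsigma aX cf t0).
Qed.

Lemma alive_meas n t : 0 <= t -> F t [set w | (t%:E <= tau n w)%E].
Proof. by move=> t0; exact: exit_meas. Qed.

Lemma joint_meas (f : 'cV[R]_d -> R) n : continuous f ->
  measurable_fun setT (fun z : R * T => f (X z.1 z.2) * active X n z.1 z.2).
Proof.
move=> cf; apply: path_joint_meas => //; first by move=> t; exact: path_meas.
by move=> m t t0; exact: (Fmeas t0 (alive_meas m t0)).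
Qed.

Lemma continuous_hx : continuous (fun x : 'cV[R]_d => hx x).
Proof.
move=> x; apply: (continuous_comp (f := fun x : 'cV[R]_d => enorm x ^+ 2)).
  by apply: continuousM; exact: continuous_enorm.
exact: continuous_growth_rate.
Qed.

Lemma continuous_entry (f : 'cV[R]_d -> 'cV[R]_d) i : continuous f ->
  continuous (fun x => f x i 0).
Proof.
move=> cf x; apply: (continuous_comp (f := f) (g := fun y : 'cV[R]_d => y i 0)).
  exact: cf.
exact: coord_continuous.
Qed.

Lemma continuous_enorm_sqr (f : 'cV[R]_d -> 'M[R]_d) : continuous f ->
  continuous (fun x => enorm (f x) ^+ 2).
Proof.
move=> cf x; apply: (continuous_comp (f := f) (g := fun A => enorm A ^+ 2)).
  exact: cf.
by apply: continuousM; exact: continuous_enorm.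
Qed.

Variable n : nat.
Notation act := (active X n).

Lemma active_bound (f : 'cV[R]_d -> R) C r w : 0 <= C ->
  (forall x, enorm x <= n%:R -> `|f x| <= C) -> `|f (X r w) * act r w| <= C.
Proof.
move=> C0 fC; rewrite /active; have [/andP[r0 rt]|_] := boolP (_ && _).
  by rewrite mulr1 fC// before_exit.
by rewrite mulr0 normr0.
Qed.

Notation drift := (drift_part b X n).
Notation gm := (gam nu sigma c X n).

Lemma drift_meas i : measurable_fun setT (fun z : R * T => drift i z.1 z.2).
Proof. by apply: (joint_meas (f := fun x => b x i 0)); exact: continuous_entry. Qed.

Let cgam : continuous (fun x => enorm (sigma x) ^+ 2 + jump_energy nu c x).
Proof.
have cs := continuous_enorm_sqr sigma_cont.
by move=> x; apply: (@continuousD _ _ _ (fun x => enorm (sigma x) ^+ 2) _ x); [exact: cs|exact: c_int_cont].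
Qed.

Lemma gam_meas : measurable_fun setT (fun z : R * T => gm z.1 z.2).
Proof. exact: (joint_meas _ cgam). Qed.

Variables (C : R) (C0 : 0 <= C).
Hypothesis b_bound : forall x i, enorm x <= n%:R -> `|b x i 0| <= C.
Variables (Cg : R) (Cg0 : 0 <= Cg).
Hypothesis gam_bound : forall x, enorm x <= n%:R ->
  enorm (sigma x) ^+ 2 + jump_energy nu c x <= Cg.

Lemma drift_bound i r w : `|drift i r w| <= C.
Proof. by apply: (active_bound (f := fun x => b x i 0)) => // x; exact: b_bound. Qed.

Lemma gam_ge0 r w : 0 <= gm r w.
Proof. by rewrite mulr_ge0 ?ler0n// addr_ge0 ?sqr_ge0 ?jump_energy_ge0. Qed.

Lemma gam_norm r w : `|gm r w| <= Cg.
Proof.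
apply: (active_bound (f := fun x => enorm (sigma x) ^+ 2 + jump_energy nu c x)) => // x xn.
by rewrite ger0_norm ?gam_bound// addr_ge0 ?sqr_ge0 ?jump_energy_ge0.
Qed.

Lemma continuous_hxV : continuous (fun x : 'cV[R]_d => (hx x)^-1).
Proof.
move=> x; apply: (@continuousV _ _ (fun x : 'cV[R]_d => hx x) x); last exact: continuous_hx.
by rewrite gt_eqF ?growth_rate_gt0.
Qed.

Let section_meas (f : R -> T -> R) w : measurable_fun setT (fun z : R * T => f z.1 z.2) ->
  measurable_fun setT (f ^~ w).
Proof.
by move=> mf; exact: (measurableT_comp mf (g := fun r : R => (r, w)) (measurable_fun_pair _ _)).
Qed.

Lemma drift_bm i w : bounded_meas (drift i ^~ w).
Proof.
split; first by apply: section_meas; exact: drift_meas.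
by exists C => r; exact: drift_bound.
Qed.

Lemma gam_bm w : bounded_meas (gm ^~ w).
Proof.
split; first by apply: section_meas; exact: gam_meas.
by exists Cg => r; exact: gam_norm.
Qed.

Variables (s u : R) (s0 : 0 <= s) (su : s <= u).
Notation J f := (\int[lam]_(r in `]s, u]) f r).
Variables (A0 : set T) (FA0 : F 0 A0).

(** Being alive at [s] depends on the path strictly before [s], hence is an event of [F s]. It still
    allows a jump out of the ball at [s] itself, which the last factor excludes. *)
Definition kept (w : T) : R :=
  \1_A0 w * (\1_[set w | (s%:E <= tau n w)%E] w * \1_[set w | enorm (X s w) <= n%:R] w).

(** The tangent slope of [lyap] at [|X s|^2] on the kept paths; it is [F s]-measurable with values
    in [0, 1]. *)
Definition weight (w : T) : R := kept w / hx (X s w).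

(* Error made by replacing [X r] by [X s] in the growth condition, for [r] in
   [(s, u]]. *)
Definition frozen_error (r : R) (w : T) : R :=
  kept w * ((kappa * `|hx (X r w) - hx (X s w)| +
    \sum_i 2 * C * `|X s w i 0 - X r w i 0|) * act r w).

Lemma kept01 w : kept w = 0 \/
  [/\ kept w = 1, A0 w, (s%:E <= tau n w)%E & enorm (X s w) <= n%:R].
Proof.
rewrite /kept !indicE; case: (boolP (w \in A0)) => [/set_mem a|_]; last by left; rewrite mul0r.
case: (boolP (w \in _)) => [/set_mem /= t|_]; last by left; rewrite mul0r mulr0.
case: (boolP (w \in _)) => [/set_mem /= x|_]; last by left; rewrite !mulr0.
by right; rewrite !mulr1.
Qed.

Lemma kept_ge0 w : 0 <= kept w.
Proof. by case: (kept01 w) => [->|[->]]. Qed.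

Let hx_ge1 (x : 'cV[R]_d) : 1 <= hx x. Proof. exact: growth_rate_ge1. Qed.
Let hx_gt0 (x : 'cV[R]_d) : 0 < hx x. Proof. exact: growth_rate_gt0. Qed.

Lemma weight_ge0 w : 0 <= weight w.
Proof. by rewrite divr_ge0 ?kept_ge0// ltW. Qed.

Lemma weight_le1 w : weight w <= 1.
Proof.
rewrite /weight ler_pdivrMr// mul1r (le_trans _ (hx_ge1 _))//.
by case: (kept01 w) => [->|[->]].
Qed.

Lemma bmeas_indic A : F s A -> bmeas (F s) (\1_A : T -> R).
Proof.
move=> FA; split; first exact: meas_wrt_indic.
by exists 1 => w; rewrite indicE; case: (_ \in _); rewrite ?normr1 ?normr0.
Qed.

Lemma kept_bmeas : bmeas (F s) kept.
Proof.
apply: bmeasM; first by apply: bmeas_indic; exact: Fmono FA0.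
apply: bmeasM; first by apply: bmeas_indic; exact: alive_meas.
apply: bmeas_indic.
have := adapted_continuous Fsigma aX (@continuous_enorm _ _ _) s0.
move=> /(meas_wrtP _ (Fsigma s0))/(_ _ (measurable_itv `]-oo, n%:R])).
by congr (F s _); apply/seteqP; split => w /=; rewrite in_itv.
Qed.

Lemma weight_bmeas : bmeas (F s) weight.
Proof.
apply: bmeasM; first exact: kept_bmeas.
split.
  exact: (adapted_continuous Fsigma aX continuous_hxV s0).
by exists 1 => w; rewrite ger0_norm ?invr_ge0 ?invf_le1// ltW.
Qed.

(** The factor [kept] confines [X s] to the ball of radius [n], so this coefficient of the
    martingale increment is bounded. *)
Lemma weight_coord_bmeas i : bmeas (F s) (fun w => weight w * (2 * X s w i 0)).
Proof.
have -> : (fun w => weight w * (2 * X s w i 0)) = fun w =>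
    (hx (X s w))^-1 * (2 * (kept w * X s w i 0)).
  by apply/funext => w; rewrite /weight; ring.
have bh : bmeas (F s) (fun w => (hx (X s w))^-1).
  split.
    exact: (adapted_continuous Fsigma aX continuous_hxV s0).
  by exists 1 => w; rewrite ger0_norm ?invr_ge0 ?invf_le1// ltW.
have b2 : bmeas (F s) (cst 2 : T -> R).
  by split; [exact: measurable_cst|exists 2 => w; rewrite ger0_norm].
apply: bmeasM => //; apply: bmeasM => //; split.
  by apply: meas_wrtM; [exact: kept_bmeas.1|exact: adapted_coord].
exists n%:R => w; case: (kept01 w) => [->|[-> _ _ xn]].
  by rewrite mul0r normr0.
by rewrite mul1r (le_trans (enorm_entry _ _)).
Qed.

(** On kept and active paths both [X r] and [X s] lie in the ball of radius [n]: two positive values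
    of the growth rate differ by at most its value at [n^2], and each of the [d] coordinates
    contributes at most [2 C] times [2 n]. *)
Definition error_bound : R := kappa * growth_rate zeta (n%:R ^+ 2) + d%:R * (4 * C * n%:R).

Lemma frozen_error_ge0 r w : 0 <= frozen_error r w.
Proof.
rewrite mulr_ge0 ?kept_ge0// mulr_ge0 ?ler0n// addr_ge0 ?mulr_ge0 ?(ltW kappa_gt0)//.
by apply: sumr_ge0 => i _; rewrite !mulr_ge0.
Qed.

Lemma frozen_error_le r w : frozen_error r w <= error_bound.
Proof.
have B0 : 0 <= error_bound.
  by rewrite addr_ge0 ?mulr_ge0 ?(ltW kappa_gt0) ?(ltW (growth_rate_gt0 _ _)).
rewrite /frozen_error; case: (kept01 w) => [->|[-> _ _ xn]]; first by rewrite mul0r.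
rewrite mul1r /active; have [/andP[r0 rt]|_] := boolP (_ && _); last by rewrite mulr0.
rewrite mulr1; have rn := before_exit r0 rt.
have hle (x : 'cV[R]_d) : enorm x <= n%:R -> hx x <= growth_rate zeta (n%:R ^+ 2).
  by move=> xle; apply: growth_rate_nd => //; rewrite lerXn2r ?nnegrE ?enorm_ge0.
apply: lerD.
  rewrite ler_wpM2l ?(ltW kappa_gt0)// ler_norml.
  have := hle _ xn; have := hle _ rn; have := hx_gt0 (X s w); have := hx_gt0 (X r w).
  by move=> *; apply/andP; split; lra.
have -> : d%:R * (4 * C * n%:R) = \sum_(i < d) 4 * C * n%:R.
  by rewrite sumr_const card_ord mulr_natl.
apply: ler_sum => i _.
apply: (@le_trans _ _ (2 * C * (n%:R + n%:R))); last by lra.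
rewrite ler_wpM2l ?mulr_ge0//; apply: le_trans (ler_normB _ _) _.
by rewrite lerD// (le_trans (enorm_entry _ _)).
Qed.

Lemma frozen_error_meas : measurable_fun setT (fun z : R * T => frozen_error z.1 z.2).
Proof.
have mk : measurable_fun setT (fun z : R * T => kept z.2).
  by apply: (measurableT_comp (bmeas_meas Fmeas s0 kept_bmeas)).
have mact : measurable_fun setT (fun z : R * T => act z.1 z.2).
  have c1 : continuous (cst 1 : 'cV[R]_d -> R) by move=> x; exact: cst_continuous.
  by have := joint_meas n c1; under eq_fun do rewrite mul1r.
have msx (f : 'cV[R]_d -> R) : continuous f ->
    measurable_fun setT (fun z : R * T => f (X s z.2)).
  by move=> cf; apply: (measurableT_comp (path_meas cf s0)).
have key (f : 'cV[R]_d -> R) : continuous f ->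
    measurable_fun setT (fun z : R * T => `|f (X z.1 z.2) - f (X s z.2)| * act z.1 z.2).
  move=> cf.
  have -> : (fun z : R * T => `|f (X z.1 z.2) - f (X s z.2)| * act z.1 z.2) =
     fun z => `|f (X z.1 z.2) * act z.1 z.2 - f (X s z.2) * act z.1 z.2|.
    apply/funext => z; rewrite -mulrBl normrM; congr (_ * _).
    by rewrite ger0_norm.
  apply: measurableT_comp => //; apply: measurable_funB; first exact: joint_meas.
  by apply: measurable_funM => //; exact: msx.
have -> : (fun z : R * T => frozen_error z.1 z.2) = fun z => kept z.2 *
    (kappa * (`|hx (X z.1 z.2) - hx (X s z.2)| * act z.1 z.2) +
     \sum_i 2 * C * (`|X z.1 z.2 i 0 - X s z.2 i 0| * act z.1 z.2)).
  apply/funext => z; rewrite /frozen_error mulrDl mulrA mulr_suml; congr (_ * (_ + _)).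
  by apply: eq_bigr => i _; rewrite distrC mulrA.
apply: measurable_funM => //; apply: measurable_funD.
  by apply: measurable_funM => //; apply: (key (fun x => hx x)); exact: continuous_hx.
apply: measurable_sum => i; apply: measurable_funM => //.
by apply: (key (fun x => x i 0)); exact: coord_continuous.
Qed.

Lemma frozen_error_bm w : bounded_meas (frozen_error ^~ w).
Proof.
split; first by apply: section_meas; exact: frozen_error_meas.
by exists error_bound => r; rewrite ger0_norm ?frozen_error_ge0 ?frozen_error_le.
Qed.

(** Replacing [X r] by [X s] in the scalar product with [b] and in the growth rate costs
    [frozen_error]. The growth condition then leaves [kappa * h (X s)], whose second factor the
    weight cancels; the error is only reduced by the weight, since [h >= 1]. *)
Lemma step_pointwise w :
  weight w * (\sum_i 2 * X s w i 0 * J (drift i ^~ w) + J (gm ^~ w)) <=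
  kappa * (u - s) + J (frozen_error ^~ w).
Proof.
have J0 : 0 <= J (frozen_error ^~ w) by apply: itv_int_ge0 => r; exact: frozen_error_ge0.
have us : 0 <= u - s by rewrite subr_ge0.
have k0 := ltW kappa_gt0.
case: (kept01 w) => [k|[k _ _ xn]].
  by rewrite /weight k !mul0r addr_ge0// mulr_ge0.
have bz i : bounded_meas (fun r => 2 * X s w i 0 * drift i r w).
  by apply: bounded_measZ; exact: drift_bm.
have -> : \sum_i 2 * X s w i 0 * J (drift i ^~ w) + J (gm ^~ w) =
    J (fun r => \sum_i 2 * X s w i 0 * drift i r w + gm r w).
  rewrite itv_intD//; [|exact: bounded_meas_sum|exact: gam_bm].
  rewrite itv_int_sum//; congr (_ + _); apply: eq_bigr => i _.
  by rewrite itv_intZ//; exact: drift_bm.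
have le1 : J (fun r => \sum_i 2 * X s w i 0 * drift i r w + gm r w) <=
    kappa * hx (X s w) * (u - s) + J (frozen_error ^~ w).
  rewrite -itv_int_cst// -itv_intD//; [|exact: bounded_meas_cst|exact: frozen_error_bm].
  apply: itv_int_le.
  - by apply: bounded_measD; [exact: bounded_meas_sum|exact: gam_bm].
  - by apply: bounded_measD; [exact: bounded_meas_cst|exact: frozen_error_bm].
  move=> r sr ru; rewrite /frozen_error k mul1r /drift_part /gam /active /cst/=.
  have [/andP[r0 rt]|_] := boolP (_ && _); last first.
    rewrite !mulr0 !addr0 big1 => [|i _]; last by rewrite !mulr0.
    by rewrite mulr_ge0// ltW.
  rewrite !mulr1; have rn := before_exit r0 rt.
  have := growth (X r w); set y := X r w; set x := X s w => g.
  have e1 : \sum_i 2 * x i 0 * (b y i 0 * 1) = 2 * dotv y (b y) +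
      \sum_i 2 * ((x i 0 - y i 0) * b y i 0).
    rewrite /dotv mulr_sumr -big_split/=; apply: eq_bigr => i _; ring.
  rewrite e1.
  have e2 : \sum_i 2 * ((x i 0 - y i 0) * b y i 0) <= \sum_i 2 * C * `|x i 0 - y i 0|.
    apply: ler_sum => i _; rewrite -mulrA ler_wpM2l//.
    apply: le_trans (ler_norm _) _; rewrite normrM mulrC.
    by rewrite ler_wpM2r// b_bound.
  have e3 : kappa * hx y <= kappa * hx x + kappa * `|hx y - hx x|.
    by rewrite -mulrDr ler_wpM2l// -lerBlDl ler_norm.
  by lra.
rewrite /weight k div1r mulrC ler_pdivrMr//.
apply: le_trans le1 _; rewrite mulrDl; apply: lerD.
  by rewrite mulrAC.
by rewrite ler_peMr.
Qed.

Variables (IW IW' : 'I_d -> 'I_d -> T -> R) (IN IN' : 'I_d -> T -> R).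
Hypothesis IWs : forall i j, is_ito_integral P F (fun s w => W s w j 0)
  (diffusion_part sigma X n i j) s (IW i j).
Hypothesis IWu : forall i j, is_ito_integral P F (fun s w => W s w j 0)
  (diffusion_part sigma X n i j) u (IW' i j).
Hypothesis INs : forall i, is_compensated_integral P F nu (jump_measure p)
  (jump_part c X n i) s (IN i).
Hypothesis INu : forall i, is_compensated_integral P F nu (jump_measure p)
  (jump_part c X n i) u (IN' i).
Notation mart i := (total_increment (IW i) (IW' i) (IN i) (IN' i)).

Lemma mart_Ltwo i : Ltwo P (mart i).
Proof.
exact: (total_Ltwo Fsigma Fmeas Fmono s0 su W_BM p_PPP (IWs i) (IWu i) (INs i) (INu i)).
Qed.

Lemma gam_int_meas : measurable_fun setT (fun w => J (gm ^~ w)).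
Proof. by apply: (itv_int_meas su gam_meas (C := Cg)) => r w; exact: gam_norm. Qed.

Lemma drift_int_meas i : measurable_fun setT (fun w => J (drift i ^~ w)).
Proof.
by apply: (itv_int_meas su (drift_meas i) (C := C)) => r w; exact: drift_bound.
Qed.

Lemma frozen_int_meas : measurable_fun setT (fun w => J (frozen_error ^~ w)).
Proof.
apply: (itv_int_meas su frozen_error_meas (C := error_bound)) => r w.
by rewrite ger0_norm ?frozen_error_ge0 ?frozen_error_le.
Qed.

Lemma drift_int_bound i w : `|J (drift i ^~ w)| <= C * (u - s).
Proof. by apply: itv_int_abs => // [|r]; [exact: drift_bm|exact: drift_bound]. Qed.

Lemma gam_int_bound w : `|J (gm ^~ w)| <= Cg * (u - s).
Proof. by apply: itv_int_abs => // [|r]; [exact: gam_bm|exact: gam_norm]. Qed.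

Lemma frozen_int_bound w : `|J (frozen_error ^~ w)| <= error_bound * (u - s).
Proof.
apply: itv_int_abs => // [|r]; first exact: frozen_error_bm.
by rewrite ger0_norm ?frozen_error_ge0 ?frozen_error_le.
Qed.

Let gam_weight_Lone : Lone P (fun w => weight w * J (gm ^~ w)).
Proof.
apply: (bmeas_Lone Fmeas s0 weight_bmeas).
by apply: (@Lone_bounded _ _ _ _ _ (Cg * (u - s))); [exact: gam_int_meas|exact: gam_int_bound].
Qed.

Lemma mart_energy : \sum_i ex P (fun w => weight w * mart i w ^+ 2) <=
  ex P (fun w => weight w * J (gm ^~ w)).
Proof.
have mH i j : measurable_fun setT (fun z : R * T => diffusion_part sigma X n i j z.1 z.2).
  by case: (IWs i j).
have mG i : jmeas (jump_part c X n i) by case: (INs i).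
have mw := bmeas_meas Fmeas s0 weight_bmeas.
rewrite -lee_fin -sumEFin.
apply: (@le_trans _ _ (\sum_i mean P weight
    (total_energy s u nu (diffusion_part sigma X n i) (jump_part c X n i)))%E).
  apply: lee_sum => i _.
  apply: (total_square Fsigma Fmeas Fmono s0 su W_BM p_PPP (IWs i) (IWu i) (INs i) (INu i)).
    exact: weight_bmeas.
  exact: weight_ge0.
have te0 i w : (0 <= total_energy s u nu (diffusion_part sigma X n i) (jump_part c X n i) w)%E.
  rewrite /total_energy adde_ge0 ?energy_ge0// sume_ge0// => j _.
  by apply: integral_ge0 => r _; rewrite lee_fin sqr_ge0.
have mte i : measurable_fun setT
    (total_energy s u nu (diffusion_part sigma X n i) (jump_part c X n i)).
  apply: emeasurable_funD; last exact: energy_meas.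
  apply: emeasurable_sum => j.
  have jm : jmeas (fun r (_ : unit) w => diffusion_part sigma X n i j r w).
    apply: (measurableT_comp (mH i j) (g := fun z : R * unit * T => (z.1.1, z.2))).
    by apply: measurable_fun_pair => //; exact: measurableT_comp.
  have := energy_meas point_mass s u jm.
  by congr measurable_fun; apply/funext => w; rewrite point_energy.
rewrite EFin_ex// /mean -ge0_integral_sum//; last 2 first.
- by move=> i; apply: emeasurable_funM => //; exact/measurable_EFinP.
- by move=> i w _; rewrite mule_ge0// lee_fin weight_ge0.
rewrite le_eqVlt; apply/orP; left; apply/eqP; apply: eq_integral => w _.
rewrite -ge0_sume_distrr; last by move=> i _; exact: te0.
rewrite (total_energyE c_meas1 c_int cX mH mG gam_meas u w s0).
rewrite [RHS]EFinM /Rintegral fineK//.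
by apply: integrable_fin_num => //; apply: bounded_meas_int; exact: gam_bm.
Qed.

(** With [D] the increment of a coordinate over the step, that of its square is [2 x D + D^2]: the
    sum is the increment of [|X|^2], multiplied by the tangent slope. *)
Definition step (w : T) : R :=
  weight w * \sum_i (2 * X s w i 0 * (J (drift i ^~ w) + mart i w) +
    (J (drift i ^~ w) + mart i w) ^+ 2).

Lemma step_Lone : Lone P step.
Proof.
have LD i : Ltwo P (fun w => J (drift i ^~ w)).
  by apply: (Ltwo_bounded _ (drift_int_meas i)) => w; exact: drift_int_bound.
have LDM i := LtwoD (LD i) (mart_Ltwo i).
rewrite /step; under eq_fun do rewrite mulr_sumr; apply: Lone_sum => i.
under eq_fun do rewrite mulrDr; apply: LoneD.
  under eq_fun do rewrite mulrA.
  exact: (bmeas_Lone Fmeas s0 (weight_coord_bmeas i) (Ltwo_Lone (LDM i))).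
exact: (bmeas_Lone Fmeas s0 weight_bmeas (LDM i).2).
Qed.

(** The square of drift plus martingale part is split by [sqr_split]. The drift square is of second
    order in [u - s], while the excess [e] on the martingale square costs [e * Cg * (u - s)], which
    is of first order but as small as desired. *)
Lemma step_expectation e : 0 < e ->
  ex P step <=
  kappa * (u - s) + ex P (fun w => J (frozen_error ^~ w)) +
  (1 + e^-1) * (d%:R * (C * (u - s)) ^+ 2) + e * (Cg * (u - s)).
Proof.
move=> e0; have us : 0 <= u - s by rewrite subr_ge0.
pose k0 := kappa * (u - s) + (1 + e^-1) * (d%:R * (C * (u - s)) ^+ 2) + e * (Cg * (u - s)).
pose f1 w := J (frozen_error ^~ w).
pose f2 w := \sum_i weight w * (2 * X s w i 0) * mart i w.
pose f3 w := \sum_i weight w * mart i w ^+ 2.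
pose f4 w := weight w * J (gm ^~ w).
have L1 : Lone P f1.
  by apply: (@Lone_bounded _ _ _ _ _ (error_bound * (u - s)));
    [exact: frozen_int_meas|exact: frozen_int_bound].
have l2 i : Lone P (fun w => weight w * (2 * X s w i 0) * mart i w).
  exact: (bmeas_Lone Fmeas s0 (weight_coord_bmeas i) (Ltwo_Lone (mart_Ltwo i))).
have L2 : Lone P f2 by exact: Lone_sum.
have l3 i : Lone P (fun w => weight w * mart i w ^+ 2).
  exact: (bmeas_Lone Fmeas s0 weight_bmeas (mart_Ltwo i).2).
have L3 : Lone P f3 by exact: Lone_sum.
have L4 : Lone P f4 by [].
have L34 : Lone P (fun w => (1 + e) * (f3 w - f4 w)) by apply: LoneZ; exact: LoneB.
have L12 : Lone P (fun w => k0 + f1 w) by apply: LoneD => //; exact: Lone_cst.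
have e2 : ex P f2 = 0.
  rewrite /f2 ex_sum// big1// => i _.
  exact: (total_mean Fsigma Fmeas Fmono s0 su W_BM p_PPP (IWs i) (IWu i) (INs i) (INu i)
    (weight_coord_bmeas i)).
have e3 : ex P f3 <= ex P f4 by rewrite /f3 ex_sum//; exact: mart_energy.
(* The terms controlled only in mean are set apart: [f2] has mean zero, and [f3 - f4] has
   nonpositive mean by the isometry. The energy [f4] subtracted here is the one in [step_pointwise],
   its surplus [e * f4] having been bounded into [k0]. *)
apply: (@le_trans _ _ (ex P (fun w => k0 + f1 w + f2 w + (1 + e) * (f3 w - f4 w)))); last first.
  rewrite exD//; last exact: LoneD.
  rewrite exD// exD//; last exact: Lone_cst.
  rewrite exZ; last exact: LoneB.
  rewrite exB// e2 addr0 ex_cst /k0.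
  have : (1 + e) * (ex P f3 - ex P f4) <= 0.
    by rewrite mulr_ge0_le0 ?subr_le0// addr_ge0// ltW.
  by rewrite /f1; lra.
apply: ex_le.
- exact: step_Lone.
- by apply: LoneD => //; exact: LoneD.
move=> w; have sp := step_pointwise w; have w0 := weight_ge0 w; have w1 := weight_le1 w.
set g := J (gm ^~ w) in sp *.
have g0 : 0 <= g by apply: itv_int_ge0 => r; exact: gam_ge0.
have gb : g <= Cg * (u - s) by have := gam_int_bound w; rewrite -/g ger0_norm.
pose D i := J (drift i ^~ w).
have D2 i : D i ^+ 2 <= (C * (u - s)) ^+ 2.
  by rewrite -real_normK ?num_real// lerXn2r ?nnegrE ?mulr_ge0// drift_int_bound.
have S2 : \sum_i D i ^+ 2 <= d%:R * (C * (u - s)) ^+ 2.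
  rewrite [leRHS](_ : _ = \sum_(i < d) (C * (u - s)) ^+ 2); first exact: ler_sum.
  by rewrite sumr_const card_ord mulr_natl.
have ei : 0 <= 1 + e^-1 by rewrite addr_ge0// invr_ge0 ltW.
have main : \sum_i (2 * X s w i 0 * (D i + mart i w) + (D i + mart i w) ^+ 2) <=
    \sum_i 2 * X s w i 0 * D i + (1 + e^-1) * \sum_i D i ^+ 2 +
    \sum_i 2 * X s w i 0 * mart i w + (1 + e) * \sum_i mart i w ^+ 2.
  rewrite !mulr_sumr -!big_split/=; apply: ler_sum => i _.
  have := sqr_split (mart i w) (D i + mart i w) e0.
  by rewrite addrK; set q := mart i w; lra.
have q1 : weight w * g <= Cg * (u - s).
  by apply: le_trans gb; rewrite ler_piMl.
have q2 : weight w * ((1 + e^-1) * \sum_i D i ^+ 2) <=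
    (1 + e^-1) * (d%:R * (C * (u - s)) ^+ 2).
  rewrite mulrCA ler_wpM2l//; apply: le_trans S2; rewrite ler_piMl//.
  by apply: sumr_ge0 => i _; exact: sqr_ge0.
apply: le_trans (ler_wpM2l w0 main) _.
rewrite !mulrDr /k0 /f1 /f2 /f3 /f4 -/g.
have -> : \sum_i weight w * (2 * X s w i 0) * mart i w =
    weight w * \sum_i 2 * X s w i 0 * mart i w.
  by rewrite mulr_sumr; apply: eq_bigr => i _; rewrite !mulrA.
have q3 : e * (weight w * g) <= e * (Cg * (u - s)) by rewrite ler_wpM2l// ltW.
rewrite -mulr_sumr; move: sp q2; rewrite mulrDr.
rewrite -[\sum_i 2 * X s w i 0 * J _]/(\sum_i 2 * X s w i 0 * D i).
by move=> sp q2; lra.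
Qed.

End one_step.

(** * The limit of vanishing mesh *)

Section grid.
Context {R : realType}.

Lemma grid_indic (e : R) (m : nat) (r : R) : 0 <= e ->
  \sum_(k < m) \1_(`]k%:R * e, k.+1%:R * e]%classic : set R) r =
  \1_(`]0, m%:R * e]%classic : set R) r :> R.
Proof.
move=> e0; elim: m => [|m ih].
  by rewrite big_ord0 mul0r set_itvoc0 indic0.
rewrite big_ord_recr/= ih !indicE !mem_setE !in_itv/=.
have me : m%:R * e <= m.+1%:R * e by rewrite ler_wpM2r// ler_nat.
have me0 : 0 <= m%:R * e by rewrite mulr_ge0.
have [r0|r0]/= := ltP 0 r; last first.
  by rewrite (ltNge _ r) (le_trans r0 me0)/= addr0.
by have [rm|rm]/= := leP r (m%:R * e); rewrite ?(le_trans rm me) ?addr0 ?add0r.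
Qed.

End grid.

Section discretisation_error.
Context {R : realType} {dT : measure_display} {T : measurableType dT} {d : nat}.
Variable P : probability T R.
Notation lam := (@lebesgue_measure R).
Variable F : R -> set (set T).
Hypothesis Fsigma : forall t, 0 <= t -> sigma_algebra setT (F t).
Hypothesis Fmeas : forall t, 0 <= t -> F t `<=` measurable.
Hypothesis Fmono : forall s t, 0 <= s -> s <= t -> F s `<=` F t.
Variables (kappa : R) (zeta : R -> R).
Hypothesis kappa_gt0 : 0 < kappa.
Hypothesis zeta_ge1 : forall r, 0 <= r -> 1 <= zeta r.
Hypothesis zeta_nd : forall r s, 0 <= r -> r <= s -> zeta r <= zeta s.
Hypothesis zeta_C1 : C1_halfline zeta.
Notation hx x := (growth_rate zeta (enorm x ^+ 2)).
Variable X : R -> T -> 'cV[R]_d.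
Hypothesis aX : adapted F X.
Hypothesis cX : forall n w,
  cadlag_on [set t | 0 <= t /\ (t%:E <= exit_time X n w)%E] (X ^~ w).
Notation tau := (exit_time X).
Variables (n : nat) (C : R) (C0 : 0 <= C) (A0 : set T) (FA0 : F 0 A0).
Variables (t : R) (t0 : 0 < t).

Definition tick (K k : nat) : R := k%:R * (t / K.+1%:R).

Let mesh0 K : 0 < t / K.+1%:R. Proof. by rewrite divr_gt0. Qed.

Lemma tick_ge0 K k : 0 <= tick K k.
Proof. by rewrite mulr_ge0// ltW. Qed.

Lemma tick_le K k : tick K k <= tick K k.+1.
Proof. by rewrite ler_wpM2r ?ler_nat// ltW. Qed.

Lemma tick_diff K k : tick K k.+1 - tick K k = t / K.+1%:R.
Proof. by rewrite /tick -mulrBl -natrB// subSnn mul1r. Qed.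

Lemma tick_last K : tick K K.+1 = t.
Proof. by rewrite /tick mulrC divfK// pnatr_eq0. Qed.

Lemma tick_first K : tick K 0 = 0. Proof. by rewrite /tick mul0r. Qed.

Notation fe K k := (frozen_error kappa zeta X n C (tick K k) A0).

Definition grid_error (K : nat) (r : R) (w : T) : R :=
  \sum_(k < K.+1) \1_(`]tick K k, tick K k.+1]%classic : set R) r * fe K k r w.

Definition total_error (K : nat) (w : T) : R :=
  \sum_(k < K.+1) \int[lam]_(r in `]tick K k, tick K k.+1]) fe K k r w.

Let B := error_bound (d := d) kappa zeta n C.

Let fe_bm K k w : bounded_meas (fe K k ^~ w).
Proof.
exact: (frozen_error_bm Fsigma Fmeas Fmono kappa_gt0 zeta_ge1 zeta_nd zeta_C1 aX cX
  n C0 (tick_ge0 K k) FA0 w).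
Qed.

Let gfe_bm K k w : bounded_meas
  (fun r => \1_(`]tick K k, tick K k.+1]%classic : set R) r * fe K k r w).
Proof.
have [m [M HM]] := fe_bm K k w; split; first exact: measurable_funM.
exists M => r; rewrite indicE; case: (_ \in _); rewrite ?mul1r// mul0r normr0.
exact: le_trans (normr_ge0 _) (HM r).
Qed.

Lemma total_errorE K w : total_error K w = \int[lam]_(r in `]0, t]) grid_error K r w.
Proof.
rewrite itv_int_sum//; apply: eq_bigr => k _.
have E : `]0, t] `&` `]tick K k, tick K k.+1] = `]tick K k, tick K k.+1]%classic :> set R.
  apply/seteqP; split => [r [_]//|r /=]; rewrite !in_itv/= => /andP[r1 r2].
  rewrite r1 r2 (le_lt_trans (tick_ge0 K k) r1) -[X in _ <= X](tick_last K).
  split=> //; apply: le_trans r2 _.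
  by rewrite ler_wpM2r ?ler_nat// ltW.
transitivity (\int[lam]_(r in `]0, t] `&` `]tick K k, tick K k.+1]) fe K k r w).
  by rewrite E.
rewrite Rintegral_mkcondr; apply: eq_Rintegral => r _.
by rewrite patchE indicE; case: (_ \in _); rewrite ?mul1r ?mul0r.
Qed.

(** At most one cell contains [r], so the sum has at most one nonzero term. *)
Lemma grid_error_le K r w a : 0 <= a ->
  (forall k, (k <= K)%N -> tick K k < r -> r <= tick K k.+1 -> fe K k r w <= a) ->
  grid_error K r w <= a.
Proof.
move=> a0 H; apply: (@le_trans _ _ (\1_(`]0, K.+1%:R * (t / K.+1%:R)]%classic : set R) r * a)).
  rewrite -grid_indic ?mulr_suml; last by rewrite ltW.
  apply: ler_sum => k _; rewrite indicE; case: (boolP (_ \in _)); last by rewrite !mul0r.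
  rewrite mem_setE in_itv/= => /andP[r1 r2]; rewrite !mul1r; apply: H => //.
  by rewrite -ltnS.
by rewrite indicE; case: (_ \in _); rewrite ?mul1r ?mul0r.
Qed.

Lemma grid_error_ge0 K r w : 0 <= grid_error K r w.
Proof.
apply: sumr_ge0 => k _; rewrite mulr_ge0//.
exact: frozen_error_ge0.
Qed.

Let B0 : 0 <= B.
Proof. exact: le_trans (frozen_error_ge0 zeta kappa_gt0 X n C0 0 A0 0 point)
  (frozen_error_le kappa_gt0 zeta_ge1 zeta_nd X n C0 0 A0 0 point). Qed.

Lemma grid_error_bound K r w : grid_error K r w <= B.
Proof. by apply: grid_error_le => // k _ _ _; exact: frozen_error_le. Qed.

(** The tick that opens the cell of [r] lies strictly before [r], within the mesh of it:
    left-continuity of the path at [r] is exactly what makes the error vanish. *)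
Lemma grid_error_cvg r w : 0 < r ->
  ((r%:E <= tau n w)%E -> (r%:E < tau n w)%E /\ X v w @[v --> r^'-] --> X r w) ->
  grid_error K r w @[K --> \oo] --> 0.
Proof.
move=> r0 lX; have [rt|rt] := boolP (r%:E <= tau n w)%E; last first.
  rewrite (_ : (fun K => _) = cst 0); first exact: cvg_cst.
  apply/funext => K; apply: big1 => k _; rewrite /frozen_error /active.
  rewrite (_ : (r%:E < _)%E = false) ?andbF ?mulr0//.
  by apply/negbTE; apply: contra rt => /ltW.
have {lX}[rt' lX] := lX rt.
pose Phi (y : 'cV[R]_d) := kappa * `|hx (X r w) - hx y| +
    \sum_i 2 * C * `|y i 0 - X r w i 0|.
have cPhi : continuous Phi.
  move=> y; apply: (@continuousD _ _ _ (fun y => kappa * `|hx (X r w) - hx y|)).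
    apply: continuousM; first exact: cst_continuous.
    apply: (continuous_comp (f := fun y : 'cV[R]_d => hx (X r w) - hx y) (g := Num.norm));
      last exact: norm_continuous.
    by apply: continuousB; [exact: cst_continuous|exact: continuous_hx].
  apply: continuous_sum => i x.
  apply: (@continuousM _ _ (cst (2 * C)) (fun y : 'cV[R]_d => `|y i 0 - X r w i 0|) x).
    exact: cst_continuous.
  apply: (continuous_comp (f := fun y : 'cV[R]_d => y i 0 - X r w i 0) (g := Num.norm));
    last exact: norm_continuous.
  by apply: continuousB; [exact: coord_continuous|exact: cst_continuous].
have Phi0 : Phi (X r w) = 0.
  by rewrite /Phi subrr normr0 mulr0 add0r big1// => i _; rewrite subrr normr0 mulr0.
have cP : Phi (X v w) @[v --> r^'-] --> 0.
  by rewrite -Phi0; exact: (continuous_cvg _ (@cPhi (X r w)) lX).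
apply/cvgrPdist_le => e e0.
have [a /= a0 Ha] := cvgr_dist_le _ _ cP _ e0.
near=> K; rewrite sub0r normrN ger0_norm ?grid_error_ge0//.
have ta : t / K.+1%:R < a.
  rewrite mulrC -ltr_pdivlMr//; near: K.
  exact: (near_infty_natSinv_lt (PosNum (divr_gt0 a0 t0))).
apply: grid_error_le => [|k _ k1 k2]; first exact: ltW.
have rk : `|r - tick K k| < a.
  rewrite gtr0_norm ?subr_gt0//; apply: le_lt_trans ta.
  by rewrite -(tick_diff K k) lerD2r.
have le1 := Ha _ rk k1; rewrite sub0r normrN in le1; apply: le_trans le1.
apply: le_trans (ler_norm _).
have P0 : 0 <= Phi (X (tick K k) w).
  rewrite addr_ge0 ?mulr_ge0 ?(ltW kappa_gt0)//.
  by apply: sumr_ge0 => i _; rewrite !mulr_ge0.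
rewrite /frozen_error -/(Phi _); case: (kept01 X n (tick K k) A0 w) => [->|[-> _ _ _]].
  by rewrite mul0r.
by rewrite mul1r /active; case: (_ && _); rewrite ?mulr1 ?mulr0.
Unshelve. all: by end_near. Qed.

Lemma total_error_cvg w : total_error K w @[K --> \oo] --> 0.
Proof.
under eq_fun do rewrite total_errorE.
have mge K : bounded_meas (grid_error K ^~ w) by exact: bounded_meas_sum.
have [N N0 [mN HN]] := left_continuous_ae cX n w.
have [] := @dominated_convergence _ (measurableTypeR R) R lam `]0, t] (measurable_itv _)
    (fun K r => (grid_error K r w)%:E) (cst 0%E) (cst B%:E).
- by move=> K; apply/measurable_EFinP; apply: measurable_funTS; exact: (mge K).1.
- exact: measurable_cst.
- exists N; split => // r /= nr; apply: contrapT => Nr; apply: nr.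
  rewrite in_itv/= => /andP[r0 rt]; apply: cvg_EFin; first exact: nearW.
  by apply: grid_error_cvg => // rt'; exact: HN.
- exact: (bounded_meas_int 0 t (bounded_meas_cst B)).
- apply: aeW => r K _ /=; rewrite lee_fin ger0_norm ?grid_error_ge0//.
  exact: grid_error_bound.
move=> _ _; rewrite integral0 => /fine_cvg; exact.
Qed.

Lemma total_error_meas K : measurable_fun setT (total_error K).
Proof.
apply: measurable_sum => k.
exact: (frozen_int_meas Fsigma Fmeas Fmono kappa_gt0 zeta_ge1 zeta_nd zeta_C1 aX cX
  n C0 (tick_ge0 K k) (tick_le K k) FA0).
Qed.

Lemma total_error_bound K w : `|total_error K w| <= B * t.
Proof.
rewrite total_errorE -[X in B * X]subr0; apply: itv_int_abs => //; first exact: ltW.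
  exact: bounded_meas_sum.
by move=> r; rewrite ger0_norm ?grid_error_ge0// grid_error_bound.
Qed.

Lemma total_error_ex : ex P (total_error K) @[K --> \oo] --> 0.
Proof.
rewrite -[X in _ --> X](ex_cst P 0).
apply: (@ex_dominated _ _ _ P total_error (cst 0) (cst (B * t))).
- exact: total_error_meas.
- exact: measurable_cst.
- exact: Lone_cst.
- by apply: aeW => w; exact: total_error_cvg.
- by apply: aeW => w K; exact: total_error_bound.
Qed.

End discretisation_error.

Lemma sum_step_le {R : numDomainType} (K : nat) (x y z : R) (g S : nat -> R) :
  (forall k, g k <= x + S k + y + z) ->
  \sum_(k < K) g k <= K%:R * x + \sum_(k < K) S k + K%:R * y + K%:R * z.
Proof.
move=> gS; apply: (@le_trans _ _ (\sum_(k < K) (x + S k + y + z))); first exact: ler_sum.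
have cs a : \sum_(k < K) a = K%:R * a by rewrite sumr_const card_ord mulr_natl.
by rewrite !big_split/= !cs.
Qed.

Lemma ex_ae_le {R : realType} {dT : measure_display} {T : measurableType dT}
    (P : probability T R) (f g : T -> R) : Lone P f -> Lone P g ->
  {ae P, forall w, f w <= g w} -> ex P f <= ex P g.
Proof.
move=> Lf Lg fg; have mf := Lone_meas Lf; have mg := Lone_meas Lg.
have mh : measurable_fun setT (fun w => Num.max (f w) (g w)) by exact: measurable_maxr.
have gh : {ae P, forall w, g w = Num.max (f w) (g w)}.
  by apply: filterS fg => w fgw; rewrite max_r.
have Lh := Lone_ae mh gh Lg.
rewrite (ex_ae mg mh gh); apply: ex_le => // w.
by rewrite le_max lexx.
Qed.

(** * The estimate of the exit probability *)

Section exit_estimate.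
Context {R : realType} {dT : measure_display} {T : measurableType dT} {d : nat}.
Context {dU : measure_display} {U : measurableType dU}.
Variable P : probability T R.
Notation lam := (@lebesgue_measure R).
Variable F : R -> set (set T).
Hypothesis Fsigma : forall t, 0 <= t -> sigma_algebra setT (F t).
Hypothesis Fmeas : forall t, 0 <= t -> F t `<=` measurable.
Hypothesis Fmono : forall s t, 0 <= s -> s <= t -> F s `<=` F t.
Variable nu : {sigma_finite_measure set U -> \bar R}.
Variables (b : 'cV[R]_d -> 'cV[R]_d) (sigma : 'cV[R]_d -> 'M[R]_d)
  (c : 'cV[R]_d -> U -> 'cV[R]_d).
Hypotheses (b_cont : continuous b) (sigma_cont : continuous sigma).
Hypothesis c_meas1 : forall x i, measurable_fun setT (fun u => c x u i 0).
Hypothesis c_int : forall x, (\int[nu]_u (enorm (c x u) ^+ 2)%:E < +oo)%E.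
Hypothesis c_int_cont : continuous (jump_energy nu c).
Variables (kappa : R) (zeta : R -> R).
Hypothesis kappa_gt0 : 0 < kappa.
Hypothesis zeta_ge1 : forall r, 0 <= r -> 1 <= zeta r.
Hypothesis zeta_nd : forall r s, 0 <= r -> r <= s -> zeta r <= zeta s.
Hypothesis zeta_C1 : C1_halfline zeta.
Notation hx x := (growth_rate zeta (enorm x ^+ 2)).
Hypothesis growth : forall x,
  2 * dotv x (b x) + enorm (sigma x) ^+ 2 + jump_energy nu c x <= kappa * hx x.
Variables (W : R -> T -> 'cV[R]_d) (W_BM : brownian_motion P F W).
Variables (p : R -> T -> option U) (p_PPP : poisson_point_process P F nu p).
Variable X : R -> T -> 'cV[R]_d.
Hypothesis aX : adapted F X.
Hypothesis cX : forall n w,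
  cadlag_on [set t | 0 <= t /\ (t%:E <= exit_time X n w)%E] (X ^~ w).
Notation tau := (exit_time X).
Variable n : nat.
Notation drift := (drift_part b X n).
Notation Xs t w := (X (stopped_time X n t w) w).

Definition solution_at (t : R) (IW : 'I_d -> 'I_d -> T -> R) (IN : 'I_d -> T -> R) : Prop :=
  [/\ forall i j, is_ito_integral P F (fun s w => W s w j 0)
        (diffusion_part sigma X n i j) t (IW i j),
      forall i, is_compensated_integral P F nu (jump_measure p)
        (jump_part c X n i) t (IN i) &
      {ae P, forall w, forall i : 'I_d, Xs t w i 0 = X 0 w i 0
        + \int[lam]_(s in `]0, stopped_time X n t w]) (b (X s w) i 0)
        + \sum_(j < d) IW i j w + IN i w}].

Variables (C : R) (C0 : 0 <= C).
Hypothesis b_bound : forall x i, enorm x <= n%:R -> `|b x i 0| <= C.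

Lemma drift_increment i s u w : 0 <= s -> s <= u ->
  \int[lam]_(r in `]0, u]) (drift i r w) - \int[lam]_(r in `]0, s]) (drift i r w) =
  \int[lam]_(r in `]s, u]) (drift i r w).
Proof.
move=> s0 su; apply: Rintegral_itvB; rewrite ?bnd_simp//.
by apply: bounded_meas_int; exact: (drift_bm Fsigma Fmeas Fmono b_cont aX cX C0 b_bound).
Qed.

(** On paths alive and inside the ball at [s] this is [lyap_increment], the equation at [s] and at
    [u] giving the increments of the coordinates. On the others the exit has occurred by [s]: the
    stopped path no longer moves, and [kept] annihilates [step]. *)
Lemma lyap_step A0 s u IW IW' IN IN' : 0 <= s -> s <= u ->
  solution_at s IW IN -> solution_at u IW' IN' ->
  {ae P, forall w, A0 w ->
    lyap zeta (enorm (Xs u w) ^+ 2) - lyap zeta (enorm (Xs s w) ^+ 2) <=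
    step b zeta X n s u A0 IW IW' IN IN' w}.
Proof.
move=> s0 su [_ _ es] [_ _ eu]; have u0 := le_trans s0 su.
apply: filterS2 es eu => w es eu A0w.
have [/andP[st Xn]|dead] := boolP ((s%:E <= tau n w)%E && (enorm (X s w) <= n%:R)).
  have k1 : kept X n s A0 w = 1.
    by rewrite /kept !indicE !mem_set// !mulr1.
  have dm i := drift_meas Fsigma Fmeas Fmono b_cont aX cX n i.
  have db i := drift_bound X C0 b_bound i.
  pose D i := \int[lam]_(r in `]s, u]) (drift i r w) +
    total_increment (IW i) (IW' i) (IN i) (IN' i) w.
  have inc i : Xs u w i 0 = X s w i 0 + D i.
    have := es i; rewrite stopped_before// => ->; rewrite eu.
    have := drift_stopped (dm i) (db i) w s0; rewrite stopped_before// => ->.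
    rewrite (drift_stopped (dm i) (db i) w u0) /D -(drift_increment i w s0 su).
    rewrite /total_increment sumrB; ring.
  rewrite (stopped_before st) /step /weight k1 div1r mulrC.
  apply: le_trans (lyap_increment zeta_ge1 zeta_nd (sqr_ge0 _) (sqr_ge0 _)) _.
  rewrite ler_wpM2r ?invr_ge0 ?(ltW (growth_rate_gt0 _ _))//.
  rewrite !enorm_cV_sqr -sumrB le_eqVlt; apply/orP; left; apply/eqP.
  by apply: eq_bigr => i _; rewrite inc -/(D i); ring.
have ts : (tau n w <= s%:E)%E.
  move: dead; rewrite negb_and => /orP[|]; first by rewrite -ltNge => /ltW.
  by rewrite -ltNge; exact: exit_time_le.
have -> : stopped_time X n u w = stopped_time X n s w.
  by rewrite /stopped_time !min_r// (le_trans ts)// lee_fin.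
rewrite subrr /step /weight; case: (kept01 X n s A0 w) => [->|[_ _ st Xn]].
  by rewrite !mul0r.
by move: dead; rewrite st Xn.
Qed.

Variable m : nat.
Let A0 : set T := [set w | enorm (X 0 w) <= m%:R].

Let FA0 : F 0 A0.
Proof.
have := adapted_continuous Fsigma aX (@continuous_enorm _ _ _) (lexx 0).
move=> /(meas_wrtP _ (Fsigma (lexx 0)))/(_ _ (measurable_itv `]-oo, m%:R])).
by congr (F 0 _); apply/seteqP; split => w /=; rewrite in_itv.
Qed.

Lemma exit_event_meas t : 0 <= t ->
  measurable (A0 `&` [set w | (tau n w < t%:E)%E]).
Proof.
move=> t0; apply: measurableI; first exact: (Fmeas (lexx 0) FA0).
have := Fmeas t0 (alive_meas Fsigma Fmono aX cX n t0) => /measurableC.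
by congr measurable; apply/seteqP; split => w /=; rewrite leNgt; [move/negP; rewrite negbK|move=> ->].
Qed.

Variables (Cg : R) (Cg0 : 0 <= Cg).
Hypothesis gam_bound : forall x, enorm x <= n%:R ->
  enorm (sigma x) ^+ 2 + jump_energy nu c x <= Cg.
Hypothesis sol : forall t, 0 <= t -> exists IW IN, solution_at t IW IN.

(** The bounds [lyap_step] telescope over the ticks. At time [t] the stopped path has norm at least
    [n] on the exit event, and [lyap] is nonnegative elsewhere. In the second-order term, [K + 1]
    steps with squared mesh leave one factor [t / (K + 1)]. *)
Lemma exit_estimate_mesh t (e : R) K : 0 < t -> 0 < e ->
  lyap zeta (n%:R ^+ 2) * fine (P (A0 `&` [set w | (tau n w < t%:E)%E])) <=
  lyap zeta (m%:R ^+ 2) + kappa * t + ex P (total_error kappa zeta X n C A0 t K) +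
  (1 + e^-1) * (d%:R * C ^+ 2 * t * (t / K.+1%:R)) + e * (Cg * t).
Proof.
move=> t0 e0; have t0' := ltW t0.
have /choice[q Hq] : forall r : R, exists q : ('I_d -> 'I_d -> T -> R) * ('I_d -> T -> R),
    0 <= r -> solution_at r q.1 q.2.
  move=> r; have [r0|r0] := pselect (0 <= r); last by exists ((fun _ _ => cst 0), (fun _ => cst 0)).
  by have [IW [IN H]] := sol r0; exists (IW, IN).
pose tk k := tick t K k.
have tk0 k : 0 <= tk k by exact: tick_ge0.
have tkS k : tk k <= tk k.+1 by exact: tick_le.
pose g k := step b zeta X n (tk k) (tk k.+1) A0 (q (tk k)).1 (q (tk k.+1)).1
  (q (tk k)).2 (q (tk k.+1)).2.
have S k := Hq _ (tk0 k).
have Lg k : Lone P (g k).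
  have [a1 a2 _] := S k; have [b1 b2 _] := S k.+1.
  exact: (step_Lone Fsigma Fmeas Fmono b_cont zeta_ge1 zeta_C1 W_BM p_PPP aX cX C0 b_bound
    (tk0 k) (tkS k) FA0 a1 b1 a2 b2).
have eg k : ex P (g k) <= kappa * (t / K.+1%:R) +
    ex P (fun w => \int[lam]_(r in `]tk k, tk k.+1])
      frozen_error kappa zeta X n C (tk k) A0 r w) +
    (1 + e^-1) * (d%:R * (C * (t / K.+1%:R)) ^+ 2) + e * (Cg * (t / K.+1%:R)).
  have [a1 a2 _] := S k; have [b1 b2 _] := S k.+1; rewrite -(tick_diff t K k).
  exact: (step_expectation Fsigma Fmeas Fmono b_cont sigma_cont c_meas1 c_int c_int_cont
    kappa_gt0 zeta_ge1 zeta_nd zeta_C1 growth W_BM p_PPP aX cX C0 b_bound Cg0 gam_bound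
    (tk0 k) (tkS k) FA0 a1 b1 a2 b2 e0).
set E := A0 `&` _; have mE : measurable E by exact: exit_event_meas.
have LE : Lone P (fun w => lyap zeta (n%:R ^+ 2) * \1_E w).
  apply: LoneZ; apply: (@Lone_bounded _ _ _ _ _ 1); first exact: measurable_indic.
  by move=> w; rewrite indicE; case: (_ \in _); rewrite ?normr1 ?normr0.
have Ls : Lone P (fun w => \sum_(k < K.+1) g k w) by exact: Lone_sum.
have Lr : Lone P (fun w => lyap zeta (m%:R ^+ 2) + \sum_(k < K.+1) g k w).
  by apply: LoneD => //; exact: Lone_cst.
have path : {ae P, forall w, lyap zeta (n%:R ^+ 2) * \1_E w <=
    lyap zeta (m%:R ^+ 2) + \sum_(k < K.+1) g k w}.
  have steps : {ae P, forall w k, A0 w ->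
      lyap zeta (enorm (Xs (tk k.+1) w) ^+ 2) - lyap zeta (enorm (Xs (tk k) w) ^+ 2) <= g k w}.
    by apply: ae_foralln => k; exact: lyap_step.
  apply: filterS steps => w steps.
  (* Paths started outside [A0] have weight 0 in every step and do not belong to [E]. *)
  have [Aw|Aw] := pselect (A0 w); last first.
    rewrite indicE memNset ?mulr0; last by move=> [].
    rewrite big1 ?addr0 ?lyap_ge0// => k _; rewrite /g /step /weight.
    by case: (kept01 X n (tk k) A0 w) => [->|[_ //]]; rewrite !mul0r.
  have tel : lyap zeta (enorm (Xs t w) ^+ 2) - lyap zeta (enorm (X 0 w) ^+ 2) <=
      \sum_(k < K.+1) g k w.
    have X0E : X 0 w = Xs (tk 0) w.
      by rewrite /tk tick_first stopped_before// exit_time_ge0.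
    rewrite X0E -[X in Xs X w](tick_last t K) -/(tk K.+1).
    rewrite -(telescope_sumr (fun k => lyap zeta (enorm (Xs (tk k) w) ^+ 2)) (leq0n K.+1)).
    by rewrite big_mkord; apply: ler_sum => k _; exact: steps.
  have mon (x y : R) : 0 <= x -> x <= y -> lyap zeta (x ^+ 2) <= lyap zeta (y ^+ 2).
    move=> x0 xy; apply: lyap_nd => //.
    by rewrite lerXn2r ?nnegrE// (le_trans x0).
  have l0 := mon _ _ (enorm_ge0 _) Aw.
  have l1 : lyap zeta (n%:R ^+ 2) * \1_E w <= lyap zeta (enorm (Xs t w) ^+ 2).
    rewrite indicE; case: (boolP (w \in E)) => [/set_mem[_ /= tt]|_].
      by rewrite mulr1; apply: mon => //; exact: stopped_value.
    by rewrite mulr0 lyap_ge0.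
  apply: le_trans l1 _; rewrite -lerBlDl; apply: le_trans tel.
  by rewrite lerD2l lerN2.
have le1 : lyap zeta (n%:R ^+ 2) * fine (P E) <=
    lyap zeta (m%:R ^+ 2) + \sum_(k < K.+1) ex P (g k).
  rewrite -(ex_indic P mE) -exZ; last first.
    apply: (@Lone_bounded _ _ _ _ _ 1); first exact: measurable_indic.
    by move=> w; rewrite indicE; case: (_ \in _); rewrite ?normr1 ?normr0.
  rewrite -ex_sum// -[X in X + _](ex_cst P) -exD//; last exact: Lone_cst.
  exact: ex_ae_le.
apply: le_trans le1 _.
have K1 : K.+1%:R != 0 :> R by rewrite pnatr_eq0.
have le2 := sum_step_le K.+1 eg.
have -> : ex P (total_error kappa zeta X n C A0 t K) =
    \sum_(k < K.+1) ex P (fun w => \int[lam]_(r in `]tk k, tk k.+1])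
      frozen_error kappa zeta X n C (tk k) A0 r w).
  rewrite -ex_sum// => k.
  apply: (@Lone_bounded _ _ _ _ _ (error_bound (d := d) kappa zeta n C * (tk k.+1 - tk k))).
    exact: (frozen_int_meas Fsigma Fmeas Fmono kappa_gt0 zeta_ge1 zeta_nd zeta_C1 aX cX
      n C0 (tk0 k) (tkS k) FA0).
  exact: (frozen_int_bound Fsigma Fmeas Fmono kappa_gt0 zeta_ge1 zeta_nd zeta_C1 aX cX
    n C0 (tk0 k) (tkS k) FA0).
set V := \sum_(k < _) ex P (fun w => \int[lam]_(r in _) _) in le2 *.
have a1 : K.+1%:R * (kappa * (t / K.+1%:R)) = kappa * t
  by move: (K.+1%:R) K1 => N N1; field.
have a2 : K.+1%:R * ((1 + e^-1) * (d%:R * (C * (t / K.+1%:R)) ^+ 2)) =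
    (1 + e^-1) * (d%:R * C ^+ 2 * t * (t / K.+1%:R)) by move: (K.+1%:R) K1 => N N1; field; rewrite N1 gt_eqF.
have a3 : K.+1%:R * (e * (Cg * (t / K.+1%:R))) = e * (Cg * t)
  by move: (K.+1%:R) K1 => N N1; field.
rewrite a1 a2 a3 in le2; apply: le_trans (lerD (lexx _) le2) _.
by rewrite !addrA.
Qed.

(** The order of the limits matters: the mesh tends to 0 with [e] fixed, which removes the term with
    [1 + 1/e], and only then does [e] tend to 0. *)
Lemma exit_estimate t : 0 < t ->
  lyap zeta (n%:R ^+ 2) * fine (P (A0 `&` [set w | (tau n w < t%:E)%E])) <=
  lyap zeta (m%:R ^+ 2) + kappa * t.
Proof.
move=> t0; set L := (X in X <= _); set M := lyap zeta (m%:R ^+ 2) + kappa * t.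
have lim_mesh e : 0 < e -> L <= M + e * (Cg * t).
  move=> e0; have cv : M + ex P (total_error kappa zeta X n C A0 t K) +
      (1 + e^-1) * (d%:R * C ^+ 2 * t * (t * K.+1%:R^-1)) + e * (Cg * t) @[K --> \oo] -->
      M + 0 + (1 + e^-1) * (d%:R * C ^+ 2 * t * (t * 0)) + e * (Cg * t).
    apply: cvgD; last exact: cvg_cst.
    apply: cvgD.
      apply: cvgD; first exact: cvg_cst.
      exact: (total_error_ex P Fsigma Fmeas Fmono kappa_gt0 zeta_ge1 zeta_nd zeta_C1 aX cX
        n C0 FA0 t0).
    apply: cvgMr; apply: cvgMr; apply: cvgMr; exact: cvg_harmonic.
  rewrite !mulr0 !addr0 in cv.
  by apply: (cvgr_to_ge cv); apply: nearW => K; exact: exit_estimate_mesh.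
apply/ler_addgt0Pr => a a0.
have G0 : 0 < Cg * t + 1 by rewrite ltr_wpDl// mulr_ge0// ltW.
apply: le_trans (lim_mesh (a / (Cg * t + 1)) _) _; first by rewrite divr_gt0.
by rewrite lerD2l mulrAC ler_pdivrMr// ler_pM2l// lerDl.
Qed.

End exit_estimate.

(** * From exit times to the explosion time *)

Lemma exit_time_nd {R : realType} {dT : measure_display} {T : measurableType dT} {d : nat}
    (X : R -> T -> 'cV[R]_d) w : nondecreasing_seq (exit_time X ^~ w).
Proof.
move=> n m nm; apply: le_ereal_inf => _ [t [t0 mt] <-]; exists t => //.
by split => //; apply: le_lt_trans mt; rewrite ler_nat.
Qed.

(** Exit times increase to the explosion time, so the latter is finite exactly when an integer
    dominates them all. This writes explosion as a countable combination of measurable events. *)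
Lemma explosion_ltP {R : realType} {dT : measure_display} {T : measurableType dT} {d : nat}
    (X : R -> T -> 'cV[R]_d) w : (explosion_time X w < +oo)%E <->
  exists N : nat, forall n, (exit_time X n w < N.+1%:R%:E)%E.
Proof.
have cv := ereal_nondecreasing_cvgn (exit_time_nd X w).
have ub n : (exit_time X n w <= explosion_time X w)%E.
  by rewrite /explosion_time (cvg_lim _ cv)//; apply: ereal_sup_ubound; exists n.
split=> [ltoo|[N HN]].
  have e0 : (0 <= explosion_time X w)%E := le_trans (exit_time_ge0 X 0 w) (ub 0%N).
  exists (Num.truncn (fine (explosion_time X w))) => n.
  apply: le_lt_trans (ub n) _.
  by rewrite -(fineK (x := explosion_time X w)) ?ge0_fin_numE// lte_fin truncnS_gt.
apply: (@le_lt_trans _ _ N.+1%:R%:E); last exact: ltry.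
apply: lime_le; first by apply/cvg_ex; eexists; exact: cv.
by apply: nearW => n; exact: ltW.
Qed.

Theorem theorem2p2 (R : realType) (d : nat) (hd : (2 <= d)%N)
  (dU : measure_display) (U : measurableType dU)
  (nu : {sigma_finite_measure set U -> \bar R})
  (b : 'cV[R]_d -> 'cV[R]_d) (sigma : 'cV[R]_d -> 'M[R]_d)
  (c : 'cV[R]_d -> U -> 'cV[R]_d)
  (b_meas : measurable_fun setT (b : borel_mx R d 1 -> borel_mx R d 1))
  (sigma_meas : measurable_fun setT (sigma : borel_mx R d 1 -> borel_mx R d d))
  (c_meas : measurable_fun setT
    ((fun z => c z.1 z.2) : borel_mx R d 1 * U -> borel_mx R d 1))
  (b_cont : continuous b) (sigma_cont : continuous sigma)
  (c_cont : forall u, continuous (fun x => c x u))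
  (c_int : forall x, (\int[nu]_u (enorm (c x u) ^+ 2)%:E < +oo)%E)
  (c_int_cont : continuous (fun x => \int[nu]_u (enorm (c x u) ^+ 2)))
  (kappa : R) (zeta : R -> R)
  (kappa_gt0 : 0 < kappa)
  (zeta_ge1 : forall r, 0 <= r -> 1 <= zeta r)
  (zeta_nondecreasing : forall r s, 0 <= r -> r <= s -> zeta r <= zeta s)
  (zeta_C1 : C1_halfline zeta)
  (zeta_int : (\int[lebesgue_measure]_(r in `[0%R, +oo[)
                 ((r * zeta r + 1)^-1)%:E = +oo)%E)
  (growth : forall x : 'cV[R]_d,
    2 * dotv x (b x) + enorm (sigma x) ^+ 2
      + \int[nu]_u (enorm (c x u) ^+ 2)
    <= kappa * (enorm x ^+ 2 * zeta (enorm x ^+ 2) + 1))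
  (dT : measure_display) (T : measurableType dT) (P : probability T R)
  (F : R -> set (set T)) (F_usual : usual_conditions P F)
  (W : R -> T -> 'cV[R]_d) (W_BM : brownian_motion P F W)
  (p : R -> T -> option U) (p_PPP : poisson_point_process P F nu p)
  (W_p_indep : independent_BM_PP P W p)
  (X : R -> T -> 'cV[R]_d)
  (X_sol : sde_solution nu b sigma c P F W p X) :
  non_explosive P X.

Proof.
have [Fsm Fmono _ _] := F_usual.
have Fsigma t : 0 <= t -> sigma_algebra setT (F t) by move=> /Fsm[].
have Fmeas t : 0 <= t -> F t `<=` measurable by move=> /Fsm[].
have [aX cX sol] := X_sol.
have c_meas1 x i : measurable_fun setT (fun u => c x u i 0).
  have m1 := continuous_borel_mx (@coord_continuous R d 1 i 0).
  have m2 : measurable_fun setT (fun u : U => (x, u) : borel_mx R d 1 * U).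
    by apply: measurable_fun_pair => //; exact: measurable_cst.
  exact: (measurableT_comp m1 (measurableT_comp c_meas m2)).
have growth' x : 2 * dotv x (b x) + enorm (sigma x) ^+ 2 + jump_energy nu c x <=
    kappa * growth_rate zeta (enorm x ^+ 2).
  by rewrite growth_rateE ?sqr_ge0//; exact: growth.
(* On this [F 0]-event the initial value of [lyap] is at most [lyap (m^2)]; these events exhaust the
   sample space as [m] grows. *)
pose A m := [set w | enorm (X 0 w) <= m%:R].
have estimate m n t : 0 < t ->
    lyap zeta (n%:R ^+ 2) * fine (P (A m `&` [set w | (exit_time X n w < t%:E)%E])) <=
    lyap zeta (m%:R ^+ 2) + kappa * t.
  move=> t0.
  have cb : continuous (fun x => enorm (b x)).
    move=> x; apply: (continuous_comp (f := b) (g := @enorm R d 1)); first exact: b_cont.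
    exact: continuous_enorm.
  have [C [C0 HC]] := continuous_bounded_ball n%:R cb.
  have cg : continuous (fun x => enorm (sigma x) ^+ 2 + jump_energy nu c x).
    move=> x; apply: (@continuousD _ _ _ (fun x => enorm (sigma x) ^+ 2) _ x).
      exact: (continuous_enorm_sqr sigma_cont).
    exact: c_int_cont.
  have [Cg [Cg0 HCg]] := continuous_bounded_ball n%:R cg.
  have b_bound x i : enorm x <= n%:R -> `|b x i 0| <= C.
    move=> xn; apply: le_trans (enorm_entry _ _) _.
    by apply: le_trans (HC _ xn); exact: ler_norm.
  have gam_bound x : enorm x <= n%:R -> enorm (sigma x) ^+ 2 + jump_energy nu c x <= Cg.
    by move=> xn; apply: le_trans (HCg _ xn); exact: ler_norm.
  exact: (exit_estimate Fsigma Fmeas Fmono b_cont sigma_cont c_meas1 c_int c_int_cont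
    kappa_gt0 zeta_ge1 zeta_nondecreasing zeta_C1 growth' W_BM p_PPP aX cX C0 b_bound m
    Cg0 gam_bound (sol n) t0).
have mE m n N : measurable (A m `&` [set w | (exit_time X n w < N.+1%:R%:E)%E]).
  exact: (exit_event_meas Fsigma Fmeas Fmono aX cX).
pose E m N := \bigcap_n (A m `&` [set w | (exit_time X n w < N.+1%:R%:E)%E]).
have mEE m N : measurable (E m N) by exact: bigcapT_measurable.
have E0 m N : P (E m N) = 0%E.
  apply/eqP; rewrite eq_le measure_ge0 andbT leNgt; apply/negP => EP.
  have fE : P (E m N) \is a fin_num by exact: fin_num_measure.
  have q0 : 0 < fine (P (E m N)) by rewrite -lte_fin fineK.
  set M := lyap zeta (m%:R ^+ 2) + kappa * N.+1%:R.
  (* For this [n], [lyap (n^2) * P (E m N)] is at least [M + 1]. As [E m N] is contained in the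
     event of the estimate for every [n], the estimate would bound the same product by [M]. *)
  have [n Hn] := lyap_unbounded zeta_ge1 zeta_nondecreasing zeta_int
    ((M + 1) / fine (P (E m N))).
  have := estimate m n _ (ltr0Sn R N); rewrite -/M leNgt => /negP; apply.
  apply: (@lt_le_trans _ _ (M + 1)); first by rewrite ltrDl.
  move: Hn; rewrite ler_pdivrMr// => /le_trans; apply.
  rewrite ler_wpM2l ?lyap_ge0//; apply: fine_le => //.
    exact: fin_num_measure.
  by apply: le_measure; [exact/mem_set|exact/mem_set|move=> w; exact].
rewrite /non_explosive.
have -> : [set w | (explosion_time X w < +oo)%E] = \bigcup_m \bigcup_N E m N.
  apply/seteqP; split => w /=.
    move=> /explosion_ltP[N HN]; exists (Num.truncn (enorm (X 0 w))).+1 => //.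
    exists N => // n _; split; last exact: HN.
    by rewrite /A /= ltW// truncnS_gt.
  by move=> [m _ [N _ H]]; apply/explosion_ltP; exists N => n; have [] := H n I.
have mU m : measurable (\bigcup_N E m N) by exact: bigcupT_measurable.
have : P.-negligible (\bigcup_m \bigcup_N E m N).
  apply: negligible_bigcup => m; apply: negligible_bigcup => N.
  by apply/negligibleP; [exact: mEE|exact: E0].
by move=> /negligibleP; apply; exact: bigcupT_measurable.
Qed.
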